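(* Let $F(x,y)\in\mathbb{Z}[x,y]$ be an irreducible binary form of degree $n\geq 3$ and let $m$ be a positive integer. Let $p_2$ be the smallest prime number $p$ satisfying $$p\geq m^{\frac{4}{n}}(3.5)^2 n^{\frac{2}{n-1}}.$$ Then the equation $|F(x,y)|=m$ has at most $(p_2+1)\left(9n+\frac{4}{n-1}\right)$ primitive solutions.
   Context: A pair $(x,y)\in\mathbb{Z}^2$ is a primitive solution of an equation in $x,y$ if it satisfies it and $\gcd(x,y)=1$. Solutions $(x,y)$ and $(-x,-y)$ are regarded as one and the same solution when counting. *)

(* Defs.v *)
From HB Require Import structures.
From mathcomp Require Import all_boot all_order all_algebra finmap.
From mathcomp Require Import all_classical all_reals all_analysis.
(* The notations of mpoly clash with those of the analysis library. *)
From mathcomp Require Import -(notations) mpoly.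

Set Implicit Arguments.
Unset Strict Implicit.
Unset Printing Implicit Defensive.

Import Order.TTheory GRing.Theory Num.Theory.

Local Open Scope classical_set_scope.
Local Open Scope ring_scope.

Notation "{ 'binary' A }" := (mpoly 2 A)
  (at level 0, A at level 200, format "{ 'binary'  A }") : type_scope.

Definition binary_eval (A : comNzRingType) (F : {binary A}) (x y : A) : A :=
  meval (tnth [tuple x; y]) F.

Definition is_form (A : nzRingType) (n : nat) (F : {binary A}) : Prop :=
  F \is ishomog1 n (@mdeg 2).

Definition irreducible_elt (A : idomainType) (a : A) : Prop :=
  [/\ a != 0, a \isn't a GRing.unit
    & forall b c : A, a = b * c -> b \is a GRing.unit \/ c \is a GRing.unit].

(* Irreducibility of an integral form is taken over the rationals: integer
   factors (a content different from 1) are disregarded. *)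
Definition irreducible_form (F : {binary int}) : Prop :=
  irreducible_elt (map_mpoly (intr : int -> rat) F : {binary rat}).

Definition primitive_solutions (F : {binary int}) (m : nat) :
    set (int * int) :=
  [set xy | `|binary_eval F xy.1 xy.2| = m%:Z /\ gcdz xy.1 xy.2 = 1].

(* The solutions up to sign, as the set of the classes {(x,y), (-x,-y)}. *)
Definition primitive_solutions_mod_sign (F : {binary int}) (m : nat) :
    set (set (int * int)) :=
  (fun xy : int * int => [set xy; - xy]) @` primitive_solutions F m.

(* Finiteness is part of the claim: fset_set is empty on an infinite set. *)
Definition card_at_most (R : realType) (T : choiceType) (A : set T) (b : R) :
    Prop :=
  finite_set A /\ (#|` fset_set A|)%fset%:R <= b.

Definition smallest_prime_ge (R : realType) (b : R) (p : nat) : Prop :=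
  [/\ prime p, b <= p%:R
    & forall q : nat, prime q -> b <= q%:R -> (p <= q)%N].

(* Main.v *)
(** Write F(x, y) = a * prod_i (x - al_i y) over the complex numbers, let M be the
    Mahler measure of F and D the square root of its discriminant.

    For a prime power N = p^e every primitive point lies in one of N + N / p
    sublattices of index N of Z^2, and restricting F to such a sublattice multiplies
    D^2 by N^(n (n - 1)). It is therefore enough to bound the number of solutions for
    forms of large discriminant; N is p2 if n >= 5, and a power of 2 between 8 (m + 1)
    and 16 m if n = 3 or 4. If there is a solution, one may moreover assume that
    |F(1, 0)| = m and that M is almost minimal among the equivalent forms with this
    property.

    Small solutions (y <= Y): moving a solution to (1, 0) and using that M is almost
    minimal shows that the product of the max(1, 1 / (2 y |x - al_i y|)) is at least
    M / (1.1 * 3^n m). For fixed i, two solutions with 2 y |x - al_i y| <= 1 satisfy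
    y' >= y * (1 / (2 y |x - al_i y|)), so the product of these factors over all
    solutions but one is at most Y. Hence there are at most n + n log Y / log (M / (1.1 * 3^n m))
    small solutions.

    Large solutions: the Lewis-Mahler inequality gives |x - al_i y| <= c / H^(n - 1)
    for the root al_i closest to x / y, where H = max(|x|, |y|) and c is small because
    D is large. So the heights of the solutions attached to one root grow like
    H' >= H^(n - 1) / (2 c). On the other hand the Thue-Siegel principle (a polynomial
    A(X) - Y B(X) vanishing to high order at the points (al_i, al_i), from Siegel's lemma,
    whose derivatives do not all vanish at a given rational point by a Wronskian
    argument) excludes two solutions of large height of which the second one is at least
    a fixed power of the first, and only a few solutions per root remain. *)

Require Import Defs.
From HB Require Import structures.
From mathcomp Require Import all_boot all_order all_algebra.
From mathcomp Require Import complex.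
From mathcomp Require Import reals.
From mathcomp.analysis Require Import sequences exp.
From mathcomp Require Import ring lra zify.

Set Implicit Arguments.
Unset Strict Implicit.
Unset Printing Implicit Defensive.

Import Order.TTheory GRing.Theory Num.Theory.

Local Open Scope ring_scope.

(** * Discriminants *)

(** How the two counts are balanced: M is not determined by the discriminant, so two scales occur,
    ln M and ln Q, where Q satisfies 2 c m Q^(n - 2) <= D with c = [gapc]. In these terms the
    constant of the gap principle is (M / Q)^(n - 2). If M is well below Q, the second solution
    attached to a root is already large and the gap principle alone suffices. Otherwise ln M is at
    least nearly ln Q, so it exceeds ln (1.1 * 3^n m) by enough that the small solutions, up to the
    height where the other count starts, cost at most C + 1 per root. Both cases have to stay below
    one bound B per sublattice. In degrees 3 and 4 a gap step raises heights only to the power 2 or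
    3, more steps are needed, and B exceeds 9 n. This is compensated by an index of order m: all
    sublattices together cost at most 24 m B, whereas the given prime has order m^(4 / n) with 4 / n
    >= 1. For n >= 5 the prime itself is the index and B = 9 n fits. *)

Definition splits_as (K : fieldType) n (f : {poly int}) (al : 'I_n -> K) : Prop :=
  [/\ size f = n.+1, injective al
    & map_poly (intr : int -> K) f =
      (lead_coef f)%:~R *: \prod_(i < n) ('X - (al i)%:P)].

Lemma splits_root (K : fieldType) n (f : {poly int}) (al : 'I_n -> K) i :
  splits_as f al -> (map_poly intr f).[al i] = 0.
Proof.
case=> _ _ ->; rewrite hornerZ horner_prod (bigD1 i) //= hornerXsubC subrr.
by rewrite mul0r mulr0.
Qed.

(** A resultant: z is the determinant of the Sylvester matrix of g and f, integral by construction.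
    It serves as the norm of the algebraic number g(al_i). *)
Lemma sylvester_norm (K : fieldType) n e (f g : {poly int}) (al : 'I_n -> K) :
  splits_as f al -> (size g <= e.+1)%N ->
  exists z : int,
    (lead_coef f)%:~R ^+ e * \prod_i (map_poly intr g).[al i] = z%:~R.
Proof.
move=> Hs sg; have [sf al_inj _] := Hs.
pose G := \matrix_(t < n, c < n + e) ('X^t * g)`_c.
pose Fm := \matrix_(s < e, c < n + e) ('X^s * f)`_c.
pose S : 'M[int]_(n + e) := col_mx G Fm.
exists (\det S).
pose V0 := \matrix_(c < n, i < n) (al i) ^+ c.
pose V1 := \matrix_(c < e, i < n) (al i) ^+ (n + c).
(* The columns of powers of [al i] evaluate the row polynomials at the roots: rows from f vanish,
   rows from g become g(al_i) times a Vandermonde row. The unit columns make U square and leave a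
   triangular block of determinant lead^e. *)
pose U : 'M[K]_(n + e) := block_mx V0 0 V1 1%:M.
have hV (p : {poly int}) (i : 'I_n) : (size p <= n + e)%N ->
    \sum_(c < n + e) (p`_c)%:~R * al i ^+ c = (map_poly intr p).[al i].
  move=> sp; rewrite (@horner_coef_wide _ (n + e)).
    by apply: eq_bigr => c _; rewrite coef_map.
  exact: leq_trans (size_poly _ _) sp.
have VE (c : 'I_(n + e)) i : col_mx V0 V1 c i = al i ^+ c.
  by rewrite mxE; case: splitP => j ->; rewrite mxE.
have szX (p : {poly int}) t : (size ('X^t * p)%R <= t + size p)%N.
  by rewrite mulrC; apply: leq_trans (size_polyMleq _ _) _; rewrite size_polyXn addnS addnC.
have GVE t i : (map_mx intr G *m col_mx V0 V1) t i =
    al i ^+ t * (map_poly intr g).[al i].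
  rewrite mxE; under eq_bigr => c _ do rewrite VE !mxE.
  rewrite hV; last first.
    apply: leq_trans (szX _ _) _; have := ltn_ord t; lia.
  by rewrite rmorphM /= map_polyXn hornerM hornerXn.
have FVE : map_mx intr Fm *m col_mx V0 V1 = 0.
  apply/matrixP=> s i; rewrite !mxE; under eq_bigr => c _ do rewrite VE !mxE.
  rewrite hV; last first.
    apply: leq_trans (szX _ _) _; have := ltn_ord s; rewrite sf; lia.
  by rewrite rmorphM /= map_polyXn hornerM (splits_root _ Hs) mulr0.
pose E0 : 'M[K]_(n + e, e) := col_mx 0 1%:M.
have EE (c : 'I_(n + e)) s : E0 c s = (c == n + s :> nat)%:R.
  rewrite mxE; case: splitP => j ->; rewrite mxE.
    by rewrite [LHS]/= ltn_eqF // (leq_trans (ltn_ord j)) // leq_addr.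
  by rewrite eqn_add2l.
have FEE : \det (map_mx intr Fm *m E0) = (lead_coef f)%:~R ^+ e.
  have FEE0 s s' : (map_mx intr Fm *m E0) s s' = (('X^s * f)`_(n + s'))%:~R.
    rewrite mxE (bigD1 (rshift n s')) //= EE eqxx mulr1 !mxE big1 ?addr0 // => c.
    by rewrite EE -val_eqE /= => /negPf->; rewrite mulr0.
  rewrite det_trig.
    under eq_bigr => s _ do rewrite FEE0 coefXnM ltnNge leq_addl /= addnK.
    by rewrite prodr_const card_ord /lead_coef sf.
  apply/is_trig_mxP => s s' lt_ss'; rewrite FEE0 coefXnM.
  case: ltnP => // _; rewrite nth_default ?rmorph0 // sf; lia.
have UE : U = row_mx (col_mx V0 V1) E0 by rewrite /U block_mxEh.
have SU : map_mx intr S *m U = block_mx (map_mx intr G *m col_mx V0 V1)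
    (map_mx intr G *m E0) 0 (map_mx intr Fm *m E0).
  by rewrite UE /S map_col_mx mul_col_row FVE.
have detU : \det U = \det V0 by rewrite det_lblock det1 mulr1.
have V0E : V0 = Vandermonde n (\row_i al i).
  by apply/matrixP=> c i; rewrite !mxE.
have V0n : \det V0 != 0.
  rewrite V0E det_Vandermonde; apply/prodf_neq0 => i _; apply/prodf_neq0 => j ij.
  rewrite !mxE subr_eq0; apply: contraTneq ij => /al_inj->; by rewrite ltnn.
have detG : \det (map_mx intr G *m col_mx V0 V1) =
    \det V0 * \prod_i (map_poly intr g).[al i].
  have -> : \prod_i (map_poly intr g).[al i] =
      \det (diag_mx (\row_i (map_poly (intr : int -> K) g).[al i])).
    by rewrite det_diag; apply: eq_bigr => i _; rewrite mxE.
  rewrite -det_mulmx; congr (\det _); apply/matrixP => t i.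
  by rewrite GVE mul_mx_diag !mxE.
have := congr1 determinant SU; rewrite det_mulmx detU det_ublock detG FEE.
rewrite (det_map_mx (intr : int -> K)) => h; apply: (mulIf V0n); rewrite h; ring.
Qed.

Lemma splits_cofactor (K : fieldType) n (f : {poly int}) (al : 'I_n -> K) i :
  splits_as f al -> map_poly intr f =
    ('X - (al i)%:P) * ((lead_coef f)%:~R *: \prod_(j < n | j != i) ('X - (al j)%:P)).
Proof. by case=> _ _ ->; rewrite (bigD1 i) //= scalerAr. Qed.

Lemma deriv_prod_XsubC (K : comNzRingType) n (al : 'I_n -> K) :
  (\prod_(i < n) ('X - (al i)%:P))^`() =
  \sum_(i < n) \prod_(j < n | j != i) ('X - (al j)%:P).
Proof.
elim: n al => [|n IH] al; first by rewrite !big_ord0 derivC.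
rewrite big_ord_recl derivM derivB derivX derivC subr0 mul1r IH.
rewrite [RHS]big_ord_recl; congr (_ + _).
  by rewrite [RHS]big_mkcond big_ord_recl /= mul1r; apply: eq_bigr.
rewrite mulr_sumr; apply: eq_bigr => i _.
rewrite [RHS]big_mkcond big_ord_recl /=; congr (_ * _).
rewrite big_mkcond; apply: eq_bigr => j _.
by rewrite (inj_eq (@fintype.lift_inj _ ord0)).
Qed.

Lemma prod_pair_sym (T : comNzRingType) n (F : 'I_n -> 'I_n -> T) :
  (forall i j, F i j = F j i) ->
  \prod_(i < n) \prod_(j < n | j != i) F i j =
  (\prod_(i < n) \prod_(j < n | (i < j)%N) F i j) ^+ 2.
Proof.
move=> Fs.
have -> : \prod_(i < n) \prod_(j < n | j != i) F i j =
   \prod_(i < n) (\prod_(j < n | (i < j)%N) F i j * \prod_(j < n | (j < i)%N) F i j).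
  apply: eq_bigr => i _; rewrite (bigID (fun j : 'I_n => (i < j)%N)) /=.
  congr (_ * _); apply: eq_bigl => j; rewrite -val_eqE /=; case: ltngtP => //.
rewrite big_split /= expr2; congr (_ * _).
rewrite (exchange_big_dep predT) //=; apply: eq_bigr => i _; apply: eq_bigr => j _.
exact: Fs.
Qed.

(* The matrix of coefficients of the f / (X - al_i), with its constant column
   (the leading coefficient of f) replaced by 1, has determinant of square
   disc f, and its Gram matrix is integral. *)
Lemma disc_int (K : numFieldType) n (f : {poly int}) (al : 'I_n -> K) :
  splits_as f al ->
  exists z : int, (lead_coef f)%:~R ^+ (n.-1 * 2) *
    (\prod_(i < n) \prod_(j < n | (i < j)%N) (al j - al i)) ^+ 2 = z%:~R.
Proof.
move=> Hs; have [sf al_inj fE] := Hs.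
case: n al Hs sf al_inj fE => [|n] al Hs sf al_inj fE.
  by exists 1; rewrite big_ord0 !expr1n mulr1.
set a := lead_coef f in fE *.
pose q i : {poly K} := a%:~R *: \prod_(j < n.+1 | j != i) ('X - (al j)%:P).
have qf i : map_poly intr f = ('X - (al i)%:P) * q i by exact: splits_cofactor.
have a0 : a%:~R != 0 :> K by rewrite intr_eq0 lead_coef_eq0 -size_poly_eq0 sf.
have sq i : (size (q i) <= n.+1)%N.
  have: (size (('X - (al i)%:P) * q i)%R <= n.+2)%N.
    by rewrite -qf (leq_trans (size_poly _ _)) // sf.
  have [->|q0] := eqVneq (q i) 0; first by rewrite size_poly0.
  by rewrite size_monicM ?monicXsubC // size_XsubC.
(* Horner's scheme for the division of f by X - al_i. *)
have coefq i c : (q i)`_c = (f`_c.+1)%:~R + al i * (q i)`_c.+1.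
  have := congr1 (fun p : {poly K} => p`_c.+1) (qf i).
  rewrite mulrBl coefB coefXM coefCM coef_map /= => ->; ring.
have qn i : (q i)`_n = a%:~R.
  by rewrite coefq [(q i)`_n.+1]nth_default // mulr0 addr0 /a /lead_coef sf.
have alq0 i : al i * (q i)`_0 = - (f`_0)%:~R.
  have := congr1 (fun p : {poly K} => p`_0) (qf i).
  by rewrite mulrBl coefB coefXM coefCM coef_map /= sub0r => ->; rewrite opprK.
pose T d := \sum_i (q i)`_d.
have TE d : T d = (f`_d.+1 *+ d.+1)%:~R.
  have -> : T d = (map_poly intr f)^`()`_d.
    rewrite fE derivZ deriv_prod_XsubC scaler_sumr coef_sum.
    by apply: eq_bigr.
  by rewrite coef_deriv coef_map /= rmorphMn.
pose S c d := \sum_i (q i)`_c * (q i)`_d.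
have SC c d : S c d = S d c by apply: eq_bigr => i _; rewrite mulrC.
(* Eliminating [al i] between two Horner recursions trades one unit of d for one of c, up to the
   integers [T]. *)
have SS c d : S c d.+1 = S c.+1 d + (f`_c.+1)%:~R * T d.+1 - (f`_d.+1)%:~R * T c.+1.
  rewrite /S /T !mulr_sumr -big_split -sumrB /=; apply: eq_bigr => i _.
  rewrite (coefq i c) (coefq i d); ring.
have S0 c : S c 0 = (f`_c.+1 : int)%:~R * T 0%N - (f`_0)%:~R * T c.+1.
  rewrite /S /T !mulr_sumr -sumrB; apply: eq_bigr => i _.
  transitivity ((f`_c.+1)%:~R * (q i)`_0 + (q i)`_c.+1 * (al i * (q i)`_0)).
    rewrite [(q i)`_c]coefq; ring.
  rewrite alq0; ring.
(* Raising c while lowering d stops at d = 0, where [S0] applies, or at c = n + 1, where the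
   coefficients of every [q i] vanish. *)
have Sint k : forall c d, (c + k = n.+1)%N -> exists z : int, S c d = z%:~R.
  elim: k => [|k IH] c d ck.
    exists 0; rewrite /S big1 // => i _; rewrite nth_default ?mul0r //.
    by rewrite (leq_trans (sq i)) //; lia.
  case: d => [|d].
    exists (f`_c.+1 * (f`_1 *+ 1) - f`_0 * (f`_c.+2 *+ c.+2)).
    by rewrite S0 !TE !(rmorphB, rmorphM).
  have [|z zE] := IH c.+1 d; first lia.
  exists (z + f`_c.+1 * (f`_d.+2 *+ d.+2) - f`_d.+1 * (f`_c.+2 *+ c.+2)).
  by rewrite SS zE !TE !(rmorphB, rmorphD, rmorphM).
pose P := \matrix_(i < n.+1, c < n.+1) (if c == n :> nat then 1 else (q i)`_c).
pose dl := \row_(c < n.+1) (if c == n :> nat then a%:~R else 1 : K).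
pose V := Vandermonde n.+1 (\row_i al i).
have detV : \det V = \prod_(i < n.+1) \prod_(j < n.+1 | (i < j)%N) (al j - al i).
  by rewrite det_Vandermonde; apply: eq_bigr => i _; apply: eq_bigr => j _; rewrite !mxE.
have V0 : \det V != 0.
  rewrite detV; apply/prodf_neq0 => i _; apply/prodf_neq0 => j ij.
  rewrite subr_eq0; apply: contraTneq ij => /al_inj->; by rewrite ltnn.
(* The entries are q_i(al_j), which vanish off the diagonal; [dl] puts the leading coefficient back
   into the last column. *)
have PV : P *m diag_mx dl *m V = diag_mx (\row_i (q i).[al i]).
  apply/matrixP => i j; rewrite mul_mx_diag !mxE.
  transitivity ((q i).[al j]).
    rewrite (horner_coef_wide _ (sq i)); apply: eq_bigr => c _; rewrite !mxE.
    by case: eqP => [->|_]; rewrite ?mulr1 // mul1r qn.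
  have [->|ij] := eqVneq i j; first by rewrite mulr1n.
  rewrite mulr0n hornerZ horner_prod (bigD1 j) /=; last by rewrite eq_sym.
  by rewrite hornerXsubC subrr mul0r mulr0.
have detdl : \det (diag_mx dl) = a%:~R.
  rewrite det_diag (bigD1 ord_max) //= mxE eqxx big1 ?mulr1 // => c cn.
  by rewrite mxE; case: eqP => // cE; case/eqP: cn; apply: val_inj.
have detq : (\prod_i (q i).[al i]) ^+ 2 =
    a%:~R ^+ (n.+1 * 2) * (\det V ^+ 2) ^+ 2.
  have -> : \prod_i (q i).[al i] = a%:~R ^+ n.+1 *
      \prod_i \prod_(j | j != i) (al i - al j).
    rewrite (eq_bigr (fun i => a%:~R * \prod_(j < n.+1 | j != i) (al i - al j))).
      by rewrite big_split /= prodr_const card_ord.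
    move=> i _; rewrite hornerZ horner_prod; congr (_ * _).
    by apply: eq_bigr => j _; rewrite hornerXsubC.
  rewrite exprMn exprM; congr (_ * _).
  transitivity (\prod_i \prod_(j < n.+1 | j != i) (al j - al i) ^+ 2).
    rewrite -prodrXl; apply: eq_bigr => i _; rewrite -prodrXl.
    by apply: eq_bigr => j _; rewrite -sqrrN opprB.
  rewrite (@prod_pair_sym _ _ (fun i j => (al j - al i) ^+ 2)); last first.
    by move=> i j; rewrite -sqrrN opprB.
  congr (_ ^+ 2); rewrite detV -prodrXl; apply: eq_bigr => i _; by rewrite -prodrXl.
have detP : \det P ^+ 2 = a%:~R ^+ (n * 2) * \det V ^+ 2.
  have h : \det P ^+ 2 * (a%:~R ^+ 2 * \det V ^+ 2) =
      (a%:~R ^+ (n * 2) * \det V ^+ 2) * (a%:~R ^+ 2 * \det V ^+ 2).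
    have := congr1 (fun A => \det A ^+ 2) PV.
    rewrite /= !det_mulmx detdl det_diag.
    under [\prod_i _ in RHS]eq_bigr => i _ do rewrite mxE.
    rewrite detq mulSn exprD => h; rewrite -!exprMn in h *; rewrite -mulrA in h.
    by rewrite h !exprMn; ring.
  by apply: (mulIf _ h); rewrite mulf_neq0 ?expf_neq0.
rewrite /= -detV -detP.
have GE c d : exists z : int, (P^T *m P) c d = z%:~R.
  rewrite mxE; under eq_bigr => i _ do rewrite !mxE.
  case: eqP => cn; case: eqP => dn.
  - by exists n.+1%:R; rewrite (eq_bigr (fun=> 1)) ?sumr_const ?card_ord ?mulr1 // rmorph_nat.
  - exists (f`_d.+1 *+ d.+1); rewrite -TE; apply: eq_bigr => i _; exact: mul1r.
  - exists (f`_c.+1 *+ c.+1); rewrite -TE; apply: eq_bigr => i _; exact: mulr1.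
  - by apply: (Sint (n.+1 - c)%N); have := ltn_ord c; lia.
have [g gE] := fin_all_exists (fun c => fin_all_exists (GE c)).
exists (\det (\matrix_(c, d) g c d)).
rewrite expr2 -{1}det_tr -det_mulmx -(det_map_mx (intr : int -> K)).
by congr (\det _); apply/matrixP => c d; rewrite gE !mxE.
Qed.

(** * Complex absolute values and the Vandermonde bound *)

From mathcomp Require Import spectral.

Definition nrm (R : rcfType) (z : R[i]) : R := Normc.normc z.

Lemma nrmE (R : rcfType) (z : R[i]) : `|z| = ((nrm z)%:C)%C.
Proof. by case: z. Qed.

Lemma nrm_ge0 (R : rcfType) (z : R[i]) : 0 <= nrm z.
Proof. by rewrite -lecR -nrmE normr_ge0. Qed.

Lemma nrmM (R : rcfType) (z w : R[i]) : nrm (z * w) = nrm z * nrm w.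
Proof. exact: Normc.normcM. Qed.

Lemma nrm0 (R : rcfType) : nrm (0 : R[i]) = 0.
Proof. exact: Normc.normc0. Qed.

Lemma nrm1 (R : rcfType) : nrm (1 : R[i]) = 1.
Proof. exact: Normc.normc1. Qed.

Lemma nrm_eq0 (R : rcfType) (z : R[i]) : (nrm z == 0) = (z == 0).
Proof.
by rewrite -(inj_eq (@complexI R)) -nrmE /= -[0%:C%C]/(0 : R[i]) normr_eq0.
Qed.

Lemma nrm_gt0 (R : rcfType) (z : R[i]) : (0 < nrm z) = (z != 0).
Proof. by rewrite lt0r nrm_eq0 nrm_ge0 andbT. Qed.

Lemma nrmV (R : rcfType) (z : R[i]) : nrm z^-1 = (nrm z)^-1.
Proof. exact: Normc.normcV. Qed.

Lemma nrmN (R : rcfType) (z : R[i]) : nrm (- z) = nrm z.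
Proof. by apply: (@complexI R); rewrite -!nrmE normrN. Qed.

Lemma nrmD (R : rcfType) (z w : R[i]) : nrm (z + w) <= nrm z + nrm w.
Proof. by rewrite -lecR rmorphD /= -!nrmE ler_normD. Qed.

Lemma nrmB (R : rcfType) (z w : R[i]) : nrm (z - w) <= nrm z + nrm w.
Proof. by rewrite -(nrmN w) nrmD. Qed.

Lemma nrmX (R : rcfType) (z : R[i]) k : nrm (z ^+ k) = nrm z ^+ k.
Proof. by elim: k => [|k IH]; rewrite ?expr0 ?nrm1 // !exprS nrmM IH. Qed.

Lemma nrm_prod (R : rcfType) (I : Type) (r : seq I) (P : pred I) (F : I -> R[i]) :
  nrm (\prod_(i <- r | P i) F i) = \prod_(i <- r | P i) nrm (F i).
Proof. by apply: (big_morph (@nrm R)); [exact: nrmM | exact: nrm1]. Qed.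

Lemma nrm_sum (R : rcfType) (I : Type) (r : seq I) (P : pred I) (F : I -> R[i]) :
  nrm (\sum_(i <- r | P i) F i) <= \sum_(i <- r | P i) nrm (F i).
Proof.
apply: (big_ind2 (fun z x => nrm z <= x)) => [|z x w y zx wy|//].
  by rewrite nrm0.
exact: le_trans (nrmD _ _) (lerD zx wy).
Qed.

Lemma nrm_int (R : rcfType) (z : int) : nrm (z%:~R : R[i]) = `|z|%:~R.
Proof.
apply: (@complexI R); rewrite -nrmE -intr_norm.
exact/esym/(rmorph_int (real_complex R)).
Qed.

Lemma nrm_nat (R : rcfType) k : nrm (k%:R : R[i]) = k%:R.
Proof. by rewrite !pmulrn nrm_int. Qed.

Lemma normRe_nrm (R : rcfType) (z : R[i]) : `|complex.Re z| <= nrm z.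
Proof.
case: z => a b; rewrite /nrm /= -sqrtr_sqr ler_sqrt ?addr_ge0 ?sqr_ge0 //.
by rewrite lerDl sqr_ge0.
Qed.

Lemma normIm_nrm (R : rcfType) (z : R[i]) : `|complex.Im z| <= nrm z.
Proof.
case: z => a b; rewrite /nrm /= -sqrtr_sqr ler_sqrt ?addr_ge0 ?sqr_ge0 //.
by rewrite lerDr sqr_ge0.
Qed.

Lemma nrm_conj (R : rcfType) (z : R[i]) : nrm (conjc z) = nrm z.
Proof. by case: z => a b; rewrite /nrm /= sqrrN. Qed.

Lemma nrm_Re_Im (R : rcfType) (z : R[i]) (r : R) :
  `|complex.Re z + complex.Im z| <= r -> `|complex.Re z - complex.Im z| <= r -> nrm z <= r.
Proof.
case: z => a b /= h1 h2; rewrite /nrm /=.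
have r0 : 0 <= r by apply: le_trans h1.
rewrite -(ger0_norm r0) -sqrtr_sqr ler_sqrt ?sqr_ge0 //.
have s1 : (a + b) ^+ 2 <= r ^+ 2 by rewrite -(real_normK (num_real (a + b))) ler_sqr ?nnegrE.
have s2 : (a - b) ^+ 2 <= r ^+ 2 by rewrite -(real_normK (num_real (a - b))) ler_sqr ?nnegrE.
by move: s1 s2; rewrite sqrrD sqrrB => s1 s2; lra.
Qed.

Local Open Scope sesquilinear_scope.

(* AM-GM on the eigenvalues of the Gram matrix, whose trace is at most N * N. *)
Lemma hadamard_le (R : rcfType) N (A : 'M[R[i]]_N) :
  (forall i j, nrm (A i j) <= 1) -> nrm (\det A) ^+ 2 <= N%:R ^+ N.
Proof.
case: N A => [|N] A hA; first by rewrite det_mx00 nrm1 expr1n expr0.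
pose G := A *m A ^t*.
have detG : \det G = `|\det A| ^+ 2.
  by rewrite det_mulmx det_map_mx det_tr normCK.
have Gh : G \is hermsymmx.
  apply/is_hermitianmxP; rewrite expr0 scale1r /G trmx_mul map_mxM /=.
  by rewrite trmxCK.
have Gn : G \is normalmx by exact: hermitian_normalmx.
have /orthomx_spectralP GE := Gn.
set P := spectralmx G in GE; set D := spectral_diag G in GE.
have Pu : P \is unitarymx by exact: spectral_unitarymx.
have PU : P \in unitmx by exact: unitarymx_unit.
have DE : diag_mx D = (P *m A) *m (P *m A)^t*.
  rewrite trmx_mul map_mxM /= -(invmx_unitary Pu) mulmxA -(mulmxA P) -/G GE.
  by rewrite !mulmxA mulmxV // mul1mx mulmxK.
have D0 i : 0 <= D 0 i.
  have /matrixP/(_ i i) := DE; rewrite !mxE eqxx mulr1n => ->.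
  by apply: sumr_ge0 => j _; rewrite !mxE mul_conjC_ge0.
have trG : \tr G <= (N.+1 ^ 2)%:R.
  have -> : (N.+1 ^ 2)%:R = \sum_(i < N.+1) \sum_(j < N.+1) 1 :> R[i].
    by rewrite !sumr_const !card_ord -mulrnA mulnn.
  apply: ler_sum => i _; rewrite !mxE; apply: ler_sum => j _.
  rewrite !mxE -normCK -[leRHS](expr1n _ 2) lerXn2r ?nnegrE //.
  by rewrite nrmE -[1]/((1 : R)%:C)%C lecR.
have trD : \tr G = \sum_i D 0 i.
  by rewrite GE mxtrace_mulC mulmxA mulmxV // mul1mx mxtrace_diag.
have detD : \det G = \prod_i D 0 i.
  by rewrite GE !det_mulmx mulrAC -det_mulmx mulVmx // det1 mul1r det_diag.
have := @leif_AGM_scaled _ 'I_N.+1 predT (fun i => D 0 i).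
rewrite card_ord => /(_ _)[i _|le _]; first by rewrite mulrn_wge0.
have le1 : \prod_i D 0 i * N.+1%:R ^+ N.+1 <= (N.+1 ^ 2)%:R ^+ N.+1.
  have -> : \prod_i D 0 i * N.+1%:R ^+ N.+1 = \prod_(i in 'I_N.+1) (D 0 i *+ N.+1).
    rewrite [RHS](eq_bigr (fun i => D 0 i * N.+1%:R)) => [|i _]; last by rewrite mulr_natr.
    by rewrite big_split /= prodr_const card_ord.
  apply: le_trans le _; rewrite lerXn2r ?nnegrE ?sumr_ge0 //.
  by rewrite -trD.
have e : (N.+1 ^ 2)%:R ^+ N.+1 = N.+1%:R ^+ N.+1 * N.+1%:R ^+ N.+1 :> R[i].
  by rewrite natrX expr2 exprMn.
move: le1; rewrite e -detD detG ler_pM2r ?exprn_gt0 ?ltr0n // nrmE.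
by rewrite -rmorphXn /= -[N.+1%:R](rmorph_nat (real_complex R)) -rmorphXn /= lecR.
Qed.

(** Hadamard's inequality after column i of the Vandermonde matrix is divided by max(1, |al_i|)^(N -
    1), which makes all entries at most 1 in modulus. *)
Lemma vandermonde_le (R : rcfType) N (al : 'I_N -> R[i]) :
  (\prod_(i < N) \prod_(j < N | (i < j)%N) nrm (al j - al i)) ^+ 2 <=
  N%:R ^+ N * (\prod_(i < N) Num.max 1 (nrm (al i))) ^+ (N.-1 * 2).
Proof.
pose mx i := Num.max 1 (nrm (al i)).
have mx1 i : 1 <= mx i by rewrite le_max lexx.
have mx0 i : 0 < mx i by exact: lt_le_trans (mx1 i).
pose V := \matrix_(c < N, i < N) (al i ^+ c / ((mx i ^+ N.-1)%:C)%C).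
have VE : V = Vandermonde N (\row_i al i) *m
    diag_mx (\row_i ((mx i ^+ N.-1)^-1%:C)%C).
  by apply/matrixP=> c i; rewrite mul_mx_diag !mxE fmorphV.
have hV : nrm (\det V) ^+ 2 <= N%:R ^+ N.
  apply: hadamard_le => c i; rewrite mxE nrmM nrmV nrmX.
  have -> : nrm ((mx i ^+ N.-1)%:C)%C = mx i ^+ N.-1.
    by apply: (@complexI R); rewrite -nrmE ger0_norm // lecR exprn_ge0 // ltW.
  rewrite ler_pdivrMr ?exprn_gt0 // mul1r.
  apply: (@le_trans _ _ (mx i ^+ c)).
    by rewrite lerXn2r ?nnegrE ?nrm_ge0 ?(ltW (mx0 i)) // le_max lexx orbT.
  by apply: ler_weXn2l => //; have := ltn_ord c; lia.
move: hV; rewrite VE det_mulmx det_diag det_Vandermonde nrmM exprMn.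
have -> : nrm (\prod_i (\row_i0 ((mx i0 ^+ N.-1)^-1%:C)%C) 0 i) =
    (\prod_i mx i ^+ N.-1)^-1.
  rewrite nrm_prod -prodfV; apply: eq_bigr => i _; rewrite mxE fmorphV nrmV.
  congr (_^-1).
  by apply: (@complexI R); rewrite -nrmE ger0_norm // lecR exprn_ge0 // ltW.
rewrite exprVn ler_pdivrMr; last by rewrite exprn_gt0 // prodr_gt0 // => i _; rewrite exprn_gt0.
rewrite prodrXl -exprM nrm_prod.
congr (_ ^+ 2 <= _); apply: eq_bigr => i _; rewrite nrm_prod.
by apply: eq_bigr => j _; rewrite !mxE.
Qed.

(** * Binary forms and substitutions *)

(** A binary form is carried as the polynomial F(X, 1), with its degree n kept apart. The ring is
    arbitrary so that polynomials can be substituted as well. *)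
Definition hom (A : comNzRingType) n (f : {poly A}) (x y : A) : A :=
  \sum_(i < n.+1) f`_i * x ^+ i * y ^+ (n - i).

Lemma hom_map (A B : comNzRingType) (phi : {rmorphism A -> B}) n (f : {poly A}) x y :
  phi (hom n f x y) = hom n (map_poly phi f) (phi x) (phi y).
Proof.
rewrite rmorph_sum; apply: eq_bigr => i _.
by rewrite !rmorphM !rmorphXn coef_map.
Qed.

Lemma homZ (A : comNzRingType) n (f : {poly A}) c x y :
  hom n (c *: f) x y = c * hom n f x y.
Proof. by rewrite mulr_sumr; apply: eq_bigr => i _; rewrite coefZ !mulrA. Qed.

Lemma hom_mulXsubC (A : comNzRingType) n (f : {poly A}) c x y :
  (size f <= n.+1)%N ->
  hom n.+1 (('X - c%:P) * f) x y = (x - c * y) * hom n f x y.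
Proof.
move=> sf; rewrite /hom mulrBl.
transitivity (\sum_(i < n.+2) ('X * f)`_i * x ^+ i * y ^+ (n.+1 - i) -
   \sum_(i < n.+2) (c%:P * f)`_i * x ^+ i * y ^+ (n.+1 - i)).
  by rewrite -sumrB; apply: eq_bigr => i _; rewrite coefB !mulrBl.
rewrite [RHS]mulrBl; congr (_ - _).
  rewrite big_ord_recl coefXM /= !mul0r add0r mulr_sumr.
  apply: eq_bigr => i _; rewrite coefXM /= /bump /= add1n subSS exprS; ring.
rewrite big_ord_recr /= coefCM [f`_n.+1]nth_default // mulr0 !mul0r addr0.
rewrite mulr_sumr; apply: eq_bigr => i _; rewrite coefCM /=.
have -> : (n.+1 - i = (n - i).+1)%N by have := ltn_ord i; lia.
rewrite exprS; ring.
Qed.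

Lemma hom_prodXsubC (A : comNzRingType) n (al : 'I_n -> A) x y :
  hom n (\prod_(i < n) ('X - (al i)%:P)) x y = \prod_(i < n) (x - al i * y).
Proof.
elim: n al => [|n IH] al.
  by rewrite /hom big_ord1 !big_ord0 coef1 eqxx !expr0 !mulr1.
rewrite !big_ord_recl hom_mulXsubC ?IH //.
by rewrite size_prod_XsubC /index_enum -enumT size_enum_ord.
Qed.

(** This is F(pX + q, rX + s): the coefficients become constant polynomials and the form is
    evaluated at two linear ones. *)
Definition act n (f : {poly int}) (p q r s : int) : {poly int} :=
  hom n (map_poly polyC f) (p%:P * 'X + q%:P) (r%:P * 'X + s%:P).

Lemma hom_splits (K : fieldType) n (f : {poly int}) (al : 'I_n -> K) (x y : int) :
  splits_as f al ->
  (hom n f x y)%:~R = (lead_coef f)%:~R * \prod_(i < n) (x%:~R - al i * y%:~R).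
Proof.
case=> _ _ fE; rewrite (hom_map (intr : int -> K)) /= fE homZ.
by rewrite hom_prodXsubC.
Qed.

(** The shape in which irreducibility is used: integral polynomials do not separate the roots. It
    replaces the Galois action, and it passes directly to substituted forms. *)
Definition conj_roots (K : fieldType) n (al : 'I_n -> K) : Prop :=
  forall (g : {poly int}) i j,
    (map_poly intr g).[al i] = 0 -> (map_poly intr g).[al j] = 0.

Definition good_form (K : fieldType) n (f : {poly int}) (al : 'I_n -> K) : Prop :=
  splits_as f al /\ conj_roots al.

(** If al_i were x / y, the polynomial y X - x would vanish at all conjugates, hence at two distinct
    numbers. *)
Lemma good_irrational (K : numFieldType) n (f : {poly int}) (al : 'I_n -> K) :
  (1 < n)%N -> good_form f al ->
  forall i (x y : int), (x != 0) || (y != 0) -> x%:~R - al i * y%:~R != 0.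
Proof.
move=> n1 [[sf ai _] cj] i x y xy0; apply/eqP => h.
pose g := y *: 'X - x%:P.
have gE z : (map_poly intr g).[z] = z * y%:~R - x%:~R :> K.
  by rewrite /g rmorphB /= map_polyZ map_polyX map_polyC !hornerE mulrC.
have g0 j : al j * y%:~R = x%:~R.
  by apply/eqP; rewrite -subr_eq0 -gE (cj _ i) // gE -opprB h oppr0.
have y0 : y%:~R != 0 :> K.
  apply/eqP => y0; move: xy0 (g0 i); rewrite -(intr_eq0 K x) -(intr_eq0 K y) y0.
  by rewrite mulr0 => xy0 /esym/eqP; rewrite eqxx orbF in xy0 *; rewrite (negPf xy0).
pose i0 := Ordinal (ltnW n1); pose i1 := Ordinal n1.
have : i0 = i1 by apply: ai; apply: (mulIf y0); rewrite !g0.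
by move/(congr1 val).
Qed.

Lemma act_good (K : numFieldType) n (f : {poly int}) (al : 'I_n -> K) p q r s :
  (1 < n)%N -> good_form f al -> p * s - q * r != 0 ->
  let al' i := (al i * s%:~R - q%:~R) / (p%:~R - al i * r%:~R) in
  [/\ good_form (act n f p q r s) al',
   (lead_coef (act n f p q r s))%:~R =
     (lead_coef f)%:~R * \prod_i (p%:~R - al i * r%:~R),
   forall x y, hom n (act n f p q r s) x y = hom n f (p * x + q * y) (r * x + s * y)
   & forall i j, al' j - al' i = (p * s - q * r)%:~R * (al j - al i) /
      ((p%:~R - al i * r%:~R) * (p%:~R - al j * r%:~R))].
Proof.
move=> n1 gf d0 al'; have [fs cj] := gf; have [sf ai fE] := fs.
have pr0 i : p%:~R - al i * r%:~R != 0.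
  apply: (good_irrational n1 gf); apply: contraNT d0; rewrite negb_or !negbK.
  by case/andP => /eqP-> /eqP->; rewrite mul0r mulr0 subr0.
have difE i j : al' j - al' i = (p * s - q * r)%:~R * (al j - al i) /
      ((p%:~R - al i * r%:~R) * (p%:~R - al j * r%:~R)).
  rewrite /al' rmorphB /= !rmorphM /=; field; by rewrite !pr0.
have lin i : (p%:~R%:P * 'X + q%:~R%:P) - (al i)%:P * (r%:~R%:P * 'X + s%:~R%:P) =
    (p%:~R - al i * r%:~R) *: ('X - (al' i)%:P).
  rewrite scalerBr -!mul_polyC -!polyCM /al'.
  rewrite [_ * (_ / _)]mulrC divfK ?pr0 // !polyCB !polyCM; ring.
have actE : map_poly intr (act n f p q r s) =
   ((lead_coef f)%:~R * \prod_i (p%:~R - al i * r%:~R)) *: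
   \prod_i ('X - (al' i)%:P).
  rewrite /act (hom_map (map_poly (intr : int -> K))) /=.
  have -> : map_poly (map_poly intr) (map_poly polyC f) =
     map_poly polyC (map_poly (intr : int -> K) f).
    by rewrite -!map_poly_comp; apply: eq_map_poly => z /=; rewrite map_polyC.
  rewrite !rmorphD !rmorphM /= !map_polyC map_polyX /= fE.
  rewrite map_polyZ homZ rmorph_prod /=.
  under eq_bigr => i _ do rewrite rmorphB /= map_polyX map_polyC /=.
  rewrite hom_prodXsubC; rewrite (eq_bigr _ (fun i _ => lin i)).
  by rewrite scaler_prod mul_polyC scalerA.
have c0 : (lead_coef f)%:~R * \prod_i (p%:~R - al i * r%:~R) != 0.
  rewrite mulf_neq0 ?intr_eq0 ?lead_coef_eq0 -?size_poly_eq0 ?sf //.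
  by apply/prodf_neq0 => i _.
have lE : (lead_coef (act n f p q r s))%:~R =
     (lead_coef f)%:~R * \prod_i (p%:~R - al i * r%:~R) :> K.
  rewrite -lead_coef_map_inj //=; last exact: intr_inj.
  rewrite actE lead_coefZ.
  have /monicP-> : \prod_i ('X - (al' i)%:P) \is monic.
    by apply: monic_prod => i _; exact: monicXsubC.
  by rewrite mulr1.
have sact : size (act n f p q r s) = n.+1.
  rewrite -(size_map_inj_poly (@intr_inj K)) // actE size_scale //.
  by rewrite size_prod_XsubC /index_enum -enumT size_enum_ord.
have ai' : injective al'.
  move=> i j /eqP; rewrite eq_sym -subr_eq0 difE !mulf_eq0 invr_eq0 mulf_eq0.
  rewrite !(negPf (pr0 _)) !orbF intr_eq0 (negPf d0) /= subr_eq0.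
  by move/eqP/ai.
have spl : splits_as (act n f p q r s) al' by split => //; rewrite actE lE.
split => //; last first.
  move=> x y; apply: (@intr_inj K).
  rewrite (hom_splits _ _ spl) (hom_splits _ _ fs) lE -mulrA -big_split /=.
  congr (_ * _); apply: eq_bigr => i _; rewrite /al' !rmorphD !rmorphM /=; field.
  exact: pr0.
(* Conjugacy is transported by the adjugate substitution: G is g homogenized at (s X - q, - r X +
   p), and its value at [al k] is that of g at [al' k] times a nonzero power. *)
split => // g i j; set d := size g.
pose G := hom d (map_poly polyC g) (s%:P * 'X - q%:P) ((- r)%:P * 'X + p%:P).
have GE k : (map_poly intr G).[al k] = (p%:~R - al k * r%:~R) ^+ d *
    (map_poly intr g).[al' k].
  rewrite /G (hom_map (map_poly (intr : int -> K))) /= rmorphB rmorphD !rmorphM /=.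
  rewrite !map_polyC map_polyX /= -[(_).[al k]]/(horner_eval (al k) _).
  rewrite (hom_map (horner_eval (al k))) /= rmorphB rmorphD !rmorphM /=.
  rewrite /horner_eval !hornerE rmorphN /=.
  rewrite (_ : map_poly (horner^~ (al k)) _ = map_poly intr g); last first.
    apply/polyP => c; rewrite coef_map_id0 ?horner0 // !coef_map /= map_polyC /=.
    by rewrite hornerC.
  rewrite (@horner_coef_wide _ d.+1) ?(leq_trans (size_poly _ _)) // mulr_sumr.
  apply: eq_bigr => c _.
  have -> : s%:~R * al k - q%:~R = (p%:~R - al k * r%:~R) * al' k.
    by rewrite /al' [RHS]mulrC divfK // mulrC.
  have -> : - r%:~R * al k + p%:~R = p%:~R - al k * r%:~R by ring.
  have cd : (c <= d)%N by rewrite -ltnS.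
  have -> : (p%:~R - al k * r%:~R) ^+ d = (p%:~R - al k * r%:~R) ^+ c *
      (p%:~R - al k * r%:~R) ^+ (d - c) by rewrite -exprD subnKC.
  rewrite exprMn; ring.
move=> gi; have Gi : (map_poly intr G).[al i] = 0 by rewrite GE gi mulr0.
have := cj G i j Gi; rewrite GE => /eqP; rewrite mulf_eq0 expf_eq0 (negPf (pr0 j)).
by rewrite andbF /= => /eqP.
Qed.

(** * Wronskians *)

Lemma dvdp_XsubC_exp (K : fieldType) (P : {poly K}) a k :
  (forall j, (j < k)%N -> P^`N(j).[a] = 0) -> ('X - a%:P) ^+ k %| P.
Proof.
move=> h.
have -> : P = \sum_(i < size P) (P^`N(i).[a])%:P * ('X - a%:P) ^+ i.
  rewrite -{1}[P]comp_polyXr /comp_poly -[X in horner _ X](subrKC (a%:P)).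
  rewrite (@nderiv_taylor_wide _ (size P)) ?size_map_polyC //; last exact: mulrC.
  by apply: eq_bigr => i _; rewrite nderivn_map horner_map.
apply: (big_ind (fun Q => _ %| Q)) => [|p q|i _]; first exact: dvdp0.
  exact: dvdp_add.
have [ik|ki] := ltnP i k; first by rewrite h // mul0r dvdp0.
by rewrite dvdp_mull // dvdp_exp2l.
Qed.

Lemma nderivn_roots_eq0 (K : fieldType) n (al : 'I_n -> K) (P : {poly K}) k :
  injective al -> (forall j i, (j < k)%N -> P^`N(j).[al i] = 0) ->
  (size P <= n * k)%N -> P = 0.
Proof.
move=> ai h sP; apply/eqP; apply: contraLR sP => P0; rewrite -ltnNge.
have dvd (s : seq 'I_n) : uniq s -> \prod_(i <- s) ('X - (al i)%:P) ^+ k %| P.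
  elim: s => [|i s IH] /=; first by rewrite big_nil dvd1p.
  case/andP=> is_ us; rewrite big_cons Gauss_dvdp ?(IH us) ?andbT.
    by apply: dvdp_XsubC_exp => j jk; apply: h.
  apply: coprimep_expl; rewrite coprimep_sym coprimep_XsubC /root horner_prod.
  rewrite prodf_seq_neq0; apply/allP => j js /=.
  rewrite horner_exp hornerXsubC expf_neq0 // subr_eq0; apply: contraNneq is_.
  by move/ai->.
have := dvdp_leq P0 (dvd _ (index_enum_uniq _)).
rewrite prodrXl; set Q := \prod_(_ <- _) _.
have sQ : size Q = n.+1.
  by rewrite /Q size_prod_XsubC /index_enum -enumT size_enum_ord.
have Q0 : Q != 0 by rewrite -size_poly_eq0 sQ.
have : (0 < size (Q ^+ k)%R)%N by rewrite size_poly_gt0 expf_neq0.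
move=> p; apply: leq_trans; rewrite -(prednK p) size_exp sQ /=.
exact: ltnSn.
Qed.

Definition wronsk (A : nzRingType) (P Q : {poly A}) := P * Q^`() - P^`() * Q.

Lemma coefM_top (A : comNzRingType) (P Q : {poly A}) a b :
  (size P <= a.+1)%N -> (size Q <= b.+1)%N -> (P * Q)`_(a + b) = P`_a * Q`_b.
Proof.
move=> sP sQ; rewrite coefM (bigD1 (Ordinal (leq_addr b a : (a < (a + b).+1)%N))) //=.
rewrite addKn big1 ?addr0 // => i; rewrite -val_eqE /= => ia.
have [lt|ge] := ltnP i a.
  rewrite [Q`__]nth_default ?mulr0 //; apply: leq_trans sQ _; lia.
rewrite nth_default ?mul0r //; apply: leq_trans sP _; lia.
Qed.

(** The leading coefficients of U (X B') and (X U') B differ only by the factors deg B and deg U,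
    which must agree in characteristic 0. *)
Lemma wronsk_eq0_size (A : numDomainType) (U B : {poly A}) :
  U != 0 -> B != 0 -> wronsk U B = 0 -> size U = size B.
Proof.
move=> U0 B0 /eqP; rewrite subr_eq0 => /eqP E.
have sU : (0 < size U)%N by rewrite size_poly_gt0.
have sB : (0 < size B)%N by rewrite size_poly_gt0.
pose u := (size U).-1; pose b := (size B).-1.
have cX (P : {poly A}) c : ('X * P^`())`_c = P`_c *+ c.
  by rewrite coefXM coef_deriv; case: c.
have sX (P : {poly A}) : (size ('X * P^`())%R <= size P)%N.
  by apply/leq_sizeP => j /leq_sizeP sj; rewrite cX sj ?mul0rn.
have h : (U * ('X * B^`()))`_(u + b) = (('X * U^`()) * B)`_(u + b).
  by congr (_`__); rewrite mulrCA E mulrA.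
have hu : (size U <= u.+1)%N by rewrite /u prednK.
have hb : (size B <= b.+1)%N by rewrite /b prednK.
have hXu : (size ('X * U^`())%R <= u.+1)%N by apply: leq_trans (sX U) hu.
have hXb : (size ('X * B^`())%R <= b.+1)%N by apply: leq_trans (sX B) hb.
rewrite (coefM_top hu hXb) (coefM_top hXu hb) !cX in h.
have lU : U`_u != 0 by rewrite -[U`_u]/(lead_coef U) lead_coef_eq0.
have lB : B`_b != 0 by rewrite -[B`_b]/(lead_coef B) lead_coef_eq0.
move: h; rewrite mulrnAr mulrnAl => /eqP.
rewrite -subr_eq0 -mulr_natr -[X in _ - X]mulr_natr -mulrBr mulf_eq0 mulf_eq0.
rewrite (negPf lU) (negPf lB) /= subr_eq0 eqr_nat => /eqP e.
by rewrite -(prednK sU) -(prednK sB) -/u -/b e.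
Qed.

(** The combination of P and Q in which the leading terms cancel still has Wronskian 0 with Q but a
    smaller degree, so it is 0. *)
Lemma wronsk_eq0_prop (A : numDomainType) (P Q : {poly A}) :
  Q != 0 -> wronsk P Q = 0 -> lead_coef Q *: P = lead_coef P *: Q.
Proof.
move=> Q0 W0; have [->|P0] := eqVneq P 0.
  by rewrite lead_coef0 scaler0 scale0r.
have sPQ := wronsk_eq0_size P0 Q0 W0.
apply/eqP; rewrite -subr_eq0; apply/negPn/negP => U0.
set U := _ - _ in U0.
have WU : wronsk U Q = 0.
  rewrite /wronsk /U derivB !derivZ; apply/eqP; rewrite -(scaler0 _ (lead_coef Q)) -W0.
  by rewrite /wronsk -!mul_polyC; apply/eqP; ring.
have := wronsk_eq0_size U0 Q0 WU.
have : (size U < size Q)%N.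
  have sQ : (0 < size Q)%N by rewrite size_poly_gt0.
  rewrite -[X in (_ < X)%N](prednK sQ) ltnS; apply/leq_sizeP => j jQ.
  rewrite coefB !coefZ; have [jE|jN] := eqVneq j (size Q).-1.
    by rewrite /lead_coef sPQ jE mulrC subrr.
  have lt : (size Q <= j)%N by rewrite -(prednK sQ) ltn_neqAle eq_sym jN jQ.
  by rewrite !nth_default ?sPQ // !mulr0 subrr.
by move=> lt eq; rewrite eq ltnn in lt.
Qed.

(** A zero Wronskian gives b A = a B with integers a, b. The vanishing conditions then read (b al_i
    - a) B^(j)(al_i) = 0, so by irrationality B has n zeros of order k, too many for its size. *)
Lemma wronsk_neq0 (K : numFieldType) n (f : {poly int}) (al : 'I_n -> K)
    (A B : {poly int}) k w :
  (1 < n)%N -> good_form f al -> (size A <= w)%N -> (size B <= w)%N ->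
  (w <= n * k)%N -> (A != 0) || (B != 0) ->
  (forall j i, (j < k)%N -> (map_poly intr A^`N(j)).[al i] =
       al i * (map_poly intr B^`N(j)).[al i]) ->
  wronsk A B != 0.
Proof.
move=> n1 gf sA sB wk AB0 h; have [[_ ai _] _] := gf.
have mapI : injective (map_poly (intr : int -> K)).
  by apply: map_inj_poly => //; exact: intr_inj.
have eq0 (P : {poly int}) : (size P <= w)%N ->
    (forall j i, (j < k)%N -> (map_poly intr P^`N(j)).[al i] = 0 :> K) -> P = 0.
  move=> sP hP; apply: mapI; rewrite rmorph0; apply: (nderivn_roots_eq0 ai (k := k)).
    by move=> j i jk; rewrite nderivn_map hP.
  by apply: leq_trans wk; apply: leq_trans sP; exact: size_poly.
have [B0|B0] := eqVneq B 0.
  have A0 : A = 0.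
    apply: eq0 => // j i jk.
    by rewrite h // B0 linear0 rmorph0 horner0 mulr0.
  by move: AB0; rewrite A0 B0 eqxx.
apply/eqP => W0; have E := wronsk_eq0_prop B0 W0.
case/eqP: (B0); apply: eq0 => // j i jk.
have /(congr1 (fun P => (map_poly intr P^`N(j)).[al i] : K)) := E.
rewrite /= !nderivnZ !map_polyZ /= !hornerZ h // mulrA [_ * al i]mulrC => /eqP.
rewrite -subr_eq0 -mulrBl mulf_eq0 => /orP[|/eqP//].
rewrite -opprB oppr_eq0 => /negPn/negP[].
by apply: (good_irrational n1 gf); rewrite lead_coef_eq0 lead_coef_eq0 B0 orbT.
Qed.

(** Gauss's lemma: y X - x is primitive, so its t-th power divides W over the integers, and y^t
    divides the leading coefficient of W. *)
Lemma linear_exp_dvd_lead (W : {poly int}) (x y : int) t :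
  W != 0 -> 0 < y -> coprimez x y ->
  ('X - (x%:~R / y%:~R)%:P) ^+ t %| map_poly (intr : int -> rat) W ->
  y ^+ t <= `|lead_coef W|.
Proof.
move=> W0 y0 cxy.
pose p : {poly int} := y *: 'X - x%:P.
have yQ : y%:~R != 0 :> rat by rewrite intr_eq0 gt_eqF.
have pE : map_poly (intr : int -> rat) p = y%:~R *: ('X - (x%:~R / y%:~R)%:P).
  rewrite /p rmorphB /= map_polyZ map_polyX map_polyC /= scalerBr.
  by rewrite -[_ *: _%:P]mul_polyC -polyCM mulrC divfK.
have -> : (('X - (x%:~R / y%:~R)%:P) ^+ t %| map_poly (intr : int -> rat) W) =
    (p ^+ t %| W).
  rewrite -dvdp_rat_int rmorphXn /= pE exprZn dvdpZl //.
  by rewrite expf_neq0.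
case/dvdpP_int => r WE.
have lp : lead_coef p = y.
  have y1 : size (y *: 'X : {poly int}) = 2%N by rewrite size_scale ?gt_eqF // size_polyX.
  rewrite /p lead_coefDl ?lead_coefZ ?lead_coefX ?mulr1 // size_polyN y1.
  exact: leq_ltn_trans (size_polyC_leq1 _) _.
have c1 : `|zcontents p| = 1.
  have : (zcontents p %| gcdz x y)%Z.
    have := dvdzz (zcontents p); rewrite dvdz_contents => /polyOverP po.
    rewrite dvdz_gcd; have := po 0%N; have := po 1%N.
    rewrite /p !coefB !coefZ !coefX !coefC /= mulr1 subr0 mulr0 sub0r.
    by move=> ->; rewrite rpredN => ->.
  rewrite (eqP cxy) dvdz1 => /eqP; lia.
have : lead_coef (p ^+ t) = zcontents (p ^+ t) * lead_coef (zprimitive (p ^+ t)).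
  by rewrite {1}[p ^+ t]zpolyEprim lead_coefZ.
rewrite lead_coef_exp lp => yt.
have zc : `|zcontents (p ^+ t)| = 1.
  elim: t {yt r WE} => [|t IH]; first by rewrite expr0 zcontents_monic ?monic1 ?normr1.
  by rewrite exprS zcontentsM normrM IH c1 mulr1.
have -> : y ^+ t = `|lead_coef (zprimitive (p ^+ t))|.
  by rewrite -[LHS]gtr0_norm ?exprn_gt0 // yt normrM zc mul1r.
rewrite WE lead_coefM normrM ler_peMr //.
have : lead_coef r != 0.
  by rewrite lead_coef_eq0; apply: contraNneq W0 => r0; rewrite WE r0 mulr0.
by move: (lead_coef r) => z; lia.
Qed.

(** Let t be the multiplicity of x1 / y1 as a zero of the Wronskian. If A - r2 B vanished there to
    order t + 2, the Wronskian, which can be computed with A - r2 B in place of A, would vanish to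
    order t + 1. So some l <= t + 1 works, and Gauss's lemma bounds t. *)
Lemma exists_nonvanishing (A B : {poly int}) (x1 y1 x2 y2 : int) :
  wronsk A B != 0 -> 0 < y1 -> coprimez x1 y1 ->
  exists l, y1 ^+ l.-1 <= `|lead_coef (wronsk A B)| /\
   (map_poly intr A^`N(l)).[x1%:~R / y1%:~R] -
   x2%:~R / y2%:~R * (map_poly intr B^`N(l)).[x1%:~R / y1%:~R] != 0 :> rat.
Proof.
move=> W0 y10 cxy; set r1 := _ / _; set r2 := _ / _.
pose mp := map_poly (intr : int -> rat).
have mpI : injective mp by apply: map_inj_poly => //; exact: intr_inj.
pose U := mp A - r2 *: mp B.
have UE l : U^`N(l).[r1] = (mp A^`N(l)).[r1] - r2 * (mp B^`N(l)).[r1].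
  by rewrite nderivnB nderivnZ hornerD hornerN hornerZ /mp !nderivn_map.
have WE : mp (wronsk A B) = U * (mp B)^`() - U^`() * mp B.
  rewrite /wronsk /mp rmorphB !rmorphM /= -!deriv_map -/mp /U derivB derivZ.
  rewrite -!mul_polyC; ring.
have W0' : mp (wronsk A B) != 0 by rewrite -(rmorph0 (map_poly (intr : int -> rat))) (inj_eq mpI).
pose t := mup r1 (mp (wronsk A B)).
have yt : y1 ^+ t <= `|lead_coef (wronsk A B)|.
  apply: linear_exp_dvd_lead W0 y10 cxy _; rewrite -/r1 -/mp.
  by rewrite -mup_geq.
have [/allP h|/allPn[l]] := boolP (all (fun l => U^`N(l).[r1] == 0) (iota 0 t.+2)).
  have : ('X - r1%:P) ^+ t.+2 %| U.
    by apply: dvdp_XsubC_exp => j jt; apply/eqP/h; rewrite mem_iota.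
  case/dvdpP => V VE.
  have : ('X - r1%:P) ^+ t.+1 %| mp (wronsk A B).
    rewrite WE VE derivM deriv_exp derivB derivX derivC subr0 mul1r /=.
    apply: dvdp_sub.
      by apply: dvdp_mulr; apply: dvdp_mull; rewrite [X in _ %| X]exprS dvdp_mull.
    apply: dvdp_mulr; apply: dvdp_add; apply: dvdp_mull.
      by rewrite [X in _ %| X]exprS dvdp_mull.
    by rewrite -mulr_natr dvdp_mulr.
  by rewrite -mup_geq // ltnn.
rewrite mem_iota /= add0n ltnS => lt Ul; exists l; split; last by rewrite -UE.
apply: le_trans yt; apply: ler_weXn2l; first by lia.
by case: l lt {Ul}.
Qed.

Lemma sum_ord_le_support (A : numDomainType) (F : nat -> A) w c :
  (forall i, 0 <= F i) -> (forall i, (w <= i)%N -> F i = 0) ->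
  \sum_(i < c) F i <= \sum_(i < w) F i.
Proof.
move=> F0 Fw; rewrite -!(big_mkord predT).
have [cw|wc] := leqP c w.
  by rewrite (big_cat_nat (leq0n c) cw) /= lerDl sumr_ge0.
rewrite (big_cat_nat (leq0n w) (ltnW wc)) /= gerDl big_nat_cond big1 //.
by move=> i; rewrite andbT => /andP[wi _]; exact: Fw.
Qed.

Lemma coef_wronsk_le (A B : {poly int}) w (b : int) c :
  (size A <= w)%N -> (size B <= w)%N ->
  (forall i, `|A`_i| <= b) -> (forall i, `|B`_i| <= b) ->
  `|(wronsk A B)`_c| <= (w%:R * b) ^+ 2 *+ 2.
Proof.
move=> sA sB hA hB.
have b0 : 0 <= b by apply: le_trans (hA 0%N).
have dle (P : {poly int}) : (size P <= w)%N -> (forall i, `|P`_i| <= b) ->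
    forall i, `|P^`()`_i| <= w%:R * b.
  move=> sP hP i; rewrite coef_deriv; have [wi|iw] := leqP w i.+1.
    rewrite nth_default ?mul0rn ?normr0 ?mulr_ge0 //; exact: leq_trans wi.
  rewrite normrMn -[leLHS]mulr_natl ler_pM // ler_nat; exact: ltnW.
have Mle (P Q : {poly int}) : (size P <= w)%N -> (forall i, `|P`_i| <= b) ->
    (forall i, `|Q`_i| <= w%:R * b) -> forall d, `|(P * Q)`_d| <= (w%:R * b) ^+ 2.
  move=> sP hP hQ d; rewrite coefM; apply: le_trans (ler_norm_sum _ _ _) _.
  apply: (@le_trans _ _ (\sum_(i < d.+1) `|P`_i| * (w%:R * b))).
    by apply: ler_sum => i _; rewrite normrM ler_wpM2l.
  rewrite -mulr_suml expr2 ler_wpM2r ?mulr_ge0 //.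
  apply: le_trans (@sum_ord_le_support _ (fun i => `|P`_i|) w _ _ _) _ => //.
    by move=> i wi; rewrite nth_default ?normr0 // (leq_trans sP).
  apply: (@le_trans _ _ (\sum_(i < w) b)); first by apply: ler_sum => i _.
  by rewrite sumr_const card_ord -[leLHS]mulr_natl.
rewrite /wronsk coefB; apply: le_trans (ler_normB _ _) _; rewrite mulr2n lerD //.
  by apply: Mle => // i; apply: dle.
by rewrite mulrC; apply: Mle => // i; apply: dle.
Qed.

(** * Siegel's lemma *)

Definition house (R : rcfType) n (al : 'I_n -> R[i]) i : R := Num.max 1 (nrm (al i)).

Definition mahler (R : rcfType) n (f : {poly int}) (al : 'I_n -> R[i]) : R :=
  `|lead_coef f|%:~R * \prod_i house al i.

Lemma house_ge1 (R : rcfType) n (al : 'I_n -> R[i]) i : 1 <= house al i.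
Proof. by rewrite le_max lexx. Qed.

Lemma house_gt0 (R : rcfType) n (al : 'I_n -> R[i]) i : 0 < house al i.
Proof. exact: lt_le_trans (house_ge1 al i). Qed.

Lemma nrm_le_house (R : rcfType) n (al : 'I_n -> R[i]) i : nrm (al i) <= house al i.
Proof. by rewrite le_max lexx orbT. Qed.

Lemma conj_root_perm (R : rcfType) n (f : {poly int}) (al : 'I_n -> R[i]) i :
  splits_as f al -> exists j, al j = conjc (al i).
Proof.
move=> fs; have [sf _ fE] := fs.
have h : (map_poly intr f).[conjc (al i)] = 0 :> R[i].
  have fc : map_poly intr f = map_poly (@conjc R) (map_poly (intr : int -> R[i]) f).
    rewrite -map_poly_comp; apply: eq_map_poly => z /=; exact/esym/(rmorph_int conjc).
  by rewrite fc horner_map /= (splits_root i fs) rmorph0.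
move: h; rewrite fE hornerZ horner_prod => /eqP; rewrite mulf_eq0.
rewrite intr_eq0 lead_coef_eq0 -size_poly_eq0 sf /= => /prodf_eq0[j _].
by rewrite hornerXsubC subr_eq0 => /eqP; exists j.
Qed.

(* The real coordinates Re + Im at all conjugates: on a pair of conjugate roots
   they are Re + Im and Re - Im. *)
Definition coord (R : rcfType) (z : R[i]) : R := complex.Re z + complex.Im z.

Lemma coordB (R : rcfType) (z w : R[i]) : coord (z - w) = coord z - coord w.
Proof. by case: z w => a b [c d]; rewrite /coord /=; ring. Qed.

Lemma coord_le (R : rcfType) (z : R[i]) : `|coord z| <= 2 * nrm z.
Proof.
apply: le_trans (ler_normD _ _) _; rewrite mulr2n mulrDl !mul1r.
by rewrite lerD ?normRe_nrm ?normIm_nrm.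
Qed.

Lemma nrm_le_coord (R : rcfType) (z : R[i]) (r : R) :
  `|coord z| <= r -> `|coord (conjc z)| <= r -> nrm z <= r.
Proof. by case: z => a b; rewrite /coord /= => h1 h2; exact: (@nrm_Re_Im R (Complex a b) r h1 h2). Qed.

(** The box principle with a number of cells that depends on the coordinate; in Siegel's lemma it
    varies with the order j of the derivative. *)
Lemma pigeonhole_family (T : finType) (I : finType) (c : nat) (F : I -> pred 'I_c)
    (phi : T -> {ffun I -> 'I_c}) :
  (forall t, phi t \in family F) -> (\prod_i #|F i| < #|T|)%N ->
  exists t u, t != u /\ phi t = phi u.
Proof.
move=> phiF lt; have : ~~ injectiveb phi.
  apply/negP => /injectiveP phiI; move: lt; rewrite ltnNge.
  have <- : #|family F| = (\prod_i #|F i|)%N.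
    by rewrite card_family foldrE big_image /=; apply: eq_bigl.
  rewrite -(card_codom phiI) subset_leq_card //.
  by apply/subsetP => g /codomP[t ->].
by case/injectivePn => t [u tu e]; exists t, u.
Qed.

Lemma bin_le_exp2 s j : ('C(s, j) <= 2 ^ s)%N.
Proof.
elim: s j => [|s IH] [|j]; rewrite ?bin0 ?expn_gt0 //.
by rewrite binS expnS mul2n -addnn leq_add.
Qed.

Lemma sum_exp2_le j m : (\sum_(c < m) 2 ^ (j + c) <= 2 ^ (j + m))%N.
Proof.
elim: m => [|m IH]; first by rewrite big_ord0.
by rewrite big_ord_recr /= addnS expnS mul2n -addnn leq_add2r.
Qed.

Lemma nrm_nderivn_le (R : rcfType) (P : {poly int}) w j (b h : R) (z : R[i]) :
  (size P <= w)%N -> (forall c, `|P`_c|%:~R <= b) -> nrm z <= h -> 1 <= h ->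
  nrm (map_poly intr P^`N(j)).[z] <= b * 2 ^+ w * h ^+ (w.-1 - j).
Proof.
move=> sP hb zh h1; have b0 : 0 <= b by apply: le_trans (hb 0%N); rewrite ler0z.
have h0 : 0 <= h by apply: le_trans h1.
have s1 : (size (map_poly (intr : int -> R[i]) P^`N(j)) <= w - j)%N.
  apply: leq_trans (size_poly _ _) _; apply/leq_sizeP => c wc.
  rewrite coef_nderivn nth_default ?mul0rn // (leq_trans sP) //; lia.
rewrite (horner_coef_wide _ s1); apply: le_trans (nrm_sum _ _ _) _.
apply: (@le_trans _ _ (\sum_(c < w - j) b * (2 ^ (j + c))%:R * h ^+ (w.-1 - j))).
  apply: ler_sum => c _; rewrite nrmM nrmX coef_map /= nrm_int coef_nderivn.
  have cw := ltn_ord c.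
  apply: ler_pM; rewrite ?ler0z ?exprn_ge0 ?nrm_ge0 //; last first.
    apply: (@le_trans _ _ (h ^+ c)); first by rewrite lerXn2r ?nnegrE ?nrm_ge0.
    by apply: ler_weXn2l => //; lia.
  rewrite normrMn rmorphMn /= -mulr_natr ler_pM ?ler0z //.
  by rewrite ler_nat bin_le_exp2.
rewrite -mulr_suml -mulr_sumr -natr_sum ler_wpM2r ?exprn_ge0 // ler_wpM2l //.
rewrite -natrX ler_nat; have [jw|wj] := leqP j w.
  by apply: leq_trans (sum_exp2_le _ _) _; rewrite subnKC.
have -> : (w - j = 0)%N by lia.
by rewrite big_ord0.
Qed.

Section Siegel.
Variables (R : realType) (n : nat) (f : {poly int}) (al : 'I_n -> R[i]).
Variables (k w B0 : nat) (g : R) (E : nat -> nat).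
Hypotheses (n0 : (0 < n)%N) (gf : good_form f al) (kw : (k <= w)%N) (B00 : (0 < B0)%N).
Hypotheses (g1 : 1 <= g) (Mg : mahler f al <= g ^+ n).
Hypothesis (HE : forall j, (j < k)%N -> 2 ^+ (w + 3) * B0%:R * g ^+ (w - j) < (E j)%:R).
Hypothesis (Hcount : (\prod_(j < k) (E j).+1 ^ n < B0.+1 ^ (2 * w))%N).

Let T := ({ffun 'I_w -> 'I_B0.+1} * {ffun 'I_w -> 'I_B0.+1})%type.
Let pol (u : {ffun 'I_w -> 'I_B0.+1}) : {poly int} :=
  \poly_(s < w) (if insub s is Some s' then (u s' : nat)%:Z else 0).
Let xi (t : T) j i : R[i] :=
  (map_poly intr (pol t.1)^`N(j)).[al i] - al i * (map_poly intr (pol t.2)^`N(j)).[al i].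
Let Om j i : R := 2 ^+ (w + 2) * B0%:R * house al i ^+ (w - j).

Let coef_pol u (s : 'I_w) : (pol u)`_s = (u s : nat)%:Z.
Proof. by rewrite coef_poly ltn_ord valK. Qed.

Let xi_le (A B : {poly int}) j i : (j < k)%N -> (size A <= w)%N -> (size B <= w)%N ->
  (forall c, `|A`_c|%:~R <= B0%:R :> R) -> (forall c, `|B`_c|%:~R <= B0%:R :> R) ->
  2 * nrm ((map_poly intr A^`N(j)).[al i] - al i * (map_poly intr B^`N(j)).[al i]) <= Om j i.
Proof.
move=> jk sA sB hA hB.
have h1 := house_ge1 al i; have h0 := house_gt0 al i.
have a1 := nrm_nderivn_le j sA hA (nrm_le_house al i) h1.
have a2 := nrm_nderivn_le j sB hB (nrm_le_house al i) h1.
have e : (w - j = (w.-1 - j).+1)%N by lia.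
have E1 : Om j i = 2 * (B0%:R * 2 ^+ w * house al i ^+ (w.-1 - j) * house al i +
   B0%:R * 2 ^+ w * house al i ^+ (w.-1 - j) * house al i).
  rewrite /Om e exprS addn2 !exprS; ring.
rewrite E1 ler_pM2l //; apply: le_trans (nrmB _ _) _; apply: lerD.
  apply: le_trans a1 _; rewrite ler_peMr // !mulr_ge0 ?exprn_ge0 //; exact: ltW.
rewrite nrmM mulrC ler_pM ?nrm_ge0 //; exact: nrm_le_house.
Qed.

Let Om_gt0 j i : 0 < Om j i.
Proof. by rewrite /Om !mulr_gt0 ?exprn_gt0 ?ltr0n // house_gt0. Qed.

Let size_pol u : (size (pol u) <= w)%N.
Proof. exact: size_poly. Qed.

Let pol_le u c : `|(pol u)`_c|%:~R <= B0%:R :> R.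
Proof.
rewrite coef_poly; case: ltnP => // cw; case: insubP => //= s' _ _.
by rewrite ger0_norm // -pmulrn ler_nat -ltnS.
Qed.

Let cell (t : T) (ji : 'I_k * 'I_n) : nat :=
  Num.truncn ((E ji.1)%:R * (coord (xi t ji.1 ji.2) + Om ji.1 ji.2) / (2 * Om ji.1 ji.2)).

Let Epos j : (j < k)%N -> 0 < (E j)%:R :> R.
Proof.
move=> jk; apply: le_lt_trans (HE jk).
by rewrite !mulr_ge0 ?exprn_ge0 // (le_trans _ g1).
Qed.

Let coord_rng (t : T) (ji : 'I_k * 'I_n) :
  0 <= (E ji.1)%:R * (coord (xi t ji.1 ji.2) + Om ji.1 ji.2) / (2 * Om ji.1 ji.2) <= (E ji.1)%:R.
Proof.
case: ji => j i /=; have O0 := Om_gt0 j i.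
have : `|coord (xi t j i)| <= Om j i.
  apply: le_trans (coord_le _) _.
  by apply: xi_le; rewrite ?ltn_ord ?size_pol // => c; exact: pol_le.
rewrite ler_norml => /andP[l1 l2]; apply/andP; split.
  apply: divr_ge0; last by rewrite mulr_ge0 // ltW.
  by apply: mulr_ge0 => //; rewrite -lerBlDr sub0r.
have O2 : 0 < 2 * Om j i by rewrite mulr_gt0.
rewrite (ler_pdivrMr _ _ O2); apply: ler_wpM2l; first exact: ler0n.
by rewrite mulr2n mulrDl !mul1r lerD2r.
Qed.

Let cell_le t ji : (cell t ji <= E ji.1)%N.
Proof.
have /andP[h0 h1] := coord_rng t ji; have /andP[l _] := truncn_itv h0.
by rewrite -(ler_nat R); apply: le_trans h1.
Qed.

(** Two pairs of polynomials with coefficients in [0, B0] have all real coordinates of the numbers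
    [xi] in the same cells. For their difference, A^(j) - X B^(j) is so small at every conjugate
    that lead^(w - j) times the product of its values, an integer, is less than 1 in modulus, hence
    0. So one value vanishes, and by conjugacy all do. The Mahler measure enters as the product of
    the leading coefficient and the [house] factors. *)
Lemma siegel_lemma : exists A B : {poly int},
  [/\ (size A <= w)%N, (size B <= w)%N, (A != 0) || (B != 0),
   (forall c, `|A`_c|%:~R <= B0%:R :> R) /\ (forall c, `|B`_c|%:~R <= B0%:R :> R)
   & forall j i, (j < k)%N -> (map_poly intr A^`N(j)).[al i] =
       al i * (map_poly intr B^`N(j)).[al i]].
Proof.
pose c := (\max_(j < k) E j).+1.
have Ec (j : 'I_k) : (E j < c)%N by rewrite ltnS; exact: (leq_bigmax j).
pose F (ji : 'I_k * 'I_n) : pred 'I_c := fun e => (e <= E ji.1)%N.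
pose phi (t : T) : {ffun 'I_k * 'I_n -> 'I_c} := [ffun ji => inord (cell t ji)].
have phiE t ji : phi t ji = cell t ji :> nat.
  by rewrite ffunE inordK // (leq_ltn_trans (cell_le t ji)) ?Ec.
have phiF t : phi t \in family F.
  by apply/familyP => ji; rewrite unfold_in /F phiE cell_le.
have cardF ji : #|F ji| = (E ji.1).+1.
  have -> : #|F ji| = #|[set: 'I_(E ji.1).+1]|.
    have le : ((E ji.1).+1 <= c)%N by exact: Ec.
    rewrite -(card_imset [set: 'I_(E ji.1).+1] (f := widen_ord le)); last first.
      by move=> x y /(congr1 val) /= e; apply: val_inj.
    apply: eq_card => e; apply/idP/imsetP => [he|[x _ ->]].
      have he' : (e < (E ji.1).+1)%N by exact: he.
      by exists (Ordinal he') => //; apply: val_inj.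
    by rewrite unfold_in /F /= -ltnS.
  by rewrite cardsT card_ord.
have [|t [u [tu ptu]]] := pigeonhole_family phiF.
  rewrite card_prod !card_ffun !card_ord -expnD addnn -mul2n.
  apply: leq_ltn_trans Hcount; rewrite (eq_bigr _ (fun ji _ => cardF ji)).
  rewrite -(pair_bigA _ (fun (j : 'I_k) (i : 'I_n) => (E j).+1)) /=.
  by under eq_bigr => j _ do rewrite prod_nat_const card_ord.
pose A := pol t.1 - pol u.1; pose B := pol t.2 - pol u.2.
have sub_le a b s : `|(pol a - pol b)`_s|%:~R <= B0%:R :> R.
  rewrite coefB !coef_poly; case: ltnP => [sw|_]; last by rewrite subr0.
  case: insubP => [s' _ _|_]; last by rewrite subr0.
  have := ltn_ord (a s'); have := ltn_ord (b s').
  move=> h1 h2; have : (`|(a s' : nat)%:Z - (b s' : nat)%:Z| <= B0%:Z) by lia.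
  by rewrite -(ler_int R) => /le_trans; apply.
have xiE j i : (map_poly intr A^`N(j)).[al i] - al i * (map_poly intr B^`N(j)).[al i] =
    xi t j i - xi u j i.
  rewrite /xi /A /B !nderivnB !rmorphB /= !hornerE; ring.
exists A, B; split.
- by rewrite (leq_trans (size_polyD _ _)) // geq_max size_polyN !size_pol.
- by rewrite (leq_trans (size_polyD _ _)) // geq_max size_polyN !size_pol.
- apply: contraNT tu; rewrite negb_or !negbK !subr_eq0 => /andP[/eqP e1 /eqP e2].
  have polI a b : pol a = pol b -> a = b.
    move=> e; apply/ffunP => s; apply: val_inj => /=.
    by have := congr1 (fun p : {poly int} => p`_s) e; rewrite !coef_pol => -[].
  by case: (t) (u) e1 e2 => [t1 t2] [u1 u2] /= /polI-> /polI->.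
- by split=> s; apply: sub_le.
move=> j i jk; apply/eqP; rewrite -subr_eq0; apply/eqP.
pose G := A^`N(j) - 'X * B^`N(j).
have GE i' : (map_poly intr G).[al i'] = xi t j i' - xi u j i'.
  by rewrite -xiE /G rmorphB rmorphM /= map_polyX !hornerE.
suff [i' hi'] : exists i', (map_poly intr G).[al i'] = 0 :> R[i].
  by have := gf.2 G i' i hi'; rewrite GE xiE.
have small i' : nrm (map_poly intr G).[al i'] <= 2 * Om j i' / (E j)%:R.
  have dc i2 : `|coord (xi t j i2 - xi u j i2)| <= 2 * Om j i2 / (E j)%:R.
    pose ji := (Ordinal jk, i2).
    have e : cell t ji = cell u ji by rewrite -!phiE ptu.
    have /andP[t0 _] := coord_rng t ji; have /andP[u0 _] := coord_rng u ji.
    have /andP[t1 t2] := truncn_itv t0; have /andP[u1 u2] := truncn_itv u0.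
    move: t1 t2 u1 u2; rewrite -/(cell t ji) -/(cell u ji) e /= => t1 t2 u1 u2.
    have O0 := Om_gt0 j i2; have E0 := Epos jk.
    set x := (E j)%:R * (coord (xi t j i2) + _) / _ in t1 t2.
    set y := (E j)%:R * (coord (xi u j i2) + _) / _ in u1 u2.
    have xy : `|x - y| <= 1.
      rewrite -natr1 in t2 u2; rewrite ler_norml; apply/andP; split; lra.
    have -> : coord (xi t j i2 - xi u j i2) = (x - y) * (2 * Om j i2 / (E j)%:R).
      rewrite coordB /x /y; field; by rewrite !gt_eqF.
    have p0 : 0 <= 2 * Om j i2 / (E j)%:R.
      by apply: divr_ge0; [rewrite mulr_ge0 // ltW | exact: ltW].
    by rewrite normrM (ger0_norm p0) ler_piMl.
  (* The index of the complex conjugate root supplies the other coordinate Re - Im; its cells have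
     the same width since [house] takes the same value there. *)
  rewrite GE; have [i3 i3E] := conj_root_perm i' gf.1.
  have hs : house al i3 = house al i' by rewrite /house i3E nrm_conj.
  have cxi v : xi v j i3 = conjc (xi v j i').
    have cm (P : {poly int}) : (map_poly intr P).[conjc (al i')] =
        conjc (map_poly (intr : int -> R[i]) P).[al i'].
      rewrite -(horner_map (@conjc R)) /= -map_poly_comp; congr (_.[_]).
      apply: eq_map_poly => z /=; exact/esym/(rmorph_int conjc).
    by rewrite /xi i3E !cm rmorphB rmorphM.
  apply: nrm_le_coord => //.
  by have := dc i3; rewrite !cxi -rmorphB /Om hs.
have sG : (size G <= (w - j).+1)%N.
  apply/leq_sizeP => s ws; rewrite /G coefB coefXM !coef_nderivn.
  have cz a b c' : (w <= c')%N -> (pol a - pol b)`_c' = 0.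
    by move=> wc; rewrite coefB !coef_poly ltnNge wc subr0.
  rewrite cz ?mul0rn ?sub0r; last lia.
  case: eqP => [_|s0]; first by rewrite oppr0.
  by rewrite cz ?mul0rn ?oppr0 //; lia.
have [z zE] := sylvester_norm gf.1 sG.
have z0 : z = 0.
  apply/eqP; rewrite -normr_eq0 -[_ == _]negbK; apply/negP => zn.
  have z1 : 1 <= `|z| by lia.
  have : 1 <= nrm (z%:~R : R[i]) by rewrite nrm_int -[1]/(1%:~R) ler_int.
  rewrite -zE nrmM nrmX nrm_int nrm_prod leNgt => /negP; apply.
  apply: (@le_lt_trans _ _ (`|lead_coef f|%:~R ^+ (w - j) *
     \prod_i' (2 * Om j i' / (E j)%:R))).
    rewrite ler_wpM2l ?exprn_ge0 ?ler0z // ler_prod // => i' _.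
    by rewrite nrm_ge0 small.
  have -> : \prod_i' (2 * Om j i' / (E j)%:R) =
     (2 ^+ (w + 3) * B0%:R / (E j)%:R) ^+ n * (\prod_i' house al i') ^+ (w - j).
    rewrite -prodrXl; under eq_bigr => i' _.
      have -> : 2 * Om j i' / (E j)%:R = 2 ^+ (w + 3) * B0%:R / (E j)%:R *
         house al i' ^+ (w - j).
        by rewrite /Om addn3 addn2 !exprS; ring.
      over.
    by rewrite big_split /= prodr_const card_ord.
  rewrite mulrCA -exprMn -/(mahler f al).
  have E0 := Epos jk.
  apply: (@le_lt_trans _ _ ((2 ^+ (w + 3) * B0%:R / (E j)%:R * g ^+ (w - j)) ^+ n)).
    have -> : (2 ^+ (w + 3) * B0%:R / (E j)%:R * g ^+ (w - j)) ^+ n =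
       (2 ^+ (w + 3) * B0%:R / (E j)%:R) ^+ n * (g ^+ n) ^+ (w - j).
      by rewrite exprMn -!exprM (mulnC n).
    apply: ler_wpM2l; first by rewrite exprn_ge0 // !mulr_ge0 ?invr_ge0 ?exprn_ge0.
    rewrite lerXn2r ?nnegrE ?exprn_ge0 ?(le_trans _ g1) //.
    by rewrite mulr_ge0 ?ler0z // prodr_ge0 // => i' _; rewrite ltW // house_gt0.
  rewrite exprn_ilt1; first by rewrite -lt0n.
    by rewrite !mulr_ge0 ?invr_ge0 ?exprn_ge0 ?(le_trans _ g1) //; exact: ltW.
  by rewrite mulrAC ltr_pdivrMr // mul1r HE.
move: zE; rewrite z0 => /eqP; rewrite mulf_eq0 expf_eq0 intr_eq0 lead_coef_eq0.
have [sf _ _] := gf.1.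
rewrite -size_poly_eq0 sf andbF /= => /prodf_eq0[i' _ /eqP hi'].
by exists i'.
Qed.
End Siegel.

(** * The Thue-Siegel principle *)

Lemma hom_eval (K : numFieldType) d (P : {poly int}) (x y : int) :
  (size P <= d.+1)%N -> y != 0 ->
  (hom d P x y)%:~R = y%:~R ^+ d * (map_poly intr P).[x%:~R / y%:~R] :> K.
Proof.
move=> sP y0; have yK : y%:~R != 0 :> K by rewrite intr_eq0.
rewrite (@horner_coef_wide _ d.+1); last exact: leq_trans (size_poly _ _) sP.
rewrite /hom rmorph_sum mulr_sumr; apply: eq_bigr => i _.
have id : (i <= d)%N by rewrite -ltnS.
rewrite !rmorphM !rmorphXn /= coef_map /= expr_div_n.
have -> : (y%:~R : K) ^+ d = y%:~R ^+ (d - i) * y%:~R ^+ i by rewrite -exprD subnK.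
field; by rewrite expf_neq0.
Qed.

Lemma nderivn_nderivn (K : comNzRingType) (P : {poly K}) l c :
  (P^`N(l))^`N(c) = P^`N(l + c) *+ 'C(l + c, l).
Proof.
apply/polyP => i; rewrite coefMn !coef_nderivn -!mulrnA addnA; congr (_ *+ _).
apply/eqP; rewrite -(@eqn_pmul2r (l`! * c`! * i`!)) ?muln_gt0 ?fact_gt0 //.
have e1 := bin_fact (leq_addr i c); have e2 := bin_fact (leq_addr (c + i) l).
have e3 := bin_fact (leq_addr i (l + c)); have e4 := bin_fact (leq_addr c l).
rewrite !addKn in e1 e2 e3 e4; rewrite -addnA in e3 *.
apply/eqP; transitivity ((l + (c + i))`!).
  rewrite -e2 -e1; ring.
rewrite -e3 -e4; ring.
Qed.

(** Only the Taylor terms with l + c >= k survive at a; their binomial coefficients are bounded by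
    powers of 2 that add up to at most 2^w. *)
Lemma taylor_tail_le (R : rcfType) (P : {poly R[i]}) w k l (T : R) (a h : R[i]) :
  (size P <= w)%N -> (forall j, (j < k)%N -> P^`N(j).[a] = 0) ->
  0 <= T -> (forall j, nrm P^`N(j).[a] <= T) -> nrm h <= 1 ->
  nrm (P^`N(l)).[a + h] <= T * 2 ^+ w * nrm h ^+ (k - l).
Proof.
move=> sP P0 T0 PT h1.
have s1 : (size P^`N(l) <= w - l)%N.
  apply/leq_sizeP => c wc; rewrite coef_nderivn nth_default ?mul0rn //.
  rewrite (leq_trans sP) //; lia.
rewrite (@nderiv_taylor_wide _ _ _ a h (mulrC _ _) s1).
apply: le_trans (nrm_sum _ _ _) _.
apply: (@le_trans _ _ (\sum_(c < w - l) T * (2 ^ (l + c))%:R * nrm h ^+ (k - l))).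
  apply: ler_sum => c _; rewrite nderivn_nderivn hornerMn nrmM nrmX.
  have [lk|kl] := ltnP (l + c) k.
    by rewrite P0 // mul0rn nrm0 mul0r !mulr_ge0 ?exprn_ge0 ?nrm_ge0.
  apply: ler_pM; rewrite ?exprn_ge0 ?nrm_ge0 //; last first.
    by apply: ler_wiXn2l; rewrite ?nrm_ge0 //; lia.
  rewrite -mulr_natr nrmM nrm_nat ler_pM ?nrm_ge0 //.
  by rewrite ler_nat bin_le_exp2.
rewrite -mulr_suml -mulr_sumr -natr_sum ler_wpM2r ?exprn_ge0 ?nrm_ge0 // ler_wpM2l //.
rewrite -natrX ler_nat; have [jw|wj] := leqP l w.
  by apply: leq_trans (sum_exp2_le _ _) _; rewrite subnKC.
have -> : (w - l = 0)%N by lia.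
by rewrite big_ord0.
Qed.

Lemma sqr_le_exp4 w : (2 * w ^ 2 <= 4 ^ w)%N.
Proof.
elim: w => // -[|[|w]] // IH; rewrite expnS; apply: leq_trans (leq_mul (leqnn 4) IH).
by rewrite -!mulnn; nia.
Qed.

(** Siegel's lemma in logarithms: 2 w unknowns with more than exp b values each against n k
    conditions. The last hypothesis bounds the logarithm of the number of cells, apart from a factor
    (B0 + 1)^(n k), by b (2 w - n k). *)
Lemma siegel_exp (R : realType) n (f : {poly int}) (al : 'I_n -> R[i]) k w (L b : R) :
  (0 < n)%N -> good_form f al -> (k <= w)%N -> (n * k < 2 * w)%N ->
  0 <= L -> mahler f al <= expR L -> 0 <= b ->
  ((w + 3) * (n * k))%:R * ln 2 + L * (\sum_(j < k) (w - j))%:R <=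
    b * (2 * w - n * k)%:R ->
  exists A B : {poly int},
  [/\ (size A <= w)%N, (size B <= w)%N, (A != 0) || (B != 0),
   (forall c, `|A`_c|%:~R <= expR b) /\ (forall c, `|B`_c|%:~R <= expR b)
   & forall j i, (j < k)%N -> (map_poly intr A^`N(j)).[al i] =
       al i * (map_poly intr B^`N(j)).[al i]].
Proof.
move=> n0 gf kw nkw L0 ML b0 Hb.
pose B0 := Num.truncn (expR b).
have /andP[Bl Bu] := truncn_itv (ltW (expR_gt0 b)); rewrite -/B0 in Bl Bu.
have B1 : (0 < B0)%N by rewrite truncn_gt_nat -expR0 ler_expR.
pose g := expR (L / n%:R).
have nR : n%:R != 0 :> R by rewrite pnatr_eq0 -lt0n.
have gn : g ^+ n = expR L by rewrite -expRM_natl mulrC divfK.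
have g1 : 1 <= g by rewrite -expR0 ler_expR divr_ge0.
have g0 : 0 < g by exact: expR_gt0.
pose E j := (Num.truncn (2 ^+ (w + 3) * B0%:R * g ^+ (w - j))).+1.
have X0 j : 0 <= 2 ^+ (w + 3) * B0%:R * g ^+ (w - j).
  by rewrite !mulr_ge0 ?exprn_ge0 // ltW.
have HE j : (j < k)%N -> 2 ^+ (w + 3) * B0%:R * g ^+ (w - j) < (E j)%:R.
  by move=> _; exact: truncnS_gt.
have E_le j : (E j).+1%:R <= 2 ^+ (w + 3) * B0.+1%:R * g ^+ (w - j).
  have /andP[l _] := truncn_itv (X0 j).
  rewrite -[B0.+1%:R]natr1 mulrDr mulr1 mulrDl /E -[(_).+2%:R]natr1 -natr1 -addrA lerD //.
  have p1 : 1 <= g ^+ (w - j) by rewrite exprn_ege1.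
  have p2 : 2 <= 2 ^+ (w + 3) :> R.
    rewrite addn3 exprS -[leLHS]mulr1 ler_pM2l // exprn_ege1 //; lra.
  apply: (@le_trans _ _ (2 * 1)); first by rewrite mulr1.
  exact: ler_pM.
have Hcount : (\prod_(j < k) (E j).+1 ^ n < B0.+1 ^ (2 * w))%N.
  rewrite -(ltr_nat R) natr_prod natrX.
  apply: (@le_lt_trans _ _ (\prod_(j < k) (2 ^+ (w + 3) * B0.+1%:R * g ^+ (w - j)) ^+ n)).
    apply: ler_prod => j _; rewrite ler0n natrX lerXn2r ?nnegrE ?ler0n //.
    by rewrite !mulr_ge0 ?exprn_ge0 ?ler0n ?ltW.
  have -> : \prod_(j < k) (2 ^+ (w + 3) * B0.+1%:R * g ^+ (w - j)) ^+ n =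
     B0.+1%:R ^+ (n * k) *
     expR (((w + 3) * (n * k))%:R * ln 2 + L * (\sum_(j < k) (w - j))%:R).
    have -> : expR (((w + 3) * (n * k))%:R * ln 2 + L * (\sum_(j < k) (w - j))%:R) =
       2 ^+ ((w + 3) * (n * k)) * (g ^+ n) ^+ (\sum_(j < k) (w - j)).
      rewrite expRD expRM_natl lnK ?posrE // gn; congr (_ * _).
      by rewrite mulrC expRM_natl.
    elim: (k) => [|k' IH]; first by rewrite !big_ord0 !muln0 !expr0 !mulr1.
    rewrite !big_ord_recr /= IH mulnS.
    have -> : (2 : R) ^+ ((w + 3) * (n + n * k')) =
        (2 ^+ (w + 3)) ^+ n * 2 ^+ ((w + 3) * (n * k')) by rewrite mulnDr exprD exprM.
    have -> : (g ^+ n) ^+ (\sum_(j < k') (w - j) + (w - k')) =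
        (g ^+ n) ^+ (\sum_(j < k') (w - j)) * (g ^+ (w - k')) ^+ n.
      by rewrite exprD -!exprM [((w - k') * n)%N]mulnC.
    rewrite [B0.+1%:R ^+ (n + _)]exprD !exprMn; ring.
  apply: (@le_lt_trans _ _ (B0.+1%:R ^+ (n * k) * expR b ^+ (2 * w - n * k))).
    rewrite ler_pM2l ?exprn_gt0 ?ltr0n // -expRM_natl ler_expR [leRHS]mulrC; exact: Hb.
  rewrite -[X in _ < _ ^+ X](subnKC (ltnW nkw)) exprD ltr_pM2l ?exprn_gt0 ?ltr0n //.
  rewrite ltrXn2r ?nnegrE ?expR_ge0 ?ler0n //; rewrite -?lt0n ?subn_gt0 //.
have Mg : mahler f al <= g ^+ n by rewrite gn.
have [A [B [sA sB AB [hA hB] hz]]] := siegel_lemma n0 gf kw B1 g1 Mg HE Hcount.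
by exists A, B; split => //; split => c; [apply: le_trans (hA c) Bl|apply: le_trans (hB c) Bl].
Qed.

(** For a suitable l the integer z = y1^d y2 (A^(l)(r1) - r2 B^(l)(r1)) is nonzero. With P = A - al
    B the bracket is P^(l)(r1) + (al - r2) B^(l)(r1): the first term is small because P has a zero
    of order k at al, the second because r2 is close to al. The last two inequalities make each
    contribution to |z| less than 1/2. *)
Lemma thue_step (R : realType) n (f : {poly int}) (al : 'I_n -> R[i]) (i0 : 'I_n)
    k w (L b u v : R) (x1 y1 x2 y2 : int) :
  (2 < n)%N -> good_form f al -> nrm (al i0) <= 1 -> 0 <= L -> mahler f al <= expR L ->
  0 < y1 -> 0 < y2 -> coprimez x1 y1 -> `|x1| <= y1 ->
  y1%:~R = expR u -> y2%:~R = expR v ->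
  nrm (al i0 - x1%:~R / y1%:~R) <= expR (n.-2%:R * L - n%:R * u) ->
  nrm (al i0 - x2%:~R / y2%:~R) <= expR (n.-2%:R * L - n%:R * v) ->
  n.-2%:R * L <= n%:R * u ->
  (0 < k)%N -> (k <= w)%N -> (w <= n * k)%N -> (n * k < 2 * w)%N -> 0 <= b ->
  ((w + 3) * (n * k))%:R * ln 2 + L * (\sum_(j < k) (w - j))%:R <=
    b * (2 * w - n * k)%:R ->
  v + w.+1%:R * ln 4 + b + (w%:R - 1) * u + (n%:R - 1) * (u + w%:R * ln 4 + 2 * b)
    + (k * n.-2)%:R * L < (n * k)%:R * u ->
  n.-2%:R * L + w.+1%:R * ln 4 + b + (w%:R - 1) * u < (n%:R - 1) * v ->
  False.
Proof.
move=> n2 gf a1 L0 ML y10 y20 cxy1 xy1 uE vE h1 h2 Lu k0 kw wk nkw b0 Hb HI HII.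
have n0 : (0 < n)%N by exact: ltn_trans n2.
have [A [B [sA sB AB [hA hB] hz]]] := siegel_exp n0 gf kw nkw L0 ML b0 Hb.
have W0 : wronsk A B != 0 by apply: (wronsk_neq0 (ltnW n2) gf sA sB wk AB hz).
have [l [ly nv]] := exists_nonvanishing x2 y2 W0 y10 cxy1.
have w0 : (0 < w)%N by move: nkw; clear; lia.
have ln40 : 0 <= ln 4 :> R by rewrite ln_ge0 // ler1n.
have u0 : 0 <= u by rewrite -(ler_expR) expR0 -uE -[1]/(1%:~R) ler_int -gtz0_ge1.
have v0 : 0 <= v by rewrite -(ler_expR) expR0 -vE -[1]/(1%:~R) ler_int -gtz0_ge1.
have lw : (l < w)%N.
  rewrite ltnNge; apply/negP => wl; case/eqP: nv.
  by rewrite !nderivn_poly0 ?(leq_trans sA) ?(leq_trans sB) // rmorph0 !horner0 mulr0 subr0.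
(* The price of the choice of l: y1^(l - 1) is at most the leading coefficient of the Wronskian,
   itself at most 2 (w e^b)^2 <= 4^w e^(2 b). *)
have lu : l%:R * u <= u + w%:R * ln 4 + 2 * b.
  have bb : `|lead_coef (wronsk A B)|%:~R <= expR (w%:R * ln 4 + 2 * b).
    pose B1 := Num.truncn (expR b).
    have /andP[Bl Bu] := truncn_itv (ltW (expR_gt0 b)); rewrite -/B1 in Bl Bu.
    have toB1 (z : int) : `|z|%:~R <= expR b -> `|z| <= B1%:Z.
      move=> zb; have : `|z|%:~R < B1.+1%:R :> R by exact: le_lt_trans zb Bu.
      by rewrite pmulrn ltr_int -addn1 PoszD ltzD1.
    have := coef_wronsk_le (size (wronsk A B)).-1 sA sB (fun c => toB1 _ (hA c)) (fun c => toB1 _ (hB c)).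
    rewrite -/(lead_coef _) -(ler_int R) => /le_trans; apply.
    rewrite rmorphMn rmorphXn rmorphM /= rmorph_nat -pmulrn exprMn.
    apply: (@le_trans _ _ (4 ^+ w * expR b ^+ 2)).
      rewrite -mulrnAl ler_pM ?mulrn_wge0 ?exprn_ge0 ?ler0n //.
        have -> : w%:R ^+ 2 *+ 2 = (2 * w ^ 2)%:R :> R by rewrite natrM natrX mulr_natl.
        by rewrite -natrX ler_nat sqr_le_exp4.
      by rewrite lerXn2r ?nnegrE ?ler0n ?expR_ge0.
    by rewrite expRD !expRM_natl lnK ?posrE.
  have : y1%:~R ^+ l.-1 <= expR (w%:R * ln 4 + 2 * b).
    apply: le_trans bb; rewrite -rmorphXn ler_int; exact: ly.
  rewrite uE -expRM_natl ler_expR => h.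
  have : l%:R * u <= (l.-1%:R + 1) * u.
    by apply: ler_wpM2r => //; rewrite natr1 ler_nat leqSpred.
  by move: h; clear; rewrite mulrDl mul1r; lra.
pose d := (w.-1 - l)%N.
have sd (P : {poly int}) : (size P <= w)%N -> (size P^`N(l) <= d.+1)%N.
  move=> sP; apply/leq_sizeP => c wc; rewrite coef_nderivn nth_default ?mul0rn //.
  rewrite (leq_trans sP) //; move: wc lw; rewrite /d; clear; lia.
pose z := hom d A^`N(l) x1 y1 * y2 - x2 * hom d B^`N(l) x1 y1.
have zE (K : numFieldType) : z%:~R = y1%:~R ^+ d * y2%:~R *
   ((map_poly intr A^`N(l)).[x1%:~R / y1%:~R] -
    x2%:~R / y2%:~R * (map_poly intr B^`N(l)).[x1%:~R / y1%:~R]) :> K.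
  rewrite /z rmorphB !rmorphM /= !hom_eval ?sd ?gt_eqF //.
  field; by rewrite intr_eq0 gt_eqF.
have z0 : z != 0.
  have y1n : y1 != 0 by rewrite gt_eqF.
  have y2n : y2 != 0 by rewrite gt_eqF.
  rewrite -(intr_eq0 rat) zE; apply: mulf_neq0 => //.
  by apply: mulf_neq0; rewrite ?expf_neq0 ?intr_eq0.
have z1 : 1 <= nrm (z%:~R : R[i]) by rewrite nrm_int -[1]/(1%:~R) ler_int -gtz0_ge1 normr_gt0.
set a := al i0 in a1 h1 h2.
pose r1 : R[i] := x1%:~R / y1%:~R; pose r2 : R[i] := x2%:~R / y2%:~R.
pose P := map_poly intr A - a *: map_poly intr B.
have sP : (size P <= w)%N.
  rewrite (leq_trans (size_polyD _ _)) // geq_max size_polyN.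
  rewrite (leq_trans (size_poly _ _)) //= (leq_trans (size_scale_leq _ _)) //.
  exact: leq_trans (size_poly _ _) sB.
have PE j : P^`N(j) = map_poly intr A^`N(j) - a *: map_poly intr B^`N(j).
  by rewrite /P nderivnB nderivnZ !nderivn_map.
have P0 j : (j < k)%N -> P^`N(j).[a] = 0.
  by move=> jk; rewrite PE hornerD hornerN hornerZ hz // subrr.
have eb0 := expR_ge0 b.
have PT j : nrm P^`N(j).[a] <= 2 * (expR b * 2 ^+ w).
  rewrite PE hornerD hornerN hornerZ; apply: le_trans (nrmB _ _) _.
  have tA := nrm_nderivn_le j sA hA a1 (lexx 1).
  have tB := nrm_nderivn_le j sB hB a1 (lexx 1).
  rewrite !expr1n !mulr1 in tA tB.
  rewrite [leRHS](_ : _ = expR b * 2 ^+ w + expR b * 2 ^+ w); last by ring.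
  rewrite lerD // nrmM.
  by apply: le_trans tB; rewrite ler_piMl ?nrm_ge0.
have eh1 : expR (n.-2%:R * L - n%:R * u) <= 1 by rewrite -[leRHS]expR0 ler_expR subr_le0.
have hle1 : nrm (r1 - a) <= 1.
  by rewrite -opprB nrmN (le_trans h1).
have t1 : nrm (P^`N(l)).[r1] <= 2 * (expR b * 2 ^+ w) * 2 ^+ w * nrm (r1 - a) ^+ (k - l).
  have := @taylor_tail_le _ P w k l _ a (r1 - a) sP P0 _ PT hle1.
  by rewrite subrKC; apply; rewrite !mulr_ge0 ?exprn_ge0.
have r1le : nrm r1 <= 1.
  by rewrite /r1 nrmM nrmV !nrm_int (gtr0_norm y10) ler_pdivrMr ?mul1r ?ler_int ?ltr0z.
have t2 := nrm_nderivn_le l sB hB r1le (lexx 1); rewrite expr1n mulr1 in t2.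
have zle : nrm (z%:~R : R[i]) <= expR u ^+ d * expR v *
   (2 * (expR b * 2 ^+ w) * 2 ^+ w * nrm (r1 - a) ^+ (k - l) +
    nrm (a - r2) * (expR b * 2 ^+ w)).
  rewrite zE !nrmM nrmX !nrm_int !gtr0_norm // uE vE.
  rewrite ler_wpM2l ?mulr_ge0 ?exprn_ge0 ?expR_ge0 //.
  have -> : (map_poly intr A^`N(l)).[x1%:~R / y1%:~R] -
     x2%:~R / y2%:~R * (map_poly intr B^`N(l)).[x1%:~R / y1%:~R] =
     (P^`N(l)).[r1] + (a - r2) * (map_poly intr B^`N(l)).[r1].
    by rewrite PE hornerD hornerN hornerZ -/r1 -/r2; ring.
  apply: le_trans (nrmD _ _) _; rewrite lerD // nrmM ler_wpM2l ?nrm_ge0 //.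
have e4 : 4 ^+ w = expR (w%:R * ln 4) :> R by rewrite expRM_natl lnK // posrE.
have e22 : 2 ^+ w * 2 ^+ w = 4 ^+ w :> R by rewrite -exprMn -natrM.
have E1 : 4 * 4 ^+ w = expR (w.+1%:R * ln 4) :> R by rewrite -exprS expRM_natl lnK // posrE.
have dE : d%:R = w%:R - 1 - l%:R :> R.
  have lw' : (l <= w.-1)%N by rewrite -ltnS prednK.
  by rewrite /d natrB // -subn1 natrB.
have key (X : R) : X = expR u ^+ d * expR v * expR b * (4 * 4 ^+ w) ->
   X = expR (d%:R * u + v + b + w.+1%:R * ln 4).
  by move->; rewrite E1 -expRM_natl -!expRD.
pose X := expR u ^+ d * expR v * expR b * (4 * 4 ^+ w).
have X0 : 0 <= X by rewrite !mulr_ge0 ?exprn_ge0 ?expR_ge0.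
have : 1 <= (X * nrm (r1 - a) ^+ (k - l) + X * nrm (a - r2)) / 2.
  apply: le_trans (le_trans z1 zle) _.
  rewrite mulrDr [leRHS]mulrDl lerD //.
    by rewrite /X -e22; rewrite le_eqVlt; apply/orP; left; apply/eqP; field.
  have -> : expR u ^+ d * expR v * (nrm (a - r2) * (expR b * 2 ^+ w)) =
     expR u ^+ d * expR v * expR b * nrm (a - r2) * 2 ^+ w by ring.
  have -> : X * nrm (a - r2) / 2 = expR u ^+ d * expR v * expR b * nrm (a - r2) *
     (2 * 2 ^+ w * 2 ^+ w) by rewrite /X -e22; field.
  rewrite ler_wpM2l ?mulr_ge0 ?exprn_ge0 ?expR_ge0 ?nrm_ge0 //.
  rewrite ler_peMl ?exprn_ge0 // -[leLHS]mulr1 ler_pM ?ler1n // exprn_ege1 ?ler1n //.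
have [hI|hI] := leP 1 (X * nrm (r1 - a) ^+ (k - l)); last first.
  move=> h; have {h} : 1 <= X * nrm (a - r2) by move: hI h; clear; lra.
  rewrite leNgt => /negP; apply; apply: le_lt_trans (_ : X * expR (n.-2%:R * L - n%:R * v) < 1).
    by rewrite ler_wpM2l.
  rewrite (key X) // -expRD -[ltRHS]expR0 ltr_expR dE.
  have : 0 <= l%:R * u by rewrite mulr_ge0.
  by move: HII; clear; rewrite !mulrBl !mul1r; lra.
move=> _; move: hI; rewrite leNgt => /negP; apply.
(* The exponent k - l is a truncated subtraction. If l >= k, the first inequality would force w <=
   k, against n k < 2 w. *)
have lk : (l < k)%N.
  rewrite ltnNge; apply/negP => kl.
  have klu : k%:R * u <= l%:R * u by apply: ler_wpM2r => //; rewrite ler_nat.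
  have h0 : (n%:R - 1) * (k%:R * u) <= (n%:R - 1) * (u + w%:R * ln 4 + 2 * b).
    by apply: ler_wpM2l; [rewrite subr_ge0 ler1n | exact: le_trans klu lu].
  have h3 : 0 <= (k * n.-2)%:R * L by rewrite mulr_ge0.
  have h4 : 0 <= w.+1%:R * ln 4 :> R by rewrite mulr_ge0.
  have : (w%:R - 1) * u < k%:R * u.
    by move: HI h0 h3 h4 b0 v0; clear; rewrite natrM !mulrBl !mul1r mulrA; lra.
  move=> hlt; have : w%:R - 1 < k%:R :> R.
    by rewrite ltNge; apply: contraTN hlt => hle; rewrite -leNgt ler_wpM2r.
  rewrite ltrBlDr natr1 ltr_nat; move: n2 nkw w0; clear; nia.
apply: le_lt_trans (_ : X * expR (n.-2%:R * L - n%:R * u) ^+ (k - l) < 1).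
  rewrite ler_wpM2l // lerXn2r ?nnegrE ?nrm_ge0 ?expR_ge0 //.
  by rewrite -opprB nrmN.
have lkR : (k - l)%:R = k%:R - l%:R :> R by rewrite natrB // ltnW.
rewrite (key X) // -expRM_natl -expRD -[ltRHS]expR0 ltr_expR dE lkR.
have kL : 0 <= l%:R * (n.-2%:R * L) by rewrite !mulr_ge0.
have lu' : (n%:R - 1) * (l%:R * u) <= (n%:R - 1) * (u + w%:R * ln 4 + 2 * b).
  by apply: ler_wpM2l => //; rewrite subr_ge0 ler1n.
move: HI lu' kL; clear; rewrite !natrM !mulrBl !mulrBr !mul1r !mulrA.
by rewrite [n%:R * l%:R]mulrC [n%:R * k%:R]mulrC; lra.
Qed.

Lemma ln2_le (R : realType) : ln 2 <= 7 / 10 :> R.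
Proof.
rewrite -ler_expR lnK ?posrE //.
have e : 71 / 70 <= expR (1 / 70) :> R.
  by apply: le_trans (expR_ge1Dx _); lra.
(* The 49th power of 71 / 70 exceeds 2; it is taken as two 7th powers with the simpler rational 53 /
   48 in between. *)
have -> : (7 / 10 : R) = 7%:R * (7%:R * (1 / 70)) by lra.
rewrite !expRM_natl.
have h7 : 53 / 48 <= (71 / 70) ^+ 7 :> R by rewrite !exprS expr0; lra.
have h2 : 2 <= (53 / 48) ^+ 7 :> R by rewrite !exprS expr0; lra.
apply: le_trans h2 _; rewrite lerXn2r ?nnegrE ?exprn_ge0 ?expR_ge0 //; first lra.
apply: le_trans h7 _; rewrite lerXn2r ?nnegrE ?expR_ge0 //; lra.
Qed.

(** L bounds ln M, and u, v are logarithmic heights. The ratios 15.8, 8.9 and 15 lie just below 2^4,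
    3^2 and 4^2, which [thueK n] gap steps provide up to a small loss. *)
Definition thue_range (R : realType) (n : nat) (L u v : R) : Prop :=
  [\/ [/\ n = 3, 11 / 2 <= L, 122 * L <= u & 158 / 10 * u <= v],
      [/\ n = 4, 6 <= L, 200 * L <= u & 89 / 10 * u <= v]
    | [/\ (4 < n)%N, 5 / 4 * n%:R <= L, 100 * L <= u & 15 * u <= v]].

(** N, K, W are n, k, w, and W is about 4 N K / 7. The value b solves the condition of [siegel_exp]
    with equality once W is replaced by its upper bound 4 N K / 7 + 1, 2 W - N K by its lower bound
    N K / 7, and ln 2 by 7 / 10. *)
Lemma siegel_exponent (R : realType) (N K W L : R) :
  3 <= N -> 1 <= K -> 0 <= L -> 7 * (W - 1) <= 4 * (N * K) -> 4 * (N * K) <= 7 * W ->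
  let b := L * (4 * K - 7 / 2 * K / N + 21 / 2 / N) + (4 * (N * K) + 28) * (7 / 10) in
  0 <= b /\ (W + 3) * (N * K) * ln 2 + L * (K * W - K * (K - 1) / 2) <= b * (2 * W - N * K).
Proof.
move=> N3 K1 L0 W1 W2 b.
have N0 : 0 < N by lra.
have l2 := ln2_le R; have l20 : 0 <= ln 2 :> R by rewrite ln_ge0 // ler1n.
have NK0 : 0 <= N * K by rewrite mulr_ge0; lra.
have KN : K / N <= K / 3 by rewrite ler_wpM2l ?lef_pV2 ?posrE //; lra.
have KN0 : 0 <= K / N by rewrite divr_ge0; lra.
have iN0 : 0 <= 1 / N by rewrite divr_ge0; lra.
have c0 : 0 <= 4 * K - 7 / 2 * K / N + 21 / 2 / N.
  have -> : 7 / 2 * K / N = 7 / 2 * (K / N) by rewrite mulrA.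
  have -> : 21 / 2 / N = 21 / 2 * (1 / N) by rewrite mul1r.
  lra.
have b0 : 0 <= b by rewrite /b addr_ge0 ?mulr_ge0 //; lra.
split => //.
apply: (@le_trans _ _ (b * (N * K / 7))); last by apply: ler_wpM2l => //; lra.
rewrite /b [leRHS]mulrDl [leLHS]addrC; apply: lerD.
  rewrite -[leRHS]mulrA; apply: ler_wpM2l => //.
  have -> : (4 * K - 7 / 2 * K / N + 21 / 2 / N) * (N * K / 7) =
     K * (4 * (N * K) / 7 + 1) - K * (K - 1) / 2 by field; lra.
  rewrite lerD2r; apply: ler_wpM2l; lra.
have -> : (4 * (N * K) + 28) * (7 / 10) * (N * K / 7) = (4 * (N * K) / 7 + 4) * (N * K) * (7 / 10).
  by field.
apply: ler_pM => //; first by apply: mulr_ge0 => //; lra.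
apply: ler_wpM2r => //; lra.
Qed.

(** Dominant terms: the first inequality compares K u / 1.13 + (4 / 7) N K u with N K u, the second
    (4 / 7) 1.13 N v with (N - 1) v. For N = 3 the latter reads about 1.94 < 2, which limits the
    factor 1.13. The terms in L and the constants are absorbed by the lower bounds for u / L and
    L. *)
Lemma thue_inequalities (R : realType) n (K W L u v : R) :
  thue_range n L u v -> 0 < u -> 10 <= K ->
  K * u <= 113 / 100 * v -> 113 / 100 * v < (K + 1) * u ->
  7 * (W - 1) <= 4 * (n%:R * K) -> 1 <= W ->
  let N : R := n%:R in
  let b := L * (4 * K - 7 / 2 * K / N + 21 / 2 / N) + (4 * (N * K) + 28) * (7 / 10) in
  v + (W + 1) * ln 4 + b + (W - 1) * u + (N - 1) * (u + W * ln 4 + 2 * b)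
    + K * (N - 2) * L < N * K * u /\
  (N - 2) * L + (W + 1) * ln 4 + b + (W - 1) * u < (N - 1) * v.
Proof.
move=> hr u0 K10 Kv vK W1 W0 N b.
have l4 : ln 4 <= 7 / 5 :> R.
  have -> : (4 : R) = 2 ^+ 2 by rewrite -natrX.
  by rewrite lnXn // mulr2n; have := ln2_le R; lra.
have l40 : 0 <= ln 4 :> R by rewrite ln_ge0 // ler1n.
have Wl : W * ln 4 <= (4 / 7 * (N * K) + 1) * (7 / 5).
  by apply: ler_pM => //; rewrite /N; lra.
have Wu : (W - 1) * u <= 4 / 7 * (N * K) * u by apply: ler_wpM2r; rewrite /N; lra.
case: hr => -[nE L1 Lu uv].
- have NE : N = 3 by rewrite /N nE.
  rewrite NE in Wl Wu *.
  have KL : K * (122 * L) <= K * u by apply: ler_wpM2l => //; lra.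
  have KL2 : K * (11 / 2) <= K * L by apply: ler_wpM2l => //; lra.
  have bE : b = 17 / 6 * (K * L) + 7 / 2 * L + (42 / 5 * K + 98 / 5) by rewrite /b NE; field.
  move: b bE => b -> {NE nE W1 N}.
  by split; lra.
- have NE : N = 4 by rewrite /N nE.
  rewrite NE in Wl Wu *.
  have KL : K * (200 * L) <= K * u by apply: ler_wpM2l => //; lra.
  have KL2 : K * 6 <= K * L by apply: ler_wpM2l => //; lra.
  have bE : b = 25 / 8 * (K * L) + 21 / 8 * L + (56 / 5 * K + 98 / 5) by rewrite /b NE; field.
  move: b bE => b -> {NE nE W1 N}.
  by split; lra.
have N5 : 5 <= N by rewrite /N ler_nat.
have K16 : 15 <= K.
  rewrite leNgt; apply/negP => Klt.
  have : (K + 1) * u <= 16 * u by apply: ler_wpM2r; lra.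
  by move=> ?; lra.
have NK : 5 * K <= N * K by apply: ler_wpM2r; lra.
have NK15 : N * 15 <= N * K by apply: ler_wpM2l; lra.
have NNK : (N * K) * (5 / 4 * N) <= (N * K) * L by apply: ler_wpM2l => //; rewrite ?mulr_ge0 //; lra.
have NKL : (N * K) * (100 * L) <= (N * K) * u by apply: ler_wpM2l => //; rewrite ?mulr_ge0 //; lra.
have L0 : 0 <= L by lra.
have KL0 : 0 <= K * L by apply: mulr_ge0; lra.
have KL1 : K * (5 / 4 * N) <= K * L by apply: ler_wpM2l => //; lra.
have KLu : K * (100 * L) <= K * u by apply: ler_wpM2l => //; lra.
have NLu : N * (100 * L) <= N * u by apply: ler_wpM2l => //; lra.
have NKu5 : 5 * (K * u) <= N * (K * u) by apply: ler_wpM2r; rewrite ?mulr_ge0 //; lra.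
have NKu15 : (N * u) * 15 <= (N * u) * K by apply: ler_wpM2l; rewrite ?mulr_ge0 //; lra.
have Ku15 : u * 15 <= u * K by apply: ler_wpM2l; lra.
have Nu5 : 5 * u <= N * u by apply: ler_wpM2r; lra.
have iN : 1 / N <= 1 / 5 by rewrite !mul1r lef_pV2 ?posrE //; lra.
have iN0 : 0 <= 1 / N by rewrite divr_ge0; lra.
have LN : L / N <= L / 5 by rewrite -[L / N]mulr1 -[leRHS]mulr1 -!mulrA; apply: ler_wpM2l => //; rewrite mulr1; lra.
have KLN0 : 0 <= K * L / N by apply: divr_ge0; lra.
have bE : b = 4 * (K * L) - 7 / 2 * (K * L / N) + 21 / 2 * (L / N) + (14 / 5 * (N * K) + 98 / 5).
  by rewrite /b; field; lra.
have NbE : N * b = 4 * (N * K * L) - 7 / 2 * (K * L) + 21 / 2 * L + (14 / 5 * (N * K * N) + 98 / 5 * N).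
  by rewrite /b; field; lra.
have b0 : 0 <= b.
  have : K * L / N <= K * L / 5 by rewrite -!mulrA; apply: ler_wpM2l; [lra|exact: LN].
  have : 0 <= L / N by apply: divr_ge0; lra.
  rewrite bE; lra.
have NWl : N * (W * ln 4) <= N * ((4 / 7 * (N * K) + 1) * (7 / 5)) by apply: ler_wpM2l; lra.
have bU : b <= 4 * (K * L) + 21 / 10 * L + 14 / 5 * (N * K) + 98 / 5 by rewrite bE; lra.
have NKv : N * (K * u) <= N * (113 / 100 * v) by apply: ler_wpM2l; lra.
move: b NbE b0 bU {bE} => b NbE b0 bU; clear iN iN0 LN KLN0.
clear NK NK15 W0 W1 K10 uv l40.
split.
  by clear bU NKv KL1; lra.
by clear NbE NWl NNK NKL; lra.
Qed.

Lemma thue_main (R : realType) n (f : {poly int}) (al : 'I_n -> R[i]) (i0 : 'I_n)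
    (L u v : R) (x1 y1 x2 y2 : int) :
  good_form f al -> nrm (al i0) <= 1 -> mahler f al <= expR L ->
  0 < y1 -> 0 < y2 -> coprimez x1 y1 -> `|x1| <= y1 ->
  y1%:~R = expR u -> y2%:~R = expR v ->
  nrm (al i0 - x1%:~R / y1%:~R) <= expR (n.-2%:R * L - n%:R * u) ->
  nrm (al i0 - x2%:~R / y2%:~R) <= expR (n.-2%:R * L - n%:R * v) ->
  thue_range n L u v -> False.
Proof.
move=> gf a1 ML y10 y20 cxy1 xy1 uE vE h1 h2 hr.
have [n2 L0 Lu uv] : [/\ (2 < n)%N, 1 <= L, 100 * L <= u & 89 / 10 * u <= v].
  case: hr => -[nE l1 l2 l3].
  - by split; [rewrite nE | lra | lra | lra].
  - by split; [rewrite nE | lra | lra | lra].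
  have n5 : 5 <= n%:R :> R by rewrite ler_nat.
  by split; [exact: ltn_trans nE | lra | lra | lra].
have u0 : 0 < u by lra.
(* The order of vanishing k ~ 1.13 v / u and the degree w ~ 4 n k / 7 are chosen to make
   [thue_inequalities] true. *)
pose k := Num.truncn (113 / 100 * v / u).
have x0 : 0 <= 113 / 100 * v / u by apply: divr_ge0; lra.
have /andP[kl ku] := truncn_itv x0; rewrite -/k in kl ku.
rewrite ler_pdivlMr // in kl; rewrite ltr_pdivrMr // -[k.+1%:R]natr1 in ku.
have k10 : (10 <= k)%N.
  by rewrite /k truncn_ge_nat // ler_pdivlMr //; lra.
pose w := ((4 * (n * k)) %/ 7).+1.
have w1 : (7 * w.-1 <= 4 * (n * k))%N by rewrite /w /= [(7 * _)%N]mulnC leq_trunc_div.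
have w2 : (4 * (n * k) < 7 * w)%N by rewrite /w [(7 * _)%N]mulnC ltn_ceil.
have nk : (30 <= n * k)%N by rewrite (leq_mul n2 k10).
have w1R : 7 * (w%:R - 1) <= 4 * (n%:R * k%:R) :> R.
  have -> : (w%:R - 1 : R) = w.-1%:R by rewrite /w -natr1 addrK.
  by rewrite -!natrM ler_nat.
have w2R : 4 * (n%:R * k%:R) <= 7 * w%:R :> R by rewrite -!natrM ler_nat ltnW.
have n3R : 3 <= n%:R :> R by rewrite ler_nat.
have k10R : 10 <= k%:R :> R by rewrite ler_nat.
have wR : 1 <= w%:R :> R by rewrite ler1n.
have k1R : 1 <= k%:R :> R by lra.
have Lp : 0 <= L by lra.
have [b0 Hb] := siegel_exponent n3R k1R Lp w1R w2R.
have [HI HII] := thue_inequalities hr u0 k10R kl ku w1R wR.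
set b := L * _ + _ in b0 Hb HI HII.
have kw : (k <= w)%N by move: w2 n2 k10; clear; nia.
have n2E : n.-2%:R = n%:R - 2 :> R by rewrite -subn2 natrB // ltnW.
have wS : w.+1%:R = w%:R + 1 :> R by rewrite natr1.
apply: (@thue_step _ _ _ _ _ k w L b u v x1 y1 x2 y2 n2 gf a1 Lp ML) => //.
- rewrite n2E; apply: (@le_trans _ _ (n%:R * L)); last by apply: ler_wpM2l; lra.
  by apply: ler_wpM2r => //; lra.
- by move: k10; clear; lia.
- by move: w1 nk; rewrite /w /=; clear; lia.
- by move: w2 nk; clear; lia.
- have -> : ((w + 3) * (n * k))%:R = (w%:R + 3) * (n%:R * k%:R) :> R by rewrite natrM natrD natrM.
  have -> : (2 * w - n * k)%:R = 2 * w%:R - n%:R * k%:R :> R.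
    by rewrite natrB ?natrM //; move: w2; clear; lia.
  have -> : (\sum_(j < k) (w - j))%:R = k%:R * w%:R - k%:R * (k%:R - 1) / 2 :> R.
    have : forall k', (k' <= w)%N ->
       (\sum_(j < k') (w - j))%:R = k'%:R * w%:R - k'%:R * (k'%:R - 1) / 2 :> R.
      elim=> [|k' IH] lk; first by rewrite big_ord0 !mul0r subr0.
      rewrite big_ord_recr /= natrD IH 1?ltnW // natrB 1?ltnW // -natr1; by field.
    exact.
  exact: Hb.
- by rewrite wS natrM n2E natrM.
- by rewrite wS n2E.
Qed.

(** * The Lewis-Mahler inequality *)

Definition linf (R : rcfType) n (al : 'I_n -> R[i]) i (x y : int) : R :=
  nrm (x%:~R - al i * y%:~R).

Definition rdisc (R : rcfType) n (f : {poly int}) (al : 'I_n -> R[i]) : R :=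
  `|lead_coef f|%:~R ^+ n.-1 * \prod_(i < n) \prod_(j < n | (i < j)%N) nrm (al j - al i).

Definition height (x y : int) : int := Num.max `|x| `|y|.

Definition gapc (R : rcfType) n : R := 2 ^+ n.-1 * Num.sqrt (n.-1%:R ^+ n.-1).

Lemma prod_lift (A : comNzRingType) n (i : 'I_n.+1) (F : 'I_n.+1 -> A) :
  \prod_(j < n.+1 | j != i) F j = \prod_(j < n) F (lift i j).
Proof.
rewrite big_mkcond (bigD1_ord i) //= eqxx mul1r; apply: eq_bigr => j _.
by rewrite eq_sym neq_lift.
Qed.

Lemma rdisc_ge1 (R : realType) n (f : {poly int}) (al : 'I_n -> R[i]) :
  splits_as f al -> 1 <= rdisc f al.
Proof.
move=> fs; have [z zE] := disc_int fs; have [sf ai _] := fs.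
have a0 : 0 < `|lead_coef f|%:~R :> R.
  by rewrite ltr0z normr_gt0 lead_coef_eq0 -size_poly_eq0 sf.
have d0 : 0 < rdisc f al.
  rewrite mulr_gt0 ?exprn_gt0 // prodr_gt0 // => i _; rewrite prodr_gt0 // => j ij.
  rewrite nrm_gt0 subr_eq0; apply: contraTneq ij => /ai->; by rewrite ltnn.
have dE : rdisc f al ^+ 2 = `|z|%:~R.
  rewrite -nrm_int -zE nrmM !nrmX nrm_int exprMn -exprM; congr (_ * _ ^+ 2).
  rewrite nrm_prod; apply: eq_bigr => i _; rewrite nrm_prod.
  by apply: eq_bigr => j _.
have z0 : 1 <= `|z|.
  rewrite -gtz0_ge1 -(ltr0z R) -dE exprn_gt0 //.
have : 1 <= rdisc f al ^+ 2 by rewrite dE -[1]/(1%:~R) ler_int.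
by rewrite -{1}(expr1n R 2) ler_pXn2r ?nnegrE // ltW.
Qed.

(** The differences involving al_i are set apart; the others form the Vandermonde determinant of the
    remaining n - 1 roots, to which [vandermonde_le] applies. *)
Lemma rdisc_root_le (R : rcfType) n (f : {poly int}) (al : 'I_n -> R[i]) i :
  (1 < n)%N ->
  rdisc f al <= `|lead_coef f|%:~R * \prod_(j < n | j != i) nrm (al i - al j) *
    Num.sqrt (n.-1%:R ^+ n.-1) * mahler f al ^+ n.-2.
Proof.
case: n al i => // -[//|n] al i _ /=.
set a : R := `|lead_coef f|%:~R; have a0 : 0 <= a by rewrite ler0z.
pose P := \prod_(j < n.+2 | j != i) nrm (al i - al j).
pose V := \prod_(k < n.+1) \prod_(l < n.+1 | (k < l)%N) nrm (al (lift i l) - al (lift i k)).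
have P0 : 0 <= P by rewrite prodr_ge0 // => j _; exact: nrm_ge0.
have V0 : 0 <= V by rewrite prodr_ge0 // => k _; rewrite prodr_ge0 // => l _; exact: nrm_ge0.
have split2 : (\prod_(k < n.+2) \prod_(l < n.+2 | (k < l)%N) nrm (al l - al k)) ^+ 2 = (P * V) ^+ 2.
  have sym (N : nat) (be : 'I_N -> R[i]) k l : nrm (be l - be k) = nrm (be k - be l) by rewrite -nrmN opprB.
  rewrite -(@prod_pair_sym _ _ (fun k l => nrm (al l - al k))); last exact: sym.
  rewrite exprMn /V -(@prod_pair_sym _ _ (fun k l => nrm (al (lift i l) - al (lift i k)))); last first.
    by move=> k l; rewrite -nrmN opprB.
  rewrite (bigD1 i) //= expr2 -mulrA; congr (_ * _).
    by apply: eq_bigr => j _; rewrite sym.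
  rewrite {1}/P !prod_lift -big_split /=; apply: eq_bigr => k _.
  rewrite (bigD1 i) /=; last by rewrite neq_lift.
  congr (_ * _).
  rewrite [RHS]big_mkcond /=.
  transitivity (\prod_(l < n.+2 | l != i) (if l != lift i k then nrm (al l - al (lift i k)) else 1)).
    by rewrite big_mkcond [RHS]big_mkcond /=; apply: eq_bigr => l _; case: eqP; case: eqP.
  rewrite prod_lift; apply: eq_bigr => l _.
  by rewrite (inj_eq (@fintype.lift_inj _ i)).
have -> : rdisc f al = a ^+ n.+1 * (P * V).
  rewrite /rdisc /= -/a; congr (_ * _).
  apply/eqP; rewrite -(@eqrXn2 _ 2) ?split2 ?mulr_ge0 //.
  by rewrite prodr_ge0 // => k _; rewrite prodr_ge0 // => l _; exact: nrm_ge0.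
have Vle : V <= Num.sqrt (n.+1%:R ^+ n.+1) * (\prod_(j < n.+2) house al j) ^+ n.
  have h := vandermonde_le (fun k => al (lift i k)).
  have hp : \prod_(k < n.+1) house al (lift i k) <= \prod_(j < n.+2) house al j.
    rewrite (bigD1_ord i) //= ler_peMl ?house_ge1 //.
    by rewrite prodr_ge0 // => j _; rewrite ltW // house_gt0.
  have p0 : 0 <= \prod_(k < n.+1) house al (lift i k).
    by rewrite prodr_ge0 // => j _; rewrite ltW // house_gt0.
  apply: (@le_trans _ _ (Num.sqrt (n.+1%:R ^+ n.+1) * (\prod_(k < n.+1) house al (lift i k)) ^+ n)).
    have q0 : 0 <= Num.sqrt (n.+1%:R ^+ n.+1) * (\prod_(k < n.+1) house al (lift i k)) ^+ n.
      by rewrite mulr_ge0 ?sqrtr_ge0 ?exprn_ge0.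
    rewrite -(@ler_pXn2r _ 2) ?nnegrE // exprMn sqr_sqrtr ?exprn_ge0 ?ler0n //.
    by rewrite -exprM.
  by rewrite ler_wpM2l ?sqrtr_ge0 // lerXn2r ?nnegrE ?(le_trans p0 hp).
rewrite exprS /mahler exprMn -/a -/P.
have -> : a * P * Num.sqrt (n.+1%:R ^+ n.+1) * (a ^+ n * (\prod_i0 house al i0) ^+ n) =
  (a * a ^+ n * P) * (Num.sqrt (n.+1%:R ^+ n.+1) * (\prod_(j < n.+2) house al j) ^+ n) by ring.
by rewrite mulrA ler_wpM2l // !mulr_ge0 ?exprn_ge0.
Qed.

Section Nearest.
Variables (R : realType) (n : nat) (f : {poly int}) (al : 'I_n -> R[i]).
Hypotheses (n2 : (2 < n)%N) (gf : good_form f al).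

(** Comparing |x - al_i y| / max(1, |al_i|) makes the notion symmetric under the exchange of x and
    y, as [swap_class] requires. *)
Definition nearest i (x y : int) :=
  forall j, linf al i x y * house al j <= linf al j x y * house al i.

Lemma exists_nearest x y : exists i, nearest i x y.
Proof.
have i0 : 'I_n by exact: Ordinal (ltn_trans (isT : (0 < 2)%N) n2).
have [i _ imin] := arg_minP (fun i => linf al i x y / house al i) (P := xpredT) (i0 := i0) isT.
exists i => j; have := imin j isT.
by rewrite ler_pdivrMr ?house_gt0 // mulrAC ler_pdivlMr ?house_gt0.
Qed.

(** As al_i is nearest, H |al_i - al_j| <= 2 |x - al_j y| for the other roots. Inserted in
    [rdisc_root_le], this turns the product of the root differences into |F(x, y)| / |x - al_i y|,
    up to powers of 2 and H. *)
Lemma lewis_mahler i x y : nrm (al i) <= 1 -> nearest i x y ->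
  rdisc f al * (height x y)%:~R ^+ n.-1 * linf al i x y <=
  gapc R n * `|hom n f x y|%:~R * mahler f al ^+ n.-2.
Proof.
move=> a1 nr.
have hi : house al i = 1 by rewrite /house; apply/max_idPl.
have l0 j : 0 <= linf al j x y by exact: nrm_ge0.
have nr' j : linf al i x y * house al j <= linf al j x y.
  by have := nr j; rewrite hi mulr1.
have nr1 j : linf al i x y <= linf al j x y.
  by apply: le_trans (nr' j); rewrite ler_peMr // house_ge1.
have hle j : (height x y)%:~R * nrm (al i - al j) <= 2 * linf al j x y.
  rewrite /height; have [_|_] := leP `|x| `|y|.
    rewrite -(nrm_int R y) -nrmM.
    have -> : y%:~R * (al i - al j) = (x%:~R - al j * y%:~R) - (x%:~R - al i * y%:~R) :> R[i] by ring.
    apply: le_trans (nrmB _ _) _; rewrite -/(linf al j x y) -/(linf al i x y).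
    have := nr1 j; lra.
  rewrite -(nrm_int R x) -nrmM.
  have -> : x%:~R * (al i - al j) = al i * (x%:~R - al j * y%:~R) - al j * (x%:~R - al i * y%:~R) :> R[i] by ring.
  apply: le_trans (nrmB _ _) _; rewrite !nrmM -/(linf al j x y) -/(linf al i x y).
  have h1 : nrm (al i) * linf al j x y <= linf al j x y by rewrite ler_piMl.
  have h2 : nrm (al j) * linf al i x y <= linf al j x y.
    apply: le_trans (nr' j); rewrite mulrC ler_wpM2l //; exact: nrm_le_house.
  lra.
have H0 : 0 <= (height x y)%:~R :> R by rewrite ler0z le_max normr_ge0.
have prodle : (height x y)%:~R ^+ n.-1 * \prod_(j < n | j != i) nrm (al i - al j) <=
   2 ^+ n.-1 * \prod_(j < n | j != i) linf al j x y.
  have cardE (c : R) : c ^+ n.-1 = \prod_(j < n | j != i) c.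
    by rewrite prodr_const cardC1 card_ord.
  rewrite !cardE -!big_split /=; apply: ler_prod => j _.
  by rewrite hle mulr_ge0 ?nrm_ge0.
have homE : `|hom n f x y|%:~R = `|lead_coef f|%:~R * (linf al i x y *
    \prod_(j < n | j != i) linf al j x y) :> R.
  rewrite -nrm_int (hom_splits x y gf.1) nrmM nrm_int nrm_prod (bigD1 i) //=.
have aD : 0 <= `|lead_coef f|%:~R :> R by rewrite ler0z.
have := rdisc_root_le f al i (ltnW n2).
set A := _%:~R in aD homE *; set Pd := \prod_(j < n | j != i) nrm _ in prodle *.
set S := Num.sqrt _; set Mp := mahler f al ^+ _ => dle.
have S0 : 0 <= S by exact: sqrtr_ge0.
have M0 : 0 <= Mp.
  by rewrite exprn_ge0 // mulr_ge0 ?ler0z // prodr_ge0 // => j _; rewrite ltW // house_gt0.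
rewrite homE /gapc -/S.
apply: (@le_trans _ _ ((A * Pd * S * Mp) * (height x y)%:~R ^+ n.-1 * linf al i x y)).
  by rewrite !ler_wpM2r ?exprn_ge0.
have -> : A * Pd * S * Mp * (height x y)%:~R ^+ n.-1 * linf al i x y =
  (A * S * Mp * linf al i x y) * ((height x y)%:~R ^+ n.-1 * Pd) by ring.
have -> : 2 ^+ n.-1 * S * (A * (linf al i x y * \prod_(j < n | j != i) linf al j x y)) * Mp =
  (A * S * Mp * linf al i x y) * (2 ^+ n.-1 * \prod_(j < n | j != i) linf al j x y) by ring.
by rewrite ler_wpM2l // !mulr_ge0.
Qed.

End Nearest.

(** * Solutions with small denominator *)

Lemma weak_factor_small (R : realFieldType) (a e : R) :
  0 <= a -> e <= 1 / 2 -> Num.max 1 (1 / 2 + e + a) <= 3 * Num.max 1 (a / 2).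
Proof.
move=> a0 e0; rewrite ge_max; have := le_max (a / 2) 1 (a / 2); rewrite lexx orbT.
have := le_max 1 1 (a / 2); rewrite lexx /= => h1 h2.
by apply/andP; split; lra.
Qed.

(** Meant for the case in which every a is at least 1/2. The bound carries an extra factor a^(1/4),
    and the product of the a over all roots is at most 1 by [prod_rat_dist]; the fourth power avoids
    roots. *)
Lemma weak_factor_large (R : realFieldType) (a e : R) :
  1 / 2 <= a -> 0 <= e -> e <= 1 ->
  Num.max 1 (1 / 2 + e + a) ^+ 4 <= (3 * Num.max 1 (a / 2)) ^+ 4 * a.
Proof.
move=> a0 e0 e1.
apply: (@le_trans _ _ ((a + 3 / 2) ^+ 4)).
  rewrite lerXn2r ?nnegrE ?le_max ?ler01 //; first by lra.
  by rewrite ge_max; apply/andP; split; lra.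
have [a2|a2] := leP a 2.
  have -> : Num.max 1 (a / 2) = 1 by apply/max_idPl; lra.
  have h : 0 <= (a - 1 / 2) * (2 - a) by apply: mulr_ge0; lra.
  have b1 : (a + 3 / 2) ^+ 2 <= 11 / 2 * a + 5 / 4 by rewrite expr2; lra.
  have b0 : 0 <= (a + 3 / 2) ^+ 2 by exact: sqr_ge0.
  have -> : (a + 3 / 2) ^+ 4 = ((a + 3 / 2) ^+ 2) * ((a + 3 / 2) ^+ 2) by ring.
  apply: (@le_trans _ _ ((11 / 2 * a + 5 / 4) * (11 / 2 * a + 5 / 4))).
    by apply: ler_pM.
  have -> : (3 * 1) ^+ 4 * a = 81 * a :> R by ring.
  lra.
have -> : Num.max 1 (a / 2) = a / 2 by apply/max_idPr; lra.
apply: (@le_trans _ _ ((7 / 4 * a) ^+ 4)).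
  by rewrite lerXn2r ?nnegrE //; lra.
have -> : (3 * (a / 2)) ^+ 4 * a = (a ^+ 4) * (81 / 16 * a) by field.
have -> : (7 / 4 * a) ^+ 4 = a ^+ 4 * (2401 / 256) by field.
by apply: ler_wpM2l; [apply: exprn_ge0; lra | lra].
Qed.

(** A reciprocal, large when x / y approximates al_i well. When (x, y) is moved to (1, 0) it becomes
    the modulus of the i-th new root, up to a translation common to all roots. *)
Definition rat_dist (R : realType) n (al : 'I_n -> R[i]) i (p : int * int) : R :=
  (p.2%:~R * linf al i p.1 p.2)^-1.

Definition equiv_mahler (R : realType) n (f : {poly int}) (al : 'I_n -> R[i])
    (p q r s : int) : R :=
  `|lead_coef f|%:~R * \prod_i Num.max (linf al i p r) (linf al i q s).

(* The infimum over the equivalent forms with the same absolute leading coefficient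
   need not be attained, hence the factor 11 / 10. *)
Definition nearly_reduced (R : realType) n (f : {poly int}) (al : 'I_n -> R[i]) : Prop :=
  forall p q r s : int, p * s - q * r = 1 -> `|hom n f p r| = `|lead_coef f| ->
    mahler f al <= 11 / 10 * equiv_mahler f al p q r s.

Definition primsol n (f : {poly int}) (m : int) (p : int * int) : Prop :=
  coprimez p.1 p.2 /\ `|hom n f p.1 p.2| = m.

Section Weak.
Variables (R : realType) (n : nat) (f : {poly int}) (al : 'I_n -> R[i]).
Hypotheses (n2 : (2 < n)%N) (gf : good_form f al) (rf : nearly_reduced f al).

Let m : int := `|lead_coef f|.

Lemma linf_gt0 i x y : (x != 0) || (y != 0) -> 0 < linf al i x y.
Proof. by move=> xy; rewrite nrm_gt0; apply: (good_irrational (ltnW n2) gf). Qed.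

Lemma lead_gt0 : 0 < m%:~R :> R.
Proof.
have [[sf _ _] _] := gf.
by rewrite ltr0z /m normr_gt0 lead_coef_eq0 -size_poly_eq0 sf.
Qed.

Lemma rat_dist_gt0 i p : 0 < p.2 -> 0 < rat_dist al i p.
Proof.
move=> y0; rewrite invr_gt0 mulr_gt0 ?ltr0z // linf_gt0 //.
by rewrite [p.2 == 0]gt_eqF ?orbT.
Qed.

Lemma prod_rat_dist p : 0 < p.2 -> primsol n f m p -> \prod_i rat_dist al i p <= 1.
Proof.
move=> y0 [_ hm].
have := congr1 (fun z : int => z%:~R : R) hm.
rewrite /= -nrm_int (hom_splits _ _ gf.1) nrmM nrm_int nrm_prod => E.
have E1 : \prod_i linf al i p.1 p.2 = 1.
  by apply: (mulfI (lt0r_neq0 lead_gt0)); rewrite mulr1.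
rewrite prodfV big_split /= E1 mulr1 prodr_const card_ord.
rewrite invf_le1 ?exprn_gt0 ?ltr0z // exprn_ege1 //.
by rewrite -[1]/(1%:~R) ler_int -gtz0_ge1.
Qed.

(** The column completing (x, y) to a unimodular matrix is free up to multiples k of (x, y). The
    translation v / y + k common to the new roots can thus be brought within 1/2 of the real part of
    [w j], so each new root has modulus at most 1/2 + |w_j| + |w_i|; near minimality of M is applied
    to this form. *)
Lemma weak_shift p j : 0 < p.2 -> primsol n f m p ->
  mahler f al <= 11 / 10 * (m%:~R *
    \prod_i Num.max 1 (1 / 2 + rat_dist al j p + rat_dist al i p)).
Proof.
case: p => x y /= y0 [/= cxy hm].
have [[u v] /= uv] : exists uv : int * int, x * uv.2 - uv.1 * y = 1.
  have [u [v e]] := Bezoutz x y; exists (- v, u) => /=.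
  by rewrite mulNr opprK (mulrC x) e (eqP cxy).
pose Lx i : R[i] := x%:~R - al i * y%:~R.
have Lx0 i : Lx i != 0 by rewrite -nrm_gt0 linf_gt0 // [y == 0]gt_eqF ?orbT.
have yC : y%:~R != 0 :> R[i] by rewrite intr_eq0 gt_eqF.
pose w i : R[i] := (y%:~R * Lx i)^-1.
have wE i : nrm (w i) = rat_dist al i (x, y).
  by rewrite nrmV nrmM nrm_int gtr0_norm.
pose rho : R := v%:~R / y%:~R - complex.Re (w j).
pose k := - Num.floor (rho + 1 / 2).
have hk : `|rho + k%:~R| <= 1 / 2.
  have /andP[h1 h2] := floor_itv (rho + 1 / 2); rewrite rmorphD /= in h2.
  rewrite /k rmorphN /= ler_norml; apply/andP; split; lra.
have := rf (p := x) (q := u + k * x) (r := y) (s := v + k * y) _ hm.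
move=> /(_ _)/le_trans; apply.
  rewrite -uv; ring.
rewrite ler_pM2l ?divr_gt0 // /equiv_mahler.
have be i : linf al i (u + k * x) (v + k * y) =
    linf al i x y * nrm (v%:~R / y%:~R - w i + k%:~R).
  rewrite /linf -nrmM; congr nrm; rewrite /w -/(Lx i) !rmorphD !rmorphM /=.
  have e1 : x%:~R * v%:~R - u%:~R * y%:~R = 1 :> R[i] by rewrite -!rmorphM -rmorphB /= uv.
  have e2 : u%:~R = (x%:~R * v%:~R - 1) / y%:~R :> R[i].
    by apply: (mulIf yC); rewrite divfK // -[X in _ - X]e1; ring.
  rewrite e2; have := Lx0 i; rewrite /Lx => L0; field.
  by rewrite L0 yC.
have hb i : nrm (v%:~R / y%:~R - w i + k%:~R) <=
    1 / 2 + rat_dist al j (x, y) + rat_dist al i (x, y).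
  have -> : v%:~R / y%:~R - w i + k%:~R =
     ((rho + k%:~R)%:C)%C + ((complex.Re (w j))%:C)%C - w i.
    have -> : ((rho + k%:~R)%:C)%C = v%:~R / y%:~R - ((complex.Re (w j))%:C)%C + k%:~R.
      rewrite /rho rmorphD rmorphB /= fmorph_div /= !(rmorph_int (real_complex R)).
      by [].
    by ring.
  apply: le_trans (nrmB _ _) _; rewrite wE lerD2r.
  apply: le_trans (nrmD _ _) _.
  have nC (t : R) : nrm ((t%:C)%C) = `|t|.
    by apply: (@complexI R); rewrite -nrmE normc_def /= expr0n addr0 sqrtr_sqr.
  by rewrite !nC lerD // -wE normRe_nrm.
have -> : \prod_i Num.max (linf al i x y) (linf al i (u + k * x) (v + k * y)) =
   (\prod_i linf al i x y) * \prod_i Num.max 1 (nrm (v%:~R / y%:~R - w i + k%:~R)).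
  rewrite -big_split /=; apply: eq_bigr => i _; rewrite be -{1}[linf al i x y]mulr1.
  by rewrite maxr_pMr // nrm_ge0.
have := congr1 (fun z : int => z%:~R : R) hm.
rewrite /= -nrm_int (hom_splits _ _ gf.1) nrmM nrm_int nrm_prod => E.
rewrite mulrA E ler_pM2l ?lead_gt0 //; apply: ler_prod => i _.
by rewrite le_max ler01 /= ge_max !le_max lexx /= hb orbT.
Qed.

(** The shift uses the index j of the least [rat_dist]. If that value is at most 1/2, the estimate
    holds factor by factor; otherwise only for the product, all values being above 1/2. *)
Lemma weak_product p : 0 < p.2 -> primsol n f m p ->
  mahler f al <= 11 / 10 * m%:~R * 3 ^+ n * \prod_i Num.max 1 (rat_dist al i p / 2).
Proof.
move=> y0 hp.
have i0 : 'I_n by exact: Ordinal (ltn_trans (isT : (0 < 2)%N) n2).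
have [j _ jmin] := arg_minP (fun i => rat_dist al i p) (P := xpredT) (i0 := i0) isT.
have d0 i := rat_dist_gt0 i y0.
apply: le_trans (weak_shift j y0 hp) _.
rewrite -!mulrA !ler_pM2l ?lead_gt0 ?invr_gt0 //.
set e := rat_dist al j p.
have -> : 3 ^+ n * \prod_i Num.max 1 (rat_dist al i p / 2) =
   \prod_i (3 * Num.max 1 (rat_dist al i p / 2)) by rewrite big_split /= prodr_const card_ord.
have mx0 i : 0 <= Num.max 1 (1 / 2 + e + rat_dist al i p) by rewrite le_max ler01.
have my0 i : 0 <= 3 * Num.max 1 (rat_dist al i p / 2) by rewrite mulr_ge0 ?le_max ?ler01.
have [e2|e2] := leP e (1 / 2).
  apply: ler_prod => i _; rewrite mx0 /=; apply: weak_factor_small => //; exact: ltW.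
have p1 := prod_rat_dist y0 hp.
have e1 : e <= 1.
  rewrite leNgt; apply/negP => e1; move: p1; rewrite leNgt => /negP; apply.
  apply: lt_le_trans (_ : e ^+ n <= _); first by rewrite exprn_egt1 // -lt0n (ltn_trans _ n2).
  rewrite -[X in e ^+ X](card_ord n) -prodr_const; apply: ler_prod => i _.
  by rewrite (ltW (d0 j)) jmin.
rewrite -(@ler_pXn2r _ 4) ?nnegrE ?prodr_ge0 //.
rewrite -!prodrXl; apply: (@le_trans _ _ (\prod_i ((3 * Num.max 1 (rat_dist al i p / 2)) ^+ 4 * rat_dist al i p))).
  apply: ler_prod => i _; rewrite exprn_ge0 //=; apply: weak_factor_large => //.
    exact: le_trans (ltW e2) (jmin i isT).
  exact: ltW (d0 j).
rewrite big_split /= ler_piMr // prodr_ge0 // => i _; exact: exprn_ge0.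
Qed.

Definition nonprop (p q : int * int) : bool := p.1 * q.2 - q.1 * p.2 != 0.

(** The determinant of p and q is at least 1 and at most y' |x - al y| + y |x' - al y'|, whose
    second term is at most 1/2. *)
Lemma weak_gap i p q : 0 < p.2 -> p.2 <= q.2 -> nonprop p q ->
  2 <= rat_dist al i p -> 2 <= rat_dist al i q ->
  p.2%:~R * (rat_dist al i p / 2) <= q.2%:~R :> R.
Proof.
case: p q => x y [x' y'] /= y0 yy' np a1 a2.
have y'0 : 0 < y' by exact: lt_le_trans yy'.
have yR : 0 < y%:~R :> R by rewrite ltr0z.
have y'R : 0 < y'%:~R :> R by rewrite ltr0z.
have l0 : 0 < linf al i x y by rewrite linf_gt0 // [y == 0]gt_eqF ?orbT.
have l'0 : 0 < linf al i x' y' by rewrite linf_gt0 // [y' == 0]gt_eqF ?orbT.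
have h : 1 <= y'%:~R * linf al i x y + y%:~R * linf al i x' y'.
  have : 1 <= nrm ((x * y' - x' * y)%:~R : R[i]).
    by rewrite nrm_int -[1]/(1%:~R) ler_int -gtz0_ge1 normr_gt0.
  move=> /le_trans; apply.
  have -> : (x * y' - x' * y)%:~R = y'%:~R * (x%:~R - al i * y%:~R) -
     y%:~R * (x'%:~R - al i * y'%:~R) :> R[i] by rewrite rmorphB !rmorphM /=; ring.
  by apply: le_trans (nrmB _ _) _; rewrite !nrmM !nrm_int !gtr0_norm.
have h2 : y'%:~R * linf al i x' y' <= 1 / 2.
  have P0 : 0 < y'%:~R * linf al i x' y' by rewrite mulr_gt0.
  have : 2 * (y'%:~R * linf al i x' y') <= 1 by rewrite -ler_pdivlMr // div1r.
  by lra.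
have h3 : y%:~R * linf al i x' y' <= 1 / 2.
  apply: le_trans h2; rewrite ler_wpM2r ?(ltW l'0) // ler_int //.
have -> : y%:~R * (rat_dist al i (x, y) / 2) = (2 * linf al i x y)^-1.
  rewrite /rat_dist /=; field; by rewrite !gt_eqF.
rewrite -div1r ler_pdivrMr ?mulr_gt0 //; lra.
Qed.

End Weak.

Lemma ln_prod (R : realType) (I : finType) (F : I -> R) :
  (forall i, 0 < F i) -> ln (\prod_i F i) = \sum_i ln (F i).
Proof.
move=> F0.
suff [] : ln (\prod_i F i) = \sum_i ln (F i) /\ 0 < \prod_i F i by [].
elim/big_rec2: _ => [|i a b _ [<- b0]]; first by rewrite ln1.
by rewrite lnM ?posrE // mulr_gt0.
Qed.

Lemma sum_ln_telescope (R : realType) (T : eqType) (yv g : T -> R) (x : T) (s : seq T) :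
  {in x :: s, forall p, 0 < yv p} -> (forall p, 0 < g p) -> uniq (x :: s) ->
  path (fun p q => yv p <= yv q) x s ->
  {in x :: s &, forall p q, p != q -> yv p <= yv q -> yv p * g p <= yv q} ->
  \sum_(p <- belast x s) ln (g p) <= ln (yv (last x s)) - ln (yv x).
Proof.
move=> + g0; elim: s x => [|z s IH] x y0 us ps gap; first by rewrite big_nil subrr.
move: us ps; rewrite cons_uniq [path _ _ _]/= => /andP[xs us] /andP[xz ps].
have sub p : p \in z :: s -> p \in [:: x, z & s] by move=> h; rewrite inE h orbT.
have := IH z (fun p hp => y0 p (sub p hp)) us ps (fun p q hp hq => gap p q (sub p hp) (sub q hq)).
rewrite /= big_cons => h2.
have zs : z \in z :: s by rewrite mem_head.
have xz' : x != z by apply: contraNneq xs => ->.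
have x1 : x \in [:: x, z & s] by rewrite mem_head.
have : ln (yv x) + ln (g x) <= ln (yv z).
  have yx := y0 x x1; have yz := y0 z (sub _ zs).
  rewrite -lnM ?posrE // ler_ln ?posrE ?mulr_gt0 //.
  exact: gap (sub _ zs) _ _.
by move: h2; clear; lra.
Qed.

(** The factors g > 1, ordered by [yv], telescope, each being at most a quotient of successive
    values. The last point has no successor: it is the exempted z. *)
Lemma class_sum_ln (R : realType) (T : eqType) (yv g : T -> R) (Y : R) (s : seq T) (x0 : T) :
  (forall p, 1 <= g p) ->
  (forall p, p \in s -> 1 <= yv p <= Y) -> uniq s -> 1 <= Y ->
  (forall p q, p \in s -> q \in s -> p != q -> yv p <= yv q -> 1 < g p -> 1 < g q ->
     yv p * g p <= yv q) ->
  exists z, \sum_(p <- s | p != z) ln (g p) <= ln Y.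
Proof.
move=> g1 hy us Y1 gap.
have g0 p : 0 < g p by exact: lt_le_trans (g1 p).
pose r p q := yv p <= yv q.
pose t := sort r [seq p <- s | 1 < g p].
have tt : uniq t by rewrite sort_uniq filter_uniq.
have mt p : (p \in t) = (1 < g p) && (p \in s) by rewrite mem_sort mem_filter.
have st : sorted r t by apply: sort_sorted => p q; exact: le_total.
have sumE z : \sum_(p <- s | p != z) ln (g p) = \sum_(p <- t | p != z) ln (g p).
  rewrite [RHS](perm_big [seq p <- s | 1 < g p]) /=; last by rewrite perm_sort.
  rewrite big_filter_cond [LHS](bigID (fun p => 1 < g p)) /=.
  rewrite [X in _ + X]big1 ?addr0 ; first by apply: eq_bigl => p; rewrite andbC.
  move=> p /andP[_]; rewrite -leNgt => gp.
  have -> : g p = 1 by apply/eqP; rewrite eq_le gp g1.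
  exact: ln1.
case: t tt mt st sumE => [|x s'] tt mt st sumE.
  by exists x0; rewrite sumE big_nil ln_ge0.
exists (last x s').
have hin p : p \in x :: s' -> (1 < g p) && (p \in s) by rewrite -mt.
rewrite sumE lastI -cats1 big_cat /= big_cons big_nil eqxx /= addr0.
have ub : uniq (rcons (belast x s') (last x s')) by rewrite -lastI.
rewrite big_seq_cond (eq_bigl (fun p => p \in belast x s')) -?big_seq; last first.
  move=> p /=; case pb: (p \in _) => //=; apply: contraTneq pb => ->.
  by move: ub; rewrite rcons_uniq => /andP[].
apply: le_trans (@sum_ln_telescope _ _ yv g x s' _ g0 _ _ _) _.
- by move=> p /hin/andP[_ /hy/andP[h _]]; exact: lt_le_trans h.
- exact: tt.
- exact: st.
- by move=> p q /hin/andP[gp ps] /hin/andP[gq qs] pq le; exact: gap.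
have /hin/andP[_ /hy/andP[l1 l2]] : last x s' \in x :: s' by exact: mem_last.
have /hin/andP[_ /hy/andP[x1 _]] : x \in x :: s' by exact: mem_head.
have := ln_ge0 x1.
have : ln (yv (last x s')) <= ln Y by rewrite ler_ln ?posrE // (lt_le_trans ltr01).
lra.
Qed.

(** At most n points are exempted, one for each root. For any other point the logarithms of its n
    factors add up to at least G by [weak_product], while for each root they add up to at most ln
    Y. *)
Lemma weak_count (R : realType) n (f : {poly int}) (al : 'I_n -> R[i]) (Y : R)
    (s : seq (int * int)) (G := ln (mahler f al) - ln (11 / 10 * `|lead_coef f|%:~R * 3 ^+ n)) :
  (2 < n)%N -> good_form f al -> nearly_reduced f al -> 0 <= G -> 1 <= Y -> uniq s ->
  (forall p, p \in s -> [/\ primsol n f `|lead_coef f| p, 0 < p.2 & p.2%:~R <= Y]) ->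
  {in s &, forall p q, p != q -> nonprop p q} ->
  (size s)%:R * G <= n%:R * (ln Y + G).
Proof.
move=> n2 gf rf G0 Y1 us hs np.
pose g i p := Num.max 1 (rat_dist al i p / 2).
have g1 i p : 1 <= g i p by rewrite /g le_max lexx.
have g0 i p : 0 <= ln (g i p) by exact: ln_ge0.
have /fin_all_exists[z hz] i : exists z, \sum_(p <- s | p != z) ln (g i p) <= ln Y.
  apply: (@class_sum_ln _ _ (fun p => p.2%:~R) (g i) Y s (0, 0)) => //.
    by move=> p /hs[_ y0 ->]; rewrite -[1]/(1%:~R) ler_int -gtz0_ge1 y0.
  move=> p q ps qs pq le.
  have [_ yp _] := hs p ps; have [_ yq _] := hs q qs.
  have gE r : 1 < g i r -> g i r = rat_dist al i r / 2 /\ 2 <= rat_dist al i r.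
    rewrite /g lt_max ltxx /= => h; split; first by apply/max_idPr/ltW.
    by move: h; clear; lra.
  move=> /gE[-> h1] /gE[_ h2]; apply: (weak_gap n2 gf) => //.
    by move: le; rewrite ler_int.
  exact: np.
have key p : p \in s -> G <= \sum_i ln (g i p).
  case/hs => pp y0 _; rewrite /G lerBlDr addrC.
  have P0 : 0 < \prod_i g i p by apply: prodr_gt0 => i _; exact: lt_le_trans (g1 i p).
  have c0 : 0 < 11 / 10 * `|lead_coef f|%:~R * 3 ^+ n :> R.
    by have l0 := lead_gt0 gf; rewrite !mulr_gt0 ?exprn_gt0 ?invr_gt0.
  have M0 : 0 < mahler f al.
    by rewrite mulr_gt0 ?(lead_gt0 gf) // prodr_gt0 // => i _; exact: house_gt0.
  rewrite -ln_prod => [|i]; last exact: lt_le_trans (g1 i p).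
  rewrite -lnM ?posrE // ler_ln ?posrE ?(mulr_gt0 c0 P0) //.
  exact: weak_product.
pose t := [seq p <- s | p \notin codom z].
have tle : (size s <= size t + n)%N.
  rewrite -(count_predC (fun p => p \notin codom z) s) size_filter leq_add2l.
  rewrite -size_filter -[X in (_ <= X)%N](card_ord n) -(size_codom z).
  apply: uniq_leq_size; first exact: filter_uniq.
  by move=> p; rewrite mem_filter /= negbK => /andP[].
apply: (@le_trans _ _ ((size t)%:R * G + n%:R * G)).
  by rewrite -mulrDl -natrD ler_wpM2r // ler_nat.
rewrite [leRHS]mulrDr lerD2r.
apply: (@le_trans _ _ (\sum_(p <- t) \sum_i ln (g i p))).
  rewrite (_ : _ * G = \sum_(p <- t) G); last by rewrite big_const_seq count_predT iter_addr_0 mulr_natl.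
  rewrite !big_seq.
  by apply: ler_sum => p; rewrite mem_filter => /andP[_ /key].
rewrite exchange_big /= mulr_natl -[X in _ *+ X](card_ord n) -sumr_const.
apply: ler_sum => i _; apply: le_trans (hz i).
rewrite big_filter; rewrite [leRHS](bigID (fun p => p \notin codom z)) /=.
rewrite [X in _ <= X + _](eq_bigl (fun p => p \notin codom z)).
  by rewrite lerDl sumr_ge0.
move=> p; case pz: (p \in codom z); rewrite ?andbF //= andbT.
by apply: contraFneq pz => ->; exact: codom_f.
Qed.

(** * Equivalent forms *)

From mathcomp Require Import classical_sets.

Definition actr (K : fieldType) n (al : 'I_n -> K) (p q r s : int) (i : 'I_n) : K :=
  (al i * s%:~R - q%:~R) / (p%:~R - al i * r%:~R).

Section Act.
Variables (R : realType) (n : nat) (f : {poly int}) (al : 'I_n -> R[i]) (p q r s : int).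
Hypotheses (n1 : (1 < n)%N) (gf : good_form f al) (d0 : p * s - q * r != 0).

Let al' := actr al p q r s.

Lemma linf_col_gt0 i : 0 < linf al i p r.
Proof.
rewrite nrm_gt0; apply: (good_irrational n1 gf); apply: contraNT d0.
by rewrite negb_or !negbK => /andP[/eqP-> /eqP->]; rewrite mul0r mulr0 subr0.
Qed.

Lemma linf_actr i u v :
  linf al i p r * linf al' i u v = linf al i (p * u + q * v) (r * u + s * v).
Proof.
have := linf_col_gt0 i; rewrite nrm_gt0 => l0.
rewrite /linf -nrmM; congr nrm; rewrite /al' /actr !rmorphD !rmorphM /=; field.
exact: l0.
Qed.

Lemma lead_act : `|lead_coef (act n f p q r s)|%:~R =
  `|lead_coef f|%:~R * \prod_i linf al i p r :> R.
Proof.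
have [_ h _ _] := act_good n1 gf d0.
by have := congr1 (@nrm R) h; rewrite nrmM !nrm_int nrm_prod.
Qed.

Lemma house_actr i : linf al i p r * house al' i = Num.max (linf al i p r) (linf al i q s).
Proof.
have l0 := linf_col_gt0 i.
rewrite /house maxr_pMr ?ltW // mulr1; congr Num.max.
have -> : nrm (al' i) = linf al' i 0 1 by rewrite /linf mulr0z sub0r mulr1 nrmN.
by rewrite linf_actr !mulr0 !mulr1 !add0r.
Qed.

Lemma mahler_act : mahler (act n f p q r s) al' = equiv_mahler f al p q r s.
Proof.
rewrite /mahler lead_act -mulrA -big_split /=; congr (_ * _).
by apply: eq_bigr => i _; exact: house_actr.
Qed.

Lemma equiv_mahler_act a b c d : equiv_mahler (act n f p q r s) al' a b c d =
  equiv_mahler f al (p * a + q * c) (p * b + q * d) (r * a + s * c) (r * b + s * d).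
Proof.
rewrite /equiv_mahler lead_act -mulrA -big_split /=; congr (_ * _).
apply: eq_bigr => i _; rewrite maxr_pMr ?ltW ?linf_col_gt0 //.
by rewrite !linf_actr.
Qed.

Lemma rdisc_sqr (g : {poly int}) (be : 'I_n -> R[i]) : rdisc g be ^+ 2 =
  `|lead_coef g|%:~R ^+ (n.-1 * 2) * \prod_i \prod_(j | j != i) nrm (be j - be i).
Proof.
rewrite (@prod_pair_sym _ _ (fun i j => nrm (be j - be i))) => [|i j].
  by rewrite /rdisc exprMn -exprM.
by rewrite -nrmN opprB.
Qed.

(** With L_i = |p - al_i r|, the difference of two roots is multiplied by |det| / (L_i L_j) and the
    leading coefficient by the product of the L_i; all L_i cancel. *)
Lemma rdisc_act_sqr : rdisc (act n f p q r s) al' ^+ 2 =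
  `|p * s - q * r|%:~R ^+ (n * n.-1) * rdisc f al ^+ 2.
Proof.
have l0 i := linf_col_gt0 i.
have [_ _ _ dE] := act_good n1 gf d0.
set D := `|p * s - q * r|%:~R.
have cardN (i : 'I_n) : #|[pred j : 'I_n | j != i]| = n.-1.
  by rewrite -[n in RHS]card_ord -(cardC1 i).
have prodE : \prod_i \prod_(j | j != i) nrm (al' j - al' i) *
   (\prod_i linf al i p r) ^+ (n.-1 * 2) =
   D ^+ (n * n.-1) * \prod_i \prod_(j | j != i) nrm (al j - al i).
  have e1 : \prod_i \prod_(j < n | j != i) (linf al i p r * linf al j p r) =
     (\prod_i linf al i p r) ^+ (n.-1 * 2).
    have -> : \prod_i \prod_(j < n | j != i) (linf al i p r * linf al j p r) =
        \prod_i (linf al i p r ^+ n.-1) * \prod_i \prod_(j < n | j != i) linf al j p r.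
      rewrite -big_split /=; apply: eq_bigr => i _.
      by rewrite big_split /= prodr_const cardN.
    have -> : \prod_i \prod_(j < n | j != i) linf al j p r = \prod_i (linf al i p r ^+ n.-1).
      rewrite (exchange_big_dep predT) //=; apply: eq_bigr => j _.
      by under eq_bigl => i do rewrite eq_sym; rewrite prodr_const cardN.
    by rewrite prodrXl -expr2 exprM.
  rewrite -e1 -big_split /=.
  have -> : D ^+ (n * n.-1) = \prod_(i < n) \prod_(j < n | j != i) D.
    under eq_bigr => i _ do rewrite prodr_const cardN.
    by rewrite prodr_const card_ord -exprM mulnC.
  rewrite -big_split /=; apply: eq_bigr => i _; rewrite -!big_split /=.
  apply: eq_bigr => j _; rewrite /al' /actr dE nrmM nrmV nrmM nrmM nrm_int -/D -!/(linf al _ p r).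
  by rewrite divfK // mulf_neq0 // gt_eqF.
rewrite !rdisc_sqr lead_act exprMn -mulrA [_ ^+ _ * \prod_i _]mulrC prodE.
by rewrite !mulrA; congr (_ * _); rewrite mulrC.
Qed.

End Act.

Lemma rdisc_ge0 (R : realType) n (g : {poly int}) (be : 'I_n -> R[i]) : 0 <= rdisc g be.
Proof.
rewrite mulr_ge0 ?exprn_ge0 ?ler0z // prodr_ge0 // => i _.
by rewrite prodr_ge0 // => j _; exact: nrm_ge0.
Qed.

Lemma mahler_ge_lead (R : realType) n (f : {poly int}) (al : 'I_n -> R[i]) :
  `|lead_coef f|%:~R <= mahler f al.
Proof.
rewrite ler_peMr ?ler0z //.
by apply: (big_ind (fun x : R => 1 <= x)) => // [x y|i _]; [exact: mulr_ege1 | exact: house_ge1].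
Qed.

(** The measures of the admissible equivalent forms are at least 1, so their infimum is positive and
    can be approached within the factor 11 / 10. By composition of matrices, every competitor of the
    chosen form is one of f. *)
Lemma exists_nearly_reduced (R : realType) n (f : {poly int}) (al : 'I_n -> R[i]) m :
  (1 < n)%N -> good_form f al -> 0 < m -> (exists x, primsol n f m x) ->
  exists p q r s, [/\ p * s - q * r = 1, `|lead_coef (act n f p q r s)| = m &
    nearly_reduced (act n f p q r s) (actr al p q r s)].
Proof.
move=> n1 gf m0 [[x y] [/= cxy hm]].
pose ok (A : int * int * int * int) :=
  A.1.1.1 * A.2 - A.1.1.2 * A.1.2 = 1 /\ `|hom n f A.1.1.1 A.1.2| = m.
pose mu (A : int * int * int * int) : R := equiv_mahler f al A.1.1.1 A.1.1.2 A.1.2 A.2.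
have leadE A : ok A -> `|lead_coef (act n f A.1.1.1 A.1.1.2 A.1.2 A.2)| = m.
  case=> d1 hA; apply: (@intr_inj R); rewrite (lead_act n1 gf) ?d1 // -hA.
  by rewrite -[RHS]nrm_int (hom_splits _ _ gf.1) nrmM nrm_int nrm_prod.
have mu1 A : ok A -> 1 <= mu A.
  move=> okA; have [d1 hA] := okA.
  rewrite /mu -(mahler_act n1 gf) ?d1 //; apply: le_trans (mahler_ge_lead _ _).
  by rewrite leadE // -[1]/(1%:~R) ler_int -gtz0_ge1.
have [A0 okA0] : exists A, ok A.
  have [u [v e]] := Bezoutz x y; exists (x, - v, y, u); split => //=.
  by rewrite mulNr opprK (mulrC x) e (eqP cxy).
pose S := [set z : R | exists2 A, ok A & z = mu A]%classic.
have hinf : has_inf S.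
  by split; [exists (mu A0); exists A0 | exists 1 => _ [A okA ->]; exact: mu1].
have inf1 : 1 <= inf S by apply: lb_le_inf; [exact: hinf.1 | move=> _ [A okA ->]; exact: mu1].
have [_ [A okA ->] ltA] : exists2 z, S z & z < inf S + inf S / 10.
  by apply: inf_adherent => //; rewrite divr_gt0 // (lt_le_trans ltr01).
case: A okA ltA => [[[p q] r] s] okA ltA; exists p, q, r, s.
have [/= d1 hA] := okA; split => //; first exact: (leadE _ okA).
move=> a b c d d2 hB; rewrite (mahler_act n1 gf) ?d1 // (equiv_mahler_act n1 gf) ?d1 //.
have dn0 : p * s - q * r != 0 by rewrite d1.
have [_ _ hhom _] := act_good n1 gf dn0.
have okB : ok (p * a + q * c, p * b + q * d, r * a + s * c, r * b + s * d).
  split => /=; last by rewrite -hhom hB (leadE _ okA).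
  transitivity ((p * s - q * r) * (a * d - b * c)); first by ring.
  by rewrite d1 d2 mulr1.
have : inf S <= mu (p * a + q * c, p * b + q * d, r * a + s * c, r * b + s * d).
  apply: ge_inf; first exact: hinf.2.
  by exists (p * a + q * c, p * b + q * d, r * a + s * c, r * b + s * d).
rewrite /mu /= in ltA *; lra.
Qed.

(** * Solutions of large height *)

Definition lnh (R : realType) (p : int * int) : R := ln (height p.1 p.2)%:~R.

Definition inclass (R : realType) n (f : {poly int}) (al : 'I_n -> R[i]) m i p : Prop :=
  primsol n f m p /\ nearest al i p.1 p.2.

Lemma height_ge1 (R : realType) (p : int * int) :
  coprimez p.1 p.2 -> 1 <= (height p.1 p.2)%:~R :> R.
Proof.
case: p => x y /= cxy; rewrite -[1]/(1%:~R) ler_int -gtz0_ge1 lt_max !normr_gt0.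
apply: contraTT cxy; rewrite negb_or !negbK => /andP[/eqP-> /eqP->].
by rewrite /coprimez gcdz0.
Qed.

Lemma expR_lnh (R : realType) (p : int * int) :
  coprimez p.1 p.2 -> expR (lnh R p) = (height p.1 p.2)%:~R.
Proof. by move=> /(height_ge1 R) h; rewrite lnK // posrE (lt_le_trans ltr01). Qed.

(** Logarithm of the gap constant (M / Q)^(n - 2); it is negative if M < Q. *)
Definition lam (R : realType) n (f : {poly int}) (al : 'I_n -> R[i]) (Q : R) : R :=
  n.-2%:R * (ln (mahler f al) - ln Q).

Section Strong.
Variables (R : realType) (n : nat) (f : {poly int}) (al : 'I_n -> R[i]) (m : int) (Q : R).
Hypotheses (n2 : (2 < n)%N) (gf : good_form f al) (m0 : 0 < m) (Q1 : 1 <= Q).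
Hypothesis hQ : 2 * gapc R n * m%:~R * Q ^+ n.-2 <= rdisc f al.

Lemma mahler_ge1 : 1 <= mahler f al.
Proof.
apply: le_trans (mahler_ge_lead _ _); rewrite -[1]/(1%:~R) ler_int -gtz0_ge1.
by have := lead_gt0 gf; rewrite ltr0z.
Qed.

Lemma gapc_gt0 : 0 < gapc R n.
Proof.
by rewrite mulr_gt0 ?exprn_gt0 // sqrtr_gt0 exprn_gt0 // ltr0n -subn1 subn_gt0 (ltn_trans _ n2).
Qed.

Lemma expR_lam : expR (lam f al Q) = mahler f al ^+ n.-2 / Q ^+ n.-2.
Proof.
have Q0 : 0 < Q by exact: lt_le_trans Q1.
have M0 : 0 < mahler f al by exact: lt_le_trans mahler_ge1.
by rewrite expRM_natl -ln_div ?posrE // lnK ?posrE ?divr_gt0 // expr_div_n.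
Qed.

Lemma linf_height i p : nrm (al i) <= 1 -> inclass f al m i p ->
  2 * linf al i p.1 p.2 * (height p.1 p.2)%:~R ^+ n.-1 <= expR (lam f al Q).
Proof.
move=> a1 [[_ hm] nr].
have Q0 : 0 < Q by exact: lt_le_trans Q1.
have := lewis_mahler n2 gf a1 nr; rewrite hm.
set l := linf _ _ _ _; set H := _%:~R ^+ n.-1 => lm.
have l0 : 0 <= l by exact: nrm_ge0.
have H0 : 0 <= H by rewrite exprn_ge0 // ler0z le_max normr_ge0.
have gm : 0 < gapc R n * m%:~R by rewrite mulr_gt0 ?gapc_gt0 ?ltr0z.
rewrite expR_lam ler_pdivlMr ?exprn_gt0 // -(ler_pM2l gm).
apply: le_trans lm.
have -> : gapc R n * m%:~R * (2 * l * H * Q ^+ n.-2) =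
   2 * gapc R n * m%:~R * Q ^+ n.-2 * (H * l) by ring.
by rewrite -[leRHS]mulrA; apply: ler_wpM2r => //; exact: mulr_ge0.
Qed.

Lemma strong_gap i p q : nrm (al i) <= 1 -> inclass f al m i p -> inclass f al m i q ->
  nonprop p q -> height p.1 p.2 <= height q.1 q.2 ->
  n.-1%:R * lnh R p - lam f al Q <= lnh R q.
Proof.
move=> a1 cp cq np hpq.
have lp := linf_height a1 cp; have lq := linf_height a1 cq.
have [[cp1 _] _] := cp; have [[cq1 _] _] := cq.
have Hp1 := height_ge1 R cp1; have Hq1 := height_ge1 R cq1.
have hpqR : (height p.1 p.2)%:~R <= (height q.1 q.2)%:~R :> R by rewrite ler_int.
have l0 : 0 <= linf al i p.1 p.2 by exact: nrm_ge0.
have l1 : 0 <= linf al i q.1 q.2 by exact: nrm_ge0.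
rewrite lerBlDr -ler_expR expRD expRM_natl !expR_lnh //.
have yp : `|p.2|%:~R <= (height p.1 p.2)%:~R :> R by rewrite ler_int le_max lexx orbT.
have yq : `|q.2|%:~R <= (height q.1 q.2)%:~R :> R by rewrite ler_int le_max lexx orbT.
set E := expR _ in lp lq *; set H := _%:~R in Hp1 hpqR yp lp *.
set H' := _%:~R in Hq1 hpqR yq lq *.
set a := linf _ _ _ _ in l0 lp; set b := linf _ _ _ _ in l1 lq.
have h : 1 <= H' * a + H * b.
  have : 1 <= nrm ((p.1 * q.2 - q.1 * p.2)%:~R : R[i]).
    by rewrite nrm_int -[1]/(1%:~R) ler_int -gtz0_ge1 normr_gt0.
  move=> /le_trans; apply.
  have -> : (p.1 * q.2 - q.1 * p.2)%:~R = q.2%:~R * (p.1%:~R - al i * p.2%:~R) -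
     p.2%:~R * (q.1%:~R - al i * q.2%:~R) :> R[i] by rewrite rmorphB !rmorphM /=; ring.
  apply: le_trans (nrmB _ _) _; rewrite !nrmM !nrm_int.
  by apply: lerD; apply: ler_wpM2r.
have H0 : 0 <= H by lra.
have H'0 : 0 <= H' by lra.
have Hn0 : 0 <= H ^+ n.-1 by exact: exprn_ge0.
have hn : H * H ^+ n.-1 <= H' * H' ^+ n.-1.
  by apply: ler_pM => //; rewrite lerXn2r ?nnegrE.
have t1 : 2 * H ^+ n.-1 * 1 <= 2 * H ^+ n.-1 * (H' * a + H * b).
  by apply: ler_wpM2l => //; apply: mulr_ge0.
have t2 : H' * (2 * a * H ^+ n.-1) <= H' * E by apply: ler_wpM2l.
have t3 : H' * (2 * b * H' ^+ n.-1) <= H' * E by apply: ler_wpM2l.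
have t4 : 2 * b * (H * H ^+ n.-1) <= 2 * b * (H' * H' ^+ n.-1).
  by apply: ler_wpM2l => //; apply: mulr_ge0.
lra.
Qed.

(** The height is so large that |x - al_i y| < 1, and |al_i| <= 1 then gives |x| <= |y|. So the
    height is |y|, and a change of sign makes y positive. *)
Lemma approx_of_class i p L : nrm (al i) <= 1 -> inclass f al m i p ->
  lam f al Q <= n.-2%:R * L -> n.-2%:R * L < n.-1%:R * lnh R p ->
  exists x y : int, [/\ 0 < y, coprimez x y, `|x| <= y, y%:~R = expR (lnh R p) &
    nrm (al i - x%:~R / y%:~R) <= expR (n.-2%:R * L - n%:R * lnh R p)].
Proof.
move=> a1 cp laml lamlt; have lp := linf_height a1 cp.
have [[cp1 _] _] := cp; have Hp1 := height_ge1 R cp1.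
have l0 : 0 <= linf al i p.1 p.2 by exact: nrm_ge0.
have H0 : 0 < (height p.1 p.2)%:~R :> R by exact: lt_le_trans Hp1.
have Hn0 : 0 < (height p.1 p.2)%:~R ^+ n.-1 :> R by exact: exprn_gt0.
have l1 : linf al i p.1 p.2 < 1.
  have : 2 * linf al i p.1 p.2 * (height p.1 p.2)%:~R ^+ n.-1 < (height p.1 p.2)%:~R ^+ n.-1.
    apply: le_lt_trans lp _; rewrite -(expR_lnh R cp1) -expRM_natl ltr_expR.
    exact: le_lt_trans laml lamlt.
  by rewrite gtr_pMl // => ?; lra.
have xy : `|p.1| <= `|p.2|.
  rewrite -ltzD1 -(ltr_int R) rmorphD /= -!(@nrm_int R).
  have -> : (p.1)%:~R = (p.1%:~R - al i * p.2%:~R) + al i * p.2%:~R :> R[i] by ring.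
  apply: le_lt_trans (nrmD _ _) _; rewrite addrC; apply: ler_ltD => //.
  by rewrite nrmM ler_piMl // nrm_ge0.
have hE : height p.1 p.2 = `|p.2| by apply/max_idPr.
have y0 : p.2 != 0 by rewrite -normr_gt0 -hE -(ltr0z R).
have fin (x y : int) : linf al i x y = linf al i p.1 p.2 -> y = `|p.2| ->
   nrm (al i - x%:~R / y%:~R) <= expR (n.-2%:R * L - n%:R * lnh R p).
  move=> lE yE; have yC : y%:~R != 0 :> R[i] by rewrite intr_eq0 yE normr_eq0.
  have -> : al i - x%:~R / y%:~R = - ((x%:~R - al i * y%:~R) / y%:~R) by field.
  rewrite nrmN nrmM nrmV nrm_int -/(linf al i x y) lE yE normr_id -hE.
  rewrite ler_pdivrMr // expRB expRM_natl (expR_lnh R cp1).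
  have -> : (height p.1 p.2)%:~R ^+ n = (height p.1 p.2)%:~R * (height p.1 p.2)%:~R ^+ n.-1 :> R.
    by rewrite -exprS prednK // (ltn_trans _ n2).
  rewrite invfM mulrA mulrAC divfK ?gt_eqF //.
  rewrite ler_pdivlMr //.
  apply: (@le_trans _ _ (expR (lam f al Q))); last by rewrite ler_expR.
  by apply: le_trans lp; rewrite -mulrA ler_peMl ?ler1n // mulr_ge0 // ltW.
have cxy : coprimez p.1 p.2 := cp1.
have [y1|y1] := ltP 0 p.2.
  exists p.1, p.2; split => //; first by rewrite -[leRHS]gtr0_norm.
    by rewrite (expR_lnh R cp1) hE gtr0_norm.
  by apply: fin => //; rewrite gtr0_norm.
have y2 : p.2 < 0 by rewrite lt_neqAle y0.
exists (- p.1), (- p.2); split => //; first by rewrite oppr_gt0.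
- by rewrite coprimezN coprimeNz.
- by rewrite normrN -[leRHS]ltr0_norm.
- by rewrite (expR_lnh R cp1) hE ltr0_norm.
apply: fin => //; last by rewrite ltr0_norm.
by rewrite /linf !rmorphN /= mulrN -opprD nrmN.
Qed.

Lemma thue_pair i p q L : nrm (al i) <= 1 -> inclass f al m i p -> inclass f al m i q ->
  mahler f al <= expR L -> thue_range n L (lnh R p) (lnh R q) -> False.
Proof.
move=> a1 cp cq ML hr.
have [L1 Lu uv] : [/\ 1 <= L, 100 * L <= lnh R p & lnh R p <= lnh R q].
  case: hr => -[nE l1 l2 l3].
  - by split; lra.
  - by split; lra.
  have n5 : 5 <= n%:R :> R by rewrite ler_nat.
  by split; lra.
have M0 : 0 < mahler f al := lt_le_trans ltr01 mahler_ge1.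
have lML : ln (mahler f al) <= L by rewrite -[leRHS]expRK ler_ln ?posrE ?expR_gt0.
have lQ : 0 <= ln Q by exact: ln_ge0.
have ll : lam f al Q <= n.-2%:R * L by apply: ler_wpM2l => //; lra.
have n12 : n.-2%:R <= n.-1%:R :> R by rewrite ler_nat leq_pred.
have n11 : 1 <= n.-1%:R :> R by rewrite ler1n -subn1 subn_gt0 (ltn_trans _ n2).
have big u : 100 * L <= u -> n.-2%:R * L < n.-1%:R * u.
  move=> hu; apply: (@le_lt_trans _ _ (n.-1%:R * L)); first by apply: ler_wpM2r => //; lra.
  by rewrite ltr_pM2l; lra.
have [x1 [y1 [y10 c1 xy1 e1 h1]]] := approx_of_class a1 cp ll (big _ Lu).
have [x2 [y2 [y20 _ _ e2 h2]]] := approx_of_class a1 cq ll (big _ (le_trans Lu uv)).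
exact: (thue_main gf a1 ML y10 y20 c1 xy1 e1 e2 h1 h2 hr).
Qed.

Lemma class_sorted i s : nrm (al i) <= 1 -> uniq s ->
  (forall p, p \in s -> inclass f al m i p) ->
  {in s &, forall p q, p != q -> nonprop p q} ->
  exists t, perm_eq t s /\ forall j, (j.+1 < size t)%N ->
    n.-1%:R * lnh R (nth (0, 0) t j) - lam f al Q <= lnh R (nth (0, 0) t j.+1).
Proof.
move=> a1 us cs np.
pose r (p q : int * int) := height p.1 p.2 <= height q.1 q.2.
exists (sort r s); split; first by rewrite perm_sort.
move=> j jt.
have st : sorted r (sort r s) by apply: sort_sorted => p q; exact: le_total.
have ut : uniq (sort r s) by rewrite sort_uniq.
have m1 : nth (0, 0) (sort r s) j \in s by rewrite -(mem_sort r) mem_nth // ltnW.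
have m2 : nth (0, 0) (sort r s) j.+1 \in s by rewrite -(mem_sort r) mem_nth.
apply: strong_gap a1 (cs _ m1) (cs _ m2) _ _.
  by apply: np => //; rewrite nth_uniq ?neq_ltn ?ltnSn // ltnW.
by move/(sortedP (0, 0)): st; apply.
Qed.

End Strong.

From mathcomp Require Import boolp.

(* Two solutions attached to the same root at logarithmic heights u >= thueU n * L and
   v >= (n - 1)^thueK n * u contradict the Thue-Siegel principle, and idxB n (resp. idxA n)
   applications of the gap principle lead from height dltB n * L (resp. dltA n * L) to
   thueU n * L. *)
Definition thueK (n : nat) : nat := if n == 3%N then 4 else 2.
Definition idxB (n : nat) : nat := if n == 3%N then 8 else if n == 4%N then 7 else 4.
Definition idxA (n : nat) : nat := if n == 3%N then 10 else if n == 4%N then 9 else 5.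

Section Constants.
Variable R : realType.
Definition thueU (n : nat) : R :=
  if n == 3%N then 122 else if n == 4%N then 200 else 100.
Definition thueL (n : nat) : R :=
  if n == 3%N then 11 / 2 else if n == 4%N then 6 else 5 / 4 * n%:R.
Definition dltB (n : nat) : R :=
  if n == 3%N then 12 / 25 else if n == 4%N then 1 / 10 else
  if n == 5%N then 2 / 5 else 4 / 25.
Definition dltA (n : nat) : R :=
  if n == 3%N then 3 / 25 else if n == 4%N then 1 / 50 else
  if n == 5%N then 1 / 10 else 4 / 125.
End Constants.

Variant degree_spec : nat -> Prop :=
| Degree3 : degree_spec 3 | Degree4 : degree_spec 4 | Degree5 : degree_spec 5
| Degree6 n : degree_spec n.+4.+2.

Lemma degreeP n : (2 < n)%N -> degree_spec n.
Proof. by do 3 case: n => [|n] //; do 3 (case: n => [|n]; first by constructor); constructor. Qed.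

Lemma thueU_le_B (R : realType) n : (2 < n)%N -> thueU R n <= n.-1%:R ^+ idxB n * dltB R n.
Proof.
case/degreeP => [|||k]; rewrite /thueU /idxB /dltB /=; try lra.
have h : 5 ^+ 4 <= k.+4.+1%:R ^+ 4 :> R by rewrite lerXn2r ?nnegrE // ler_nat.
by lra.
Qed.

Lemma thueU_le_A (R : realType) n : (2 < n)%N -> thueU R n <= n.-1%:R ^+ idxA n * dltA R n.
Proof.
case/degreeP => [|||k]; rewrite /thueU /idxA /dltA /=; try lra.
have h : 5 ^+ 5 <= k.+4.+1%:R ^+ 5 :> R by rewrite lerXn2r ?nnegrE // ler_nat.
by lra.
Qed.

Lemma dltB_gt0 (R : realType) n : 0 < dltB R n.
Proof. by rewrite /dltB; do ?case: eqP => _; lra. Qed.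

Lemma dltA_gt0 (R : realType) n : 0 < dltA R n.
Proof. by rewrite /dltA; do ?case: eqP => _; lra. Qed.

Lemma thueL_gt0 (R : realType) n : (2 < n)%N -> 0 < thueL R n.
Proof.
case/degreeP => [|||k]; rewrite /thueL /=; try lra.
by rewrite mulr_gt0 ?divr_gt0 ?ltr0n.
Qed.

(** The recursion compares v - g with u - g. Since g <= L is small against u, little is lost in v /
    u: in degree 3, for instance, 16 - 15 / 122 > 15.8. *)
Lemma thue_range_growth (R : realType) n (L u v g : R) :
  (2 < n)%N -> thueL R n <= L -> thueU R n * L <= u -> 0 <= g <= L ->
  n.-1%:R ^+ thueK n * (u - g) <= v - g -> thue_range n L u v.
Proof.
move=> n2 hL hu /andP[g0 gL]; move: hL hu.
case/degreeP: n2 => [|||k]; rewrite /thueL /thueU /thueK /= => hL hu hv.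
- by constructor 1; split => //; lra.
- by constructor 2; split => //; lra.
- by constructor 3; split => //; lra.
have k0 : 0 <= k%:R :> R by rewrite ler0n.
have kE : k.+4.+2%:R = k%:R + 6 :> R by rewrite -natrD addnC.
have L0 : 0 <= L by move: hL; rewrite kE; lra.
constructor 3; split => //.
have h : 16 <= k.+4.+1%:R ^+ 2 :> R.
  have -> : 16 = 4 ^+ 2 :> R by rewrite -natrX.
  by rewrite lerXn2r ?nnegrE // ler_nat.
have : 16 * (u - g) <= k.+4.+1%:R ^+ 2 * (u - g) by apply: ler_wpM2r => //; lra.
lra.
Qed.

(** The recursion h' >= b h - lm has the fixed point lm / (b - 1). Measured from a g at or above it,
    heights are multiplied by b at each step. *)
Lemma growth (R : realType) (h : nat -> R) (b g lm : R) N :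
  (forall j, (j.+1 < N)%N -> b * h j - lm <= h j.+1) -> 0 <= b -> lm <= (b - 1) * g ->
  forall k j, (j + k < N)%N -> b ^+ k * (h j - g) <= h (j + k)%N - g.
Proof.
move=> hs b0 hl; elim=> [|k IH] j jk; first by rewrite expr0 mul1r addn0.
have jk' : (j + k < N)%N by apply: leq_trans jk; rewrite ltnS leq_add2l.
have := hs (j + k)%N; rewrite -addnS => /(_ jk).
have : b * (b ^+ k * (h j - g)) <= b * (h (j + k)%N - g) by apply: ler_wpM2l => //; exact: IH.
rewrite exprS -mulrA; lra.
Qed.

(** The fixed point ln M - ln Q of the gap recursion, cut off at 0. *)
Definition excess (R : realType) n (f : {poly int}) (al : 'I_n -> R[i]) (Q : R) : R :=
  Num.max 0 (ln (mahler f al) - ln Q).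

(** Two situations that bound the number of points at one root by b. On the left all heights exceed
    the fixed point by a margin. On the right the gap constant is so small that the second point is
    high whatever the first is, whence the additional 1. *)
Definition count_hyp (R : realType) n (f : {poly int}) (al : 'I_n -> R[i]) (Q L : R)
    (s : seq (int * int)) (b : nat) : Prop :=
  [/\ forall p, p \in s -> excess f al Q + dltB R n * L <= lnh R p & b = (idxB n + thueK n)%N]
  \/ [/\ lam f al Q <= - (dltA R n * L) & b = ((idxA n).+1 + thueK n)%N].

Lemma class_count_small (R : realType) n (f : {poly int}) (al : 'I_n -> R[i]) m Q L i s b :
  (2 < n)%N -> good_form f al -> 0 < m -> 1 <= Q ->
  2 * gapc R n * m%:~R * Q ^+ n.-2 <= rdisc f al ->
  mahler f al <= expR L -> thueL R n <= L ->
  nrm (al i) <= 1 -> uniq s -> (forall p, p \in s -> inclass f al m i p) ->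
  {in s &, forall p q, p != q -> nonprop p q} ->
  count_hyp f al Q L s b -> (size s <= b)%N.
Proof.
move=> n2 gf m0 Q1 hQ ML hL a1 us cs np hb; rewrite leqNgt; apply/negP => bs.
have [t [pt gr]] := class_sorted n2 gf m0 Q1 hQ a1 us cs np.
rewrite -(perm_size pt) in bs.
have mt j : (j < size t)%N -> nth (0, 0) t j \in s by move=> jt; rewrite -(perm_mem pt) mem_nth.
have L0 : 0 < L := lt_le_trans (thueL_gt0 R n2) hL.
have b0 : 0 <= n.-1%:R :> R by [].
have bE : n.-1%:R - 1 = n.-2%:R :> R.
  by move: n2; clear; case: n => [|[|[|n]]] //= _; rewrite -[n.+2%:R]natr1 addrK.
have M0 : 0 < mahler f al := lt_le_trans ltr01 (mahler_ge1 gf).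
have lML : ln (mahler f al) <= L by rewrite -[leRHS]expRK ler_ln ?posrE ?expR_gt0.
have lQ : 0 <= ln Q by exact: ln_ge0.
pose h j := lnh R (nth (0, 0) t j).
have fin g a : 0 <= g <= L -> lam f al Q <= n.-2%:R * g -> thueU R n * L <= h a ->
    (a + thueK n < size t)%N -> False.
  move=> hg hl ha hs.
  have at' : (a < size t)%N by apply: leq_ltn_trans hs; exact: leq_addr.
  apply: (thue_pair n2 gf m0 Q1 hQ a1 (cs _ (mt _ at')) (cs _ (mt _ hs)) ML).
  apply: (thue_range_growth n2 hL ha hg).
  by apply: (growth gr) => //; rewrite bE.
case: hb => -[hb bb]; rewrite {}bb in bs.
  have g0 : 0 <= excess f al Q <= L.
    by rewrite le_max lexx /= ge_max ltW //=; lra.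
  have gl : lam f al Q <= n.-2%:R * excess f al Q by apply: ler_wpM2l => //; rewrite le_max lexx orbT.
  apply: (fin (excess f al Q) (idxB n) g0 gl _ bs).
  have bt : (0 + idxB n < size t)%N by apply: leq_ltn_trans bs; exact: leq_addr.
  have := @growth R h _ (excess f al Q) _ _ gr b0 _ (idxB n) 0%N bt.
  rewrite bE => /(_ gl); rewrite add0n => h1.
  have h0 : dltB R n * L <= h 0%N - excess f al Q.
    by rewrite lerBrDl; apply: hb; apply: mt; exact: leq_ltn_trans bt.
  have h2 : n.-1%:R ^+ idxB n * (dltB R n * L) <= n.-1%:R ^+ idxB n * (h 0%N - excess f al Q).
    by apply: ler_wpM2l => //; exact: exprn_ge0.
  have h3 : thueU R n * L <= n.-1%:R ^+ idxB n * dltB R n * L.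
    by apply: ler_wpM2r; [exact: ltW | exact: thueU_le_B].
  case/andP: g0 => g0 _; lra.
have dA := dltA_gt0 R n.
have g0 : 0 <= (0 : R) <= L by rewrite lexx ltW.
have gl : lam f al Q <= n.-2%:R * 0.
  by rewrite mulr0; apply: le_trans hb _; rewrite oppr_le0 mulr_ge0 // ltW.
apply: (fin 0 (idxA n).+1 g0 gl _ bs).
have bt : (1 + idxA n < size t)%N by rewrite add1n; apply: leq_ltn_trans bs; exact: leq_addr.
have := @growth R h _ 0 _ _ gr b0 _ (idxA n) 1%N bt.
rewrite bE => /(_ gl); rewrite !subr0 add1n => h1.
have s1 : (1 < size t)%N by apply: leq_ltn_trans bt; rewrite leq_addr.
have h0 : dltA R n * L <= h 1%N.
  have := gr 0%N s1; rewrite -!/(h _).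
  have : 0 <= n.-1%:R * h 0%N.
    apply: mulr_ge0 => //; apply: ln_ge0; apply: height_ge1.
    by have [[]] := cs _ (mt 0%N (ltnW s1)).
  lra.
have h2 : n.-1%:R ^+ idxA n * (dltA R n * L) <= n.-1%:R ^+ idxA n * h 1%N.
  by apply: ler_wpM2l => //; exact: exprn_ge0.
have h3 : thueU R n * L <= n.-1%:R ^+ idxA n * dltA R n * L.
  by apply: ler_wpM2r; [exact: ltW | exact: thueU_le_A].
lra.
Qed.

(** * Exchange of the variables, which brings roots of modulus above 1 below 1 *)

Section Swap.
Variables (R : realType) (n : nat) (f : {poly int}) (al : 'I_n -> R[i]).
Hypotheses (n1 : (1 < n)%N) (gf : good_form f al).
Let f' := act n f 0 1 1 0.
Let al' := actr al 0 1 1 0.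
Let d0 : 0 * 0 - 1 * 1 != 0 :> int. Proof. by []. Qed.

Let linf01 i : linf al i 0 1 = nrm (al i).
Proof. by rewrite /linf mulr0z sub0r mulr1 nrmN. Qed.

Lemma nrm_root_gt0 i : 0 < nrm (al i).
Proof. by rewrite -linf01; apply: (linf_col_gt0 n1 gf d0). Qed.

Lemma swap_linf i u v : nrm (al i) * linf al' i u v = linf al i v u.
Proof. by rewrite -linf01 (linf_actr n1 gf d0) !mul0r !mul1r add0r addr0. Qed.

Lemma swap_house i : nrm (al i) * house al' i = house al i.
Proof.
rewrite -linf01 (house_actr n1 gf d0) linf01 /house maxC; congr Num.max.
by rewrite /linf mulr0z mulr0 subr0 nrm1.
Qed.

Lemma swap_good : good_form f' al'.
Proof. by have [] := act_good n1 gf d0. Qed.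

Lemma swap_root i : nrm (al' i) = (nrm (al i))^-1.
Proof.
have := swap_linf i 0 1; rewrite /linf mulr0z sub0r mulr1 nrmN mulr0 subr0 nrm1 => h.
by apply: (mulfI (lt0r_neq0 (nrm_root_gt0 i))); rewrite h mulfV // gt_eqF // nrm_root_gt0.
Qed.

Lemma swap_mahler : mahler f' al' = mahler f al.
Proof.
rewrite (mahler_act n1 gf d0) /equiv_mahler /mahler; congr (_ * _); apply: eq_bigr => i _.
by rewrite -(house_actr n1 gf d0) linf01 swap_house.
Qed.

Lemma swap_rdisc : rdisc f' al' = rdisc f al.
Proof.
apply/eqP; rewrite -(@eqrXn2 _ 2) ?rdisc_ge0 // (rdisc_act_sqr n1 gf d0).
by rewrite mul0r sub0r normrN mul1r normr1 expr1n mul1r.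
Qed.

Lemma swap_class m i p : inclass f al m i p -> inclass f' al' m i (p.2, p.1).
Proof.
case=> [[cp hm] nr]; split; first split.
- by rewrite coprimez_sym.
- have [_ _ h _] := act_good n1 gf d0.
  by rewrite h !mul0r !mul1r add0r addr0.
move=> j /=.
have i0 := nrm_root_gt0 i; have j0 := nrm_root_gt0 j.
rewrite -(ler_pM2l i0) -(ler_pM2l j0).
have := nr j; rewrite -!swap_linf -!swap_house.
by congr (_ <= _); ring.
Qed.

End Swap.

Lemma class_count (R : realType) n (f : {poly int}) (al : 'I_n -> R[i]) m Q L i s b :
  (2 < n)%N -> good_form f al -> 0 < m -> 1 <= Q ->
  2 * gapc R n * m%:~R * Q ^+ n.-2 <= rdisc f al ->
  mahler f al <= expR L -> thueL R n <= L ->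
  uniq s -> (forall p, p \in s -> inclass f al m i p) ->
  {in s &, forall p q, p != q -> nonprop p q} ->
  count_hyp f al Q L s b -> (size s <= b)%N.
Proof.
move=> n2 gf m0 Q1 hQ ML hL us cs np hb; have n1 := ltnW n2.
have [a1|a1] := leP (nrm (al i)) 1; 
  first exact: (class_count_small n2 gf m0 Q1 hQ ML hL a1 us cs np hb).
pose sw (p : int * int) := (p.2, p.1).
have swI : injective sw by move=> [a c] [a' c'] [-> ->].
rewrite -(size_map sw).
apply: (@class_count_small R n (act n f 0 1 1 0) (actr al 0 1 1 0) m Q L i) => //.
- exact: swap_good.
- by rewrite swap_rdisc.
- by rewrite swap_mahler.
- by rewrite (swap_root n1 gf) invf_le1 ?ltW // (lt_trans ltr01).
- by rewrite map_inj_uniq.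
- by move=> _ /mapP[p ps ->]; apply: swap_class => //; exact: cs.
- move=> _ _ /mapP[p ps ->] /mapP[q qs ->] pq.
  have := np p q ps qs; rewrite (contraNneq _ pq) => [/(_ isT)|-> //].
  rewrite /nonprop /=.
  by have -> : p.2 * q.1 - q.2 * p.1 = - (p.1 * q.2 - q.1 * p.2); [ring | rewrite oppr_eq0].
case: hb => -[h1 h2]; [left|right]; split => //; last first.
  by move: h1; rewrite /lam swap_mahler.
move=> _ /mapP[p ps ->]; rewrite /excess swap_mahler //.
by apply: le_trans (h1 p ps) _; rewrite /lnh /height /= maxC.
Qed.

Lemma size_classes (T : Type) (I : finType) (c : T -> I) (s : seq T) :
  size s = (\sum_i size [seq p <- s | c p == i])%N.
Proof.
under eq_bigr => i _ do rewrite size_filter -sum1_count.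
rewrite (exchange_big_dep predT) //= -sum1_size; apply: eq_bigr => p _.
by rewrite (eq_bigl (pred1 (c p))) ?big_pred1_eq // => i; rewrite /= eq_sym.
Qed.

Lemma size_filterC (T : Type) (a : pred T) (s : seq T) :
  size s = (size (filter a s) + size (filter (predC a) s))%N.
Proof. by rewrite !size_filter count_predC. Qed.

Lemma form_count_classes (R : realType) n (f : {poly int}) (al : 'I_n -> R[i]) m Q L s b :
  (2 < n)%N -> good_form f al -> 0 < m -> 1 <= Q ->
  2 * gapc R n * m%:~R * Q ^+ n.-2 <= rdisc f al ->
  mahler f al <= expR L -> thueL R n <= L ->
  uniq s -> (forall p, p \in s -> primsol n f m p) ->
  {in s &, forall p q, p != q -> nonprop p q} ->
  count_hyp f al Q L s b -> (size s <= n * b)%N.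
Proof.
move=> n2 gf m0 Q1 hQ ML hL us cs np hb.
have /choice[c hc] (p : int * int) : exists i, nearest al i p.1 p.2 by exact: exists_nearest.
rewrite (size_classes c) -[X in (_ <= X * _)%N](card_ord n) -sum_nat_const.
apply: leq_sum => i _.
apply: (@class_count R n f al m Q L i) => //; first exact: filter_uniq.
- move=> p; rewrite mem_filter => /andP[/eqP <- ps]; split; [exact: cs | exact: hc].
- by move=> p q; rewrite !mem_filter => /andP[_ ps] /andP[_ qs]; exact: np.
case: hb => -[h1 h2]; [left|right]; split => // p.
by rewrite mem_filter => /andP[_ /h1].
Qed.

(** Here a = ln M, q = ln Q and p = ln (1.1 * 3^n m). The left side of the last inequality is the
    logarithm of the height up to which solutions count as small, and a - p is the gain G of each of
    them, so C bounds the cost per root. *)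
Lemma weak_cost (R : realType) (a q p dA dB e C : R) :
  0 < q -> 0 < dB -> 0 <= dA -> 1 + dB <= C -> 0 <= e ->
  C * p + dB * q <= C * (1 - e) * q -> - e * Num.max a q < a - q ->
  0 < a - p /\ Num.max 0 (a - q) + dB * Num.max a q <= C * (a - p).
Proof.
move=> q0 dB0 dA0 C1 e0 star.
have C0 : 0 < C by lra.
suff h : - e * Num.max a q < a - q ->
   Num.max 0 (a - q) + dB * Num.max a q <= C * (a - p).
  move=> /h h1; split => //; rewrite -(pmulr_rgt0 _ C0); apply: lt_le_trans h1.
  apply: (@lt_le_trans _ _ (dB * q)); first exact: mulr_gt0.
  rewrite -[leLHS]add0r; apply: lerD; first by rewrite le_max lexx.
  by rewrite ler_pM2l // le_max lexx orbT.
have [aq|aq] := leP q a => hh.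
  have -> : Num.max 0 (a - q) = a - q by apply/max_idPr; lra.
  have h1 : (C - 1 - dB) * q <= (C - 1 - dB) * a by apply: ler_wpM2l => //; lra.
  have h2 : 0 <= C * e * q by rewrite !mulr_ge0 // ltW.
  lra.
have -> : Num.max 0 (a - q) = 0 by apply/max_idPl; lra.
have : C * (q - e * q) <= C * a by apply: ler_wpM2l; lra.
lra.
Qed.

Definition sgn_norm (p : int * int) : int * int :=
  if 0 < p.2 then p else (- p.1, - p.2).

Lemma sgn_normP p : p.2 != 0 -> [/\ 0 < (sgn_norm p).2, `|(sgn_norm p).2| = `|p.2| &
  forall n f m, primsol n f m p -> primsol n f m (sgn_norm p)].
Proof.
case: p => x y /= y0; rewrite /sgn_norm /=; case: (ltP 0 y) => yle //=.
split; rewrite ?normrN //; first by rewrite oppr_gt0 lt_neqAle y0.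
move=> n f m [/= c h]; split => /=; first by rewrite coprimezN coprimeNz.
rewrite -h; suff -> : hom n f (- x) (- y) = (-1) ^+ n * hom n f x y.
  by rewrite normrM normrX normrN1 expr1n mul1r.
rewrite mulr_sumr; apply: eq_bigr => i _.
rewrite [(- x) ^+ _]exprNn [(- y) ^+ _]exprNn.
have -> : (-1) ^+ n = (-1) ^+ i * (-1) ^+ (n - i) :> int.
  by rewrite -exprD subnKC // -ltnS.
by ring.
Qed.

Lemma sgn_norm_det p q : nonprop (sgn_norm p) (sgn_norm q) = nonprop p q.
Proof.
rewrite /sgn_norm; case: ifP => _; case: ifP => _; rewrite /nonprop //=.
- by rewrite mulrN mulNr -opprB opprK oppr_eq0 addrC; congr (_ != _); ring.
- by rewrite mulrN mulNr -opprD oppr_eq0.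
- by rewrite !mulrNN.
Qed.

Lemma form_count (R : realType) n (f : {poly int}) (al : 'I_n -> R[i]) (Q C : R) s :
  let p := ln (11 / 10 * `|lead_coef f|%:~R * 3 ^+ n) in
  (2 < n)%N -> good_form f al -> nearly_reduced f al -> 1 <= Q ->
  2 * gapc R n * `|lead_coef f|%:~R * Q ^+ n.-2 <= rdisc f al ->
  thueL R n <= ln Q -> 1 + dltB R n <= C ->
  C * p + dltB R n * ln Q <= C * (1 - dltA R n / n.-2%:R) * ln Q ->
  uniq s -> (forall x, x \in s -> primsol n f `|lead_coef f| x) ->
  {in s &, forall x y, x != y -> nonprop x y} ->
  (size s <= n * ((idxA n).+1 + thueK n))%N \/
  (size s)%:R <= n%:R * ((idxB n + thueK n)%:R + 1 + C) + 1 :> R.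
Proof.
move=> p n2 gf rf Q1 hQ hL C1 star us cs np.
have M0 : 0 < mahler f al := lt_le_trans ltr01 (mahler_ge1 gf).
have m0 : 0 < `|lead_coef f| by rewrite -(ltr0z R) (lead_gt0 gf).
pose a := ln (mahler f al); pose q := ln Q; pose L := Num.max a q.
have ML : mahler f al <= expR L by rewrite -[leLHS]lnK ?posrE // ler_expR le_max lexx.
have hL' : thueL R n <= L by rewrite le_max hL orbT.
have q0 : 0 < q := lt_le_trans (thueL_gt0 R n2) hL.
have n20 : 0 < n.-2%:R :> R by rewrite ltr0n -subn2 subn_gt0.
have dA := dltA_gt0 R n; have dB := dltB_gt0 R n.
(* Either M is so far below Q that the gap principle suffices, or ln M > (1 - e) ln Q with e =
   [dltA] / (n - 2), and the count of small solutions is affordable. *)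
have [hA|hA] := leP (lam f al Q) (- (dltA R n * L)).
  left; apply: (form_count_classes n2 gf m0 Q1 hQ ML hL' us cs np).
  by right.
right.
have e0 : 0 <= dltA R n / n.-2%:R by rewrite divr_ge0 // ltW.
have hB : - (dltA R n / n.-2%:R) * Num.max a q < a - q.
  rewrite -(ltr_pM2l n20); apply: le_lt_trans hA; rewrite -/L.
  have -> : n.-2%:R * (- (dltA R n / n.-2%:R) * L) = - (dltA R n * L) * (n.-2%:R / n.-2%:R) by ring.
  by rewrite divff ?gt_eqF // mulr1.
have [G0 cost] := weak_cost q0 dB (ltW dA) C1 e0 star hB.
pose Y := expR (excess f al Q + dltB R n * L).
pose big := [seq x <- s | excess f al Q + dltB R n * L <= lnh R x].
pose sm := [seq x <- s | ~~ (excess f al Q + dltB R n * L <= lnh R x)].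
have smb : (size s = size big + size sm)%N.
  exact: (size_filterC (fun x => excess f al Q + dltB R n * L <= lnh R x)).
have bigle : (size big <= n * (idxB n + thueK n))%N.
  apply: (form_count_classes n2 gf m0 Q1 hQ ML hL') => //; first exact: filter_uniq.
  - by move=> x; rewrite mem_filter => /andP[_ /cs].
  - by move=> x y; rewrite !mem_filter => /andP[_ xs] /andP[_ ys]; exact: np.
  by left; split => // x; rewrite mem_filter => /andP[].
(* The weak count wants y > 0. Points with y = 0 are proportional, so there is at most one: the
   summand 1 in the bound. The others are made positive by [sgn_norm]. *)
pose s0 := [seq x <- sm | x.2 == 0]; pose s1 := [seq x <- sm | x.2 != 0].
have sm01 : (size sm = size s0 + size s1)%N by exact: (size_filterC (fun x => x.2 == 0)).
have usm : uniq sm by exact: filter_uniq.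
have s0le : (size s0 <= 1)%N.
  have us0 : uniq s0 by exact: filter_uniq.
  have ms0 x : x \in s0 -> x \in s /\ x.2 = 0.
    by rewrite !mem_filter => /andP[/eqP h /andP[_ ?]].
  clear sm01; case: s0 us0 ms0 => [|x [|y s0]] // us0 ms0.
  have [xs x0] : x \in s /\ x.2 = 0 by apply: ms0; rewrite mem_head.
  have [ys y0] : y \in s /\ y.2 = 0 by apply: ms0; rewrite !inE eqxx orbT.
  have : nonprop x y.
    by apply: np => //; move: us0; rewrite /= inE negb_or => /andP[/andP[]].
  by rewrite /nonprop x0 y0 !mulr0 subrr eqxx.
have ms1 x : x \in s1 -> [/\ x \in s, x.2 != 0 & lnh R x < excess f al Q + dltB R n * L].
  by rewrite !mem_filter -ltNge => /andP[h /andP[h1 h2]].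
have s1le : (size s1)%:R <= n%:R * (C + 1) :> R.
  rewrite -(ler_pM2r G0) -(size_map sgn_norm).
  apply: le_trans (_ : n%:R * (ln Y + (a - p)) <= _); last first.
    rewrite -mulrA; apply: ler_wpM2l => //; rewrite /Y expRK mulrDl mul1r lerD2r.
    exact: cost.
  have np1 x y : x \in s1 -> y \in s1 -> x != y -> nonprop (sgn_norm x) (sgn_norm y).
    by move=> /ms1[xs _ _] /ms1[ys _ _] xy; rewrite sgn_norm_det np.
  apply: (weak_count n2 gf rf).
  - exact: ltW.
  - rewrite /Y -[leLHS]expR0 ler_expR addr_ge0 ?le_max ?lexx // mulr_ge0 ?ltW //.
    exact: lt_le_trans (thueL_gt0 R n2) hL'.
  - rewrite map_inj_in_uniq; first exact: filter_uniq.
    move=> x y xs ys e; apply/eqP; apply: contraT => xy.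
    by have := np1 x y xs ys xy; rewrite e /nonprop mulrC subrr eqxx.
  - move=> _ /mapP[x xs ->]; have [xs' x20 xh] := ms1 x xs.
    have [h1 h2 h3] := sgn_normP x20; split => //; first exact/h3/cs.
    have cx : coprimez x.1 x.2 by have [] := cs x xs'.
    rewrite /Y; apply: le_trans (_ : expR (lnh R x) <= _); last by rewrite ler_expR ltW.
    by rewrite expR_lnh // ler_int -[leLHS]gtr0_norm // h2 le_max lexx orbT.
  - by move=> _ _ /mapP[x xs ->] /mapP[y ys ->] h; apply: np1 => //; apply: contraNneq h => ->.
have : (size s)%:R <= (n * (idxB n + thueK n))%:R + 1 + (size s1)%:R :> R.
  rewrite -[1]/(1%:R) -!natrD ler_nat smb sm01 addnA leq_add2r.
  exact: leq_add.
rewrite natrM => h; move: s1le h; clear; lra.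
Qed.

(** * Sublattices *)

Definition solution_list n (f : {poly int}) m (s : seq (int * int)) : Prop :=
  [/\ uniq s, forall x, x \in s -> primsol n f m x &
    {in s &, forall x y, x != y -> nonprop x y}].

Lemma coprimez_comb p q r s u v :
  coprimez (p * u + q * v) (r * u + s * v) -> coprimez u v.
Proof.
move=> /eqP h.
have h1 : (gcdz u v %| gcdz (p * u + q * v)%R (r * u + s * v)%R)%Z.
  by rewrite dvdz_gcd !rpredD ?dvdz_mull ?dvdz_gcdl ?dvdz_gcdr.
by move: h1; rewrite h dvdz1 /coprimez /gcdz absz_nat => /eqP->.
Qed.

Lemma pull_list (R : realType) n (f : {poly int}) (al : 'I_n -> R[i]) m p q r s t :
  (1 < n)%N -> good_form f al -> p * s - q * r != 0 -> solution_list n f m t ->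
  (forall x, x \in t -> exists y : int * int,
     x = (p * y.1 + q * y.2, r * y.1 + s * y.2)) ->
  exists2 t', size t' = size t & solution_list n (act n f p q r s) m t'.
Proof.
move=> n1 gf d0 [ut st np] ex.
have /choice[g hg] (x : int * int) : exists y : int * int, x \in t ->
    x = (p * y.1 + q * y.2, r * y.1 + s * y.2).
  case xt: (x \in t); last by exists (0, 0).
  by have [y yE] := ex x xt; exists y.
have [_ _ hh _] := act_good n1 gf d0.
exists (map g t); first exact: size_map.
split.
- rewrite map_inj_in_uniq // => x y xt yt e.
  by rewrite (hg x xt) (hg y yt) e.
- move=> _ /mapP[x xt ->]; have [cx hx] := st x xt; have xE := hg x xt.
  have x1 : x.1 = _ := congr1 fst xE; have x2 : x.2 = _ := congr1 snd xE.
  rewrite /= in x1 x2; split; last by rewrite hh -x1 -x2.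
  by move: cx; rewrite x1 x2; exact: coprimez_comb.
move=> _ _ /mapP[x xt ->] /mapP[y yt ->] xy.
have : nonprop x y by apply: np => //; apply: contraNneq xy => ->.
rewrite /nonprop; apply: contraNneq => e; rewrite (hg x xt) (hg y yt) /=.
set a := g x in e *; set b := g y in e *.
have -> : (p * a.1 + q * a.2) * (r * b.1 + s * b.2) - (p * b.1 + q * b.2) * (r * a.1 + s * a.2)
  = (p * s - q * r) * (a.1 * b.2 - b.1 * a.2) by ring.
by rewrite e mulr0.
Qed.

Lemma subform_count (R : realType) n (f : {poly int}) (al : 'I_n -> R[i]) m (Q C : R) t :
  let p := ln (11 / 10 * m%:~R * 3 ^+ n) in
  (2 < n)%N -> good_form f al -> 0 < m -> 1 <= Q ->
  2 * gapc R n * m%:~R * Q ^+ n.-2 <= rdisc f al ->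
  thueL R n <= ln Q -> 1 + dltB R n <= C ->
  C * p + dltB R n * ln Q <= C * (1 - dltA R n / n.-2%:R) * ln Q ->
  solution_list n f m t ->
  (size t <= n * ((idxA n).+1 + thueK n))%N \/
  (size t)%:R <= n%:R * ((idxB n + thueK n)%:R + 1 + C) + 1 :> R.
Proof.
move=> P n2 gf m0 Q1 hQ hL C1 star st; have n1 := ltnW n2.
case: t st => [|x0 t0] st; first by left.
have ex : exists x, primsol n f m x by exists x0; have [_ h _] := st; apply: h; rewrite mem_head.
have [p [q [r [s [d1 lE nr]]]]] := exists_nearly_reduced n1 gf m0 ex.
have d0 : p * s - q * r != 0 by rewrite d1.
have gf' : good_form (act n f p q r s) (actr al p q r s) by have [] := act_good n1 gf d0.
have rE : rdisc (act n f p q r s) (actr al p q r s) = rdisc f al.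
  apply/eqP; rewrite -(@eqrXn2 _ 2) ?rdisc_ge0 // (rdisc_act_sqr n1 gf d0).
  by rewrite d1 normr1 expr1n mul1r.
have [|t' <- [ut' st' np']] := pull_list n1 gf d0 st.
  move=> x _; exists (s * x.1 - q * x.2, p * x.2 - r * x.1) => /=.
  rewrite [LHS]surjective_pairing; congr (_, _).
    by rewrite -[LHS]mul1r -d1; ring.
  by rewrite -[LHS]mul1r -d1; ring.
apply: (@form_count R n _ _ Q C t' n2 gf' nr) => //; rewrite ?lE ?rE //.
Qed.

Lemma residue_ord (N : nat) (z : int) : (0 < N)%N -> exists t : 'I_N, exists k : int, z = k * N%:Z + t%:Z.
Proof.
move=> N0.
have h0 : 0 <= (z %% N%:Z)%Z by apply: modz_ge0; rewrite eqz_nat -lt0n.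
have h1 : (z %% N%:Z)%Z < N%:Z by apply: ltz_pmod; rewrite ltz_nat.
have e : (`|(z %% N%:Z)%Z|%N)%:Z = (z %% N%:Z)%Z by exact: gez0_abs.
have lt : (`|(z %% N%:Z)%Z| < N)%N by rewrite -ltz_nat e.
by exists (Ordinal lt), (z %/ N%:Z)%Z; rewrite /= e -divz_eq.
Qed.

Lemma bezout_primepow (p e : nat) (y : int) : prime p -> ~~ (p%:Z %| y)%Z ->
  exists u v : int, u * (p ^ e)%:Z + v * y = 1.
Proof.
move=> pp py; have c : coprimez (p ^ e)%:Z y.
  by rewrite /coprimez /gcdz eqz_nat -/(coprime _ _) /= coprimeXl // prime_coprime.
by have [u [v h]] := Bezoutz (p ^ e)%:Z y; exists u, v; rewrite h (eqP c).
Qed.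

(** The two families are the points of the projective line over Z / p^(e + 1): (t : 1) if p does not
    divide y, and (1 : p t) if it does. *)
Lemma prime_pow_cover (p e : nat) (x y : int) : prime p -> coprimez x y ->
  (exists (t : 'I_(p ^ e.+1)) (u : int), x = (p ^ e.+1)%:Z * u + t%:Z * y) \/
  (exists (t : 'I_(p ^ e)) (u : int), y = (p ^ e.+1)%:Z * u + (p * t)%:Z * x).
Proof.
move=> pp cxy; set N := (p ^ e.+1)%N.
have N0 : (0 < N)%N by rewrite expn_gt0 prime_gt0.
have [py|py] := boolP (p%:Z %| y)%Z; last first.
  left; have [u [v h]] := bezout_primepow e.+1 pp py.
  have [t [k hk]] := residue_ord (x * v) N0.
  exists t, (x * u + k * y).
  have -> : t%:Z = x * v - k * N%:Z by rewrite hk addrC addKr.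
  rewrite -[LHS]mulr1 -h -/N; ring.
right.
have px : ~~ (p%:Z %| x)%Z.
  apply/negP => px; have : (p%:Z %| gcdz x y)%Z by rewrite dvdz_gcd px.
  by rewrite (eqP cxy) dvdz1 /= => /eqP p1; move: pp; rewrite p1.
have [u [v h]] := bezout_primepow e.+1 pp px.
have [t [k hk]] := residue_ord (y * v) N0.
have tE : t%:Z = y * v - k * N%:Z by rewrite hk addrC addKr.
have pt : (p %| t)%N.
  have : (p%:Z %| t%:Z)%Z.
    rewrite tE; apply: rpredB; first exact: dvdz_mulr.
    by apply: dvdz_mull; rewrite /N expnS PoszM; exact: dvdz_mulr.
  by [].
have lt : (t %/ p < p ^ e)%N by rewrite ltn_divLR ?prime_gt0 // mulnC -expnS.
exists (Ordinal lt), (y * u + k * x) => /=.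
rewrite [(p * _)%N]mulnC divnK // tE -[LHS]mulr1 -h -/N; ring.
Qed.

Lemma cover_count (R : realType) n (f : {poly int}) (al : 'I_n -> R[i]) m (p e B : nat) s :
  (1 < n)%N -> good_form f al -> prime p -> solution_list n f m s ->
  (forall a b c d t, `|a * d - b * c| = (p ^ e.+1)%:Z ->
     solution_list n (act n f a b c d) m t -> (size t <= B)%N) ->
  (size s <= (p ^ e.+1 + p ^ e) * B)%N.
Proof.
move=> n1 gf pp [us ss np] hB; set N := (p ^ e.+1)%N.
have N0 : (0 < N)%N by rewrite expn_gt0 prime_gt0.
pose I : finType := ('I_N + 'I_(p ^ e))%type.
pose mat (i : I) : int * int * int * int :=
  match i with inl t => (N%:Z, t%:Z, 0, 1) | inr t => (0, 1, N%:Z, (p * t)%:Z) end.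
have /choice[c hc] (x : int * int) : exists i : I, coprimez x.1 x.2 -> exists y : int * int,
   x = ((mat i).1.1.1 * y.1 + (mat i).1.1.2 * y.2, (mat i).1.2 * y.1 + (mat i).2 * y.2).
  have [cx|cx] := boolP (coprimez x.1 x.2); last by exists (inl (Ordinal N0)).
  have [[t [u h]]|[t [u h]]] := prime_pow_cover e pp cx.
    exists (inl t) => _; exists (u, x.2) => /=.
    by rewrite mul0r mul1r add0r -h -surjective_pairing.
  exists (inr t) => _; exists (u, x.1) => /=.
  by rewrite mul0r mul1r add0r -h -surjective_pairing.
rewrite (size_classes c).
have -> : (N + p ^ e = #|I|)%N by rewrite card_sum !card_ord.
rewrite -sum_nat_const; apply: leq_sum => i _.
set si := [seq x <- s | _].
have d0 : `|(mat i).1.1.1 * (mat i).2 - (mat i).1.1.2 * (mat i).1.2| = N%:Z.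
  by case: i {si} => t /=; rewrite ?mulr1 ?mulr0 ?mul0r ?mul1r ?subr0 ?sub0r ?normrN.
have d1 : (mat i).1.1.1 * (mat i).2 - (mat i).1.1.2 * (mat i).1.2 != 0.
  by rewrite -normr_gt0 d0 ltz_nat.
have ssi : solution_list n f m si.
  split; first exact: filter_uniq.
    by move=> x; rewrite mem_filter => /andP[_ /ss].
  by move=> x y; rewrite !mem_filter => /andP[_ xs] /andP[_ ys]; exact: np.
have [|t' <- st'] := pull_list n1 gf d1 ssi; last exact: hB st'.
move=> x; rewrite mem_filter => /andP[/eqP <- xs].
by apply: hc; have [] := ss x xs.
Qed.

(** * Numerical estimates *)

Lemma expR_exp8_le (R : realType) (x r r' : R) :
  expR x <= r -> r ^+ 8 <= r' -> expR (8 * x) <= r'.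
Proof.
move=> h1; apply: le_trans; rewrite expRM_natl lerXn2r ?nnegrE ?expR_ge0 //.
exact: le_trans (expR_ge0 _) h1.
Qed.

(* exp 1 <= (512/511)^512, evaluated by repeated powering. *)
Lemma expR1_le (R : realType) : expR 1 <= 1089 / 400 :> R.
Proof.
have h0 : expR (1 / 512) <= 512 / 511 :> R.
  rewrite -[512 / 511]invf_div -[1 / 512]opprK expRN lef_pV2 ?posrE ?expR_gt0 ?divr_gt0 //.
  by apply: le_trans (expR_ge1Dx _); lra.
have h1 : expR (1 / 64) <= 1031 / 1015 :> R.
  by have -> : 1 / 64 = 8 * (1 / 512) :> R; [lra | apply: expR_exp8_le h0 _; lra].
have h2 : expR (1 / 8) <= 17 / 15 :> R.
  by have -> : 1 / 8 = 8 * (1 / 64) :> R; [lra | apply: expR_exp8_le h1 _; lra].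
by have -> : 1 = 8 * (1 / 8) :> R; [lra | apply: expR_exp8_le h2 _; lra].
Qed.

Lemma ln_ge_of_exp (R : realType) (k : nat) (x : R) :
  (1089 / 400) ^+ k <= x -> k%:R <= ln x.
Proof.
move=> h; rewrite -ler_expR lnK; last first.
  by rewrite posrE; apply: lt_le_trans h; apply: exprn_gt0; lra.
apply: le_trans h; rewrite -[k%:R]mulr1 expRM_natl lerXn2r ?nnegrE ?expR_ge0 //; first by lra.
exact: expR1_le.
Qed.

Lemma ln_le_pow (R : realType) (a b : nat) (x y : R) :
  0 < x -> 0 < y -> x ^+ a <= y ^+ b -> a%:R * ln x <= b%:R * ln y.
Proof.
move=> x0 y0 h; rewrite !mulr_natl.
by rewrite -!lnXn // ler_ln ?posrE ?exprn_gt0.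
Qed.

(** The condition on Q is the square of 2 c m Q^(n - 2) <= N^(n (n - 1) / 2), c = [gapc], and gives
    the discriminant condition for every subform because [rdisc f al] is at least 1. The two
    conditions on B match the outcomes of [subform_count]; the second compares with B + 1 because
    counts are integers. *)
Lemma covered_count (R : realType) n (f : {poly int}) (al : 'I_n -> R[i]) (m p e B : nat)
    (Q C : R) s :
  (2 < n)%N -> good_form f al -> (0 < m)%N -> prime p -> 1 <= Q ->
  4 ^+ n * n.-1%:R ^+ n.-1 * m%:R ^+ 2 * (Q ^+ n.-2) ^+ 2 <= (p ^ e.+1)%:R ^+ (n * n.-1) ->
  thueL R n <= ln Q -> 1 + dltB R n <= C ->
  C * ln (11 / 10 * m%:R * 3 ^+ n) + dltB R n * ln Q <=
    C * (1 - dltA R n / n.-2%:R) * ln Q ->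
  (n * ((idxA n).+1 + thueK n) <= B)%N ->
  n%:R * ((idxB n + thueK n)%:R + 1 + C) + 1 < B.+1%:R ->
  solution_list n f m%:Z s -> (size s <= (p ^ e.+1 + p ^ e) * B)%N.
Proof.
move=> n2 gf m0 pp Q1 hQ hL C1 star hA hB ss; have n1 := ltnW n2.
apply: (cover_count n1 gf pp ss) => a b c d t dN st.
have d0 : a * d - b * c != 0 by rewrite -normr_gt0 dN ltz_nat expn_gt0 prime_gt0.
have gf' : good_form (act n f a b c d) (actr al a b c d) by have [] := act_good n1 gf d0.
have Q0 : 0 <= Q by exact: le_trans ler01 Q1.
have hQ' : 2 * gapc R n * (m%:Z)%:~R * Q ^+ n.-2 <= rdisc (act n f a b c d) (actr al a b c d).
  rewrite -(@ler_pXn2r _ 2) ?nnegrE ?rdisc_ge0 //; last first.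
    by rewrite !mulr_ge0 ?exprn_ge0 ?ler0z ?sqrtr_ge0.
  rewrite (rdisc_act_sqr n1 gf d0) dN -[leLHS]mulr1.
  apply: ler_pM => //; first by rewrite exprn_even_ge0.
    rewrite -[(p ^ e.+1)%:Z%:~R]/((p ^ e.+1)%:R : R); apply: le_trans hQ.
    rewrite /gapc !exprMn sqr_sqrtr ?exprn_ge0 // -exprM -[(m%:Z)%:~R]/(m%:R : R).
    have -> : 4 ^+ n = 2 ^+ 2 * 2 ^+ (n.-1 * 2) :> R.
      rewrite -exprD -{1}[n]prednK ?(ltn_trans _ n2) //.
      by have -> : 4 = 2 ^+ 2 :> R; [by rewrite -natrX | rewrite -exprM; congr (_ ^+ _); lia].
    by rewrite [2 ^+ (_ * 2)]exprM !mulrA.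
  by apply: exprn_ege1; exact: rdisc_ge1 gf.1.
have mz : 0 < m%:Z by rewrite ltz_nat.
have [h|h] := subform_count n2 gf' mz Q1 hQ' hL C1 star st.
  exact: leq_trans h hA.
by rewrite -ltnS -(ltr_nat R); exact: le_lt_trans hB.
Qed.

Lemma exists_pow2 m : (0 < m)%N ->
  exists e, (8 * m.+1 <= 2 ^ e.+1)%N /\ (2 ^ e.+1 <= 16 * m)%N.
Proof.
move=> m0.
have := @up_log_bounds 2 (8 * m.+1) isT; case/(_ _)/andP; first by lia.
set k := up_log 2 (8 * m.+1) => h1 h2.
(* Once k >= 4, the number 2^(k - 1) is a multiple of 8 below 8 (m + 1), hence at most 8 m. *)
have k4 : (4 <= k)%N.
  rewrite leqNgt; apply/negP => k4.
  have : (2 ^ k <= 2 ^ 3)%N by rewrite leq_exp2l.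
  by move: h2 m0; clear; lia.
exists k.-1; rewrite prednK ?(leq_trans _ k4) //; split => //.
have kE : (2 ^ k = 16 * 2 ^ (k - 4))%N by rewrite -[16%N]/(2 ^ 4)%N -expnD subnKC.
have kE' : (2 ^ k = 2 * 2 ^ k.-1)%N by rewrite -expnS prednK ?(leq_trans _ k4).
by move: h1 kE kE'; clear; lia.
Qed.


(** AM-GM for M / 2, M / 2 and 1; equality at M = 2 gives the square factor. *)
Lemma cube_bound (R : realType) (M : R) : 1 <= M -> 27 / 4 * M ^+ 2 <= (M + 1) ^+ 3.
Proof.
move=> M1; rewrite -subr_ge0; have -> : (M + 1) ^+ 3 - 27 / 4 * M ^+ 2 = (M - 2) ^+ 2 * (M + 1 / 4) by field.
by rewrite mulr_ge0 ?sqr_ge0 //; lra.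
Qed.

Lemma square_bound (R : realType) (M : R) : 1 <= M -> 4 * M <= (M + 1) ^+ 2.
Proof.
move=> M1; by rewrite -subr_ge0 (_ : _ - _ = (M - 1) ^+ 2) ?sqr_ge0 //; ring.
Qed.

(** The Q that turns the condition of [covered_count] in degree 3 into an equality for the index 8
    (M + 1). *)
Definition Q3 (R : realType) (M : R) : R := 32 * (M + 1) ^+ 3 / M.

Lemma Q3_ge (R : realType) (M : R) : 1 <= M -> 256 <= Q3 M.
Proof.
move=> M1; rewrite /Q3 ler_pdivlMr; last by lra.
have : 2 * (4 * M) <= (M + 1) * (M + 1) ^+ 2 by apply: ler_pM; rewrite ?(square_bound M1) //; lra.
rewrite [(M + 1) ^+ 3]exprS; lra.
Qed.

Lemma Q3_cost (R : realType) (M : R) : 1 <= M -> 4%:R * ln (11 / 10 * M * 3 ^+ 3) <= 3%:R * ln (Q3 M).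
Proof.
move=> M1; have q := Q3_ge M1; apply: ln_le_pow; [by rewrite !mulr_gt0 ?divr_gt0 ?exprn_gt0; lra | by lra |].
have -> : Q3 M ^+ 3 = (32 ^+ 3 * ((M + 1) ^+ 3 * ((M + 1) ^+ 3) ^+ 2)) / M ^+ 3 by rewrite /Q3; field; lra.
rewrite ler_pdivlMr; last by rewrite exprn_gt0; lra.
have h1 : M ^+ 3 <= (M + 1) ^+ 3 by rewrite lerXn2r ?nnegrE; lra.
have h2 : (27 / 4 * M ^+ 2) ^+ 2 <= ((M + 1) ^+ 3) ^+ 2.
  by rewrite lerXn2r ?nnegrE ?(cube_bound M1) ?mulr_ge0 ?exprn_ge0 //; lra.
have h3 : M ^+ 3 * (27 / 4 * M ^+ 2) ^+ 2 <= (M + 1) ^+ 3 * ((M + 1) ^+ 3) ^+ 2.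
  by apply: ler_pM => //; rewrite ?exprn_ge0 // ?mulr_ge0 ?exprn_ge0 //; lra.
have M7 : 0 <= M ^+ 7 by rewrite exprn_ge0; lra.
have -> : (11 / 10 * M * 3 ^+ 3) ^+ 4 * M ^+ 3 = (11 / 10 * 3 ^+ 3) ^+ 4 * M ^+ 7 by ring.
apply: le_trans (_ : 32 ^+ 3 * (M ^+ 3 * (27 / 4 * M ^+ 2) ^+ 2) <= _); last by rewrite ler_pM2l ?exprn_gt0.
have -> : 32 ^+ 3 * (M ^+ 3 * (27 / 4 * M ^+ 2) ^+ 2) = 32 ^+ 3 * (27 / 4) ^+ 2 * M ^+ 7 by ring.
by apply: ler_wpM2r => //; lra.
Qed.

(** The square of Q in degree 4. The index 8 (M + 1) allows the factor 8^6 / sqrt (4^4 * 27), about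
    3153, here rounded down. *)
Definition W4 (R : realType) (M : R) : R := 3120 * (M + 1) ^+ 6 / M.

Lemma sixth_bound (R : realType) (M : R) : 1 <= M -> 64 * M ^+ 3 <= (M + 1) ^+ 6.
Proof.
move=> M1; have -> : 64 * M ^+ 3 = (4 * M) ^+ 3 by ring.
have -> : (M + 1) ^+ 6 = ((M + 1) ^+ 2) ^+ 3 by rewrite -exprM.
by rewrite lerXn2r ?nnegrE ?(square_bound M1) ?sqr_ge0 //; lra.
Qed.

Lemma W4_ge (R : realType) (M : R) : 1 <= M -> (3120 * 64) <= W4 M.
Proof.
move=> M1; rewrite /W4 ler_pdivlMr; last by lra.
have h : M <= M ^+ 3 by rewrite exprS ler_peMr ?exprn_ege1 //; lra.
have := sixth_bound M1; lra.
Qed.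

Lemma W4_cost (R : realType) (M : R) : 1 <= M -> 10%:R * ln (11 / 10 * M * 3 ^+ 4) <= 4%:R * ln (W4 M).
Proof.
move=> M1; have q := W4_ge M1; apply: ln_le_pow; [by rewrite !mulr_gt0 ?divr_gt0 ?exprn_gt0; lra | by lra |].
have -> : W4 M ^+ 4 = (3120 ^+ 4 * (((M + 1) ^+ 2) ^+ 10 * (M + 1) ^+ 4)) / M ^+ 4 by rewrite /W4; field; lra.
rewrite ler_pdivlMr; last by rewrite exprn_gt0; lra.
have h1 : M ^+ 4 <= (M + 1) ^+ 4 by rewrite lerXn2r ?nnegrE; lra.
have h2 : (4 * M) ^+ 10 <= ((M + 1) ^+ 2) ^+ 10.
  by rewrite lerXn2r ?nnegrE ?(square_bound M1) ?sqr_ge0 //; lra.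
have h3 : (4 * M) ^+ 10 * M ^+ 4 <= ((M + 1) ^+ 2) ^+ 10 * (M + 1) ^+ 4.
  by apply: ler_pM => //; rewrite ?exprn_ge0 //; lra.
have M14 : 0 <= M ^+ 14 by rewrite exprn_ge0; lra.
have -> : (11 / 10 * M * 3 ^+ 4) ^+ 10 * M ^+ 4 = (11 / 10 * 3 ^+ 4) ^+ 10 * M ^+ 14 by ring.
apply: le_trans (_ : 3120 ^+ 4 * ((4 * M) ^+ 10 * M ^+ 4) <= _); last by rewrite ler_pM2l ?exprn_gt0.
have -> : 3120 ^+ 4 * ((4 * M) ^+ 10 * M ^+ 4) = 3120 ^+ 4 * 4 ^+ 10 * M ^+ 14 by ring.
by apply: ler_wpM2r => //; lra.
Qed.

Lemma half_pow2_le (R : realType) e m : (2 ^ e.+1 <= 16 * m)%N ->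
  (2 ^ e.+1 + 2 ^ e)%:R <= 24 * m%:R :> R.
Proof. by move=> h; rewrite -natrM ler_nat; move: h; rewrite expnS; lia. Qed.

Lemma cover_size_le (R : realType) e m B k (c : R) : (2 ^ e.+1 <= 16 * m)%N ->
  (k <= (2 ^ e.+1 + 2 ^ e) * B)%N -> 24 * m%:R * B%:R <= c -> k%:R <= c.
Proof.
move=> h1 h2; apply: le_trans; apply: le_trans (_ : ((2 ^ e.+1 + 2 ^ e) * B)%:R <= _).
  by rewrite ler_nat.
by rewrite natrM; apply: ler_wpM2r => //; exact: half_pow2_le.
Qed.

Lemma pow2_ge (R : realType) e m : (8 * m.+1 <= 2 ^ e.+1)%N ->
  8 * (m%:R + 1) <= (2 ^ e.+1)%:R :> R.
Proof. by move=> h; rewrite natr1 -natrM ler_nat. Qed.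

Lemma cube_rootK (R : realType) (a : R) : 0 <= a -> (a ^+ 3) `^ (1 / 3) = a.
Proof.
move=> a0; rewrite -[a ^+ 3](powR_mulrn 3 a0) -powRrM.
by have -> : 3%:R * (1 / 3) = 1 :> R; [lra | rewrite powRr1].
Qed.

Lemma count3 (R : realType) (f : {poly int}) (al : 'I_3 -> R[i]) (m p2 : nat) s :
  good_form f al -> (0 < m)%N ->
  m%:R `^ (4 / 3%:R) * (7 / 2) ^+ 2 * 3%:R `^ (2 / (3%:R - 1)) <= p2%:R :> R ->
  solution_list 3 f m%:Z s ->
  (size s)%:R <= (p2%:R + 1) * (9 * 3%:R + 4 / (3%:R - 1)) :> R.
Proof.
have e31 : 3%:R - 1 = 2 :> R by lra.
rewrite e31 => gf m0 hp ss.
have M1 : 1 <= m%:R :> R by rewrite ler1n.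
have [e [e1 e2]] := exists_pow2 m0.
have q256 := Q3_ge M1.
have hQ : 4 ^+ 3 * 2%:R ^+ 2 * m%:R ^+ 2 * (Q3 m%:R ^+ 1) ^+ 2 <= (2 ^ e.+1)%:R ^+ (3 * 2) :> R.
  have -> : 4 ^+ 3 * 2%:R ^+ 2 * m%:R ^+ 2 * (Q3 m%:R ^+ 1) ^+ 2 = (8 * (m%:R + 1)) ^+ (3 * 2) :> R.
    by rewrite /Q3; field; rewrite gt_eqF // (lt_le_trans ltr01).
  rewrite lerXn2r ?nnegrE ?pow2_ge //; by move: M1; clear; lra.
have hL : thueL R 3 <= ln (Q3 m%:R).
  rewrite /thueL /=; have : 11%:R <= ln (Q3 (m%:R : R) ^+ 2).
    apply: ln_ge_of_exp; apply: le_trans (_ : 256 ^+ 2 <= _); first by lra.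
    by rewrite lerXn2r ?nnegrE //; move: q256; clear; lra.
  by rewrite lnXn ?(lt_le_trans _ q256) // mulr2n; clear; lra.
have Q1 : 1 <= Q3 (m%:R : R) by move: q256; clear; lra.
have n3 : (2 < 3)%N by [].
have cost := Q3_cost M1.
have hp' : 147 / 4 * m%:R `^ (4 / 3) <= p2%:R :> R.
  have e3 : 3 `^ (2 / 2) = 3 :> R by rewrite divff ?pnatr_eq0 // powRr1.
  by move: hp; rewrite e3; lra.
have q0 : 0 < ln (Q3 (m%:R : R)) by apply: lt_le_trans hL; rewrite /thueL /=; lra.
(* For m = 1 the bound is 45 per sublattice: p2 >= 37 and 24 * 45 <= 38 * 29. For m >= 2 the gain
   m^(1/3) >= 5 / 4 leaves room for 55, obtained with C = 5. *)
have [m1|m2] := leqP m 1.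
  have mE : m = 1%N by apply/eqP; rewrite eqn_leq m1 m0.
  have := @covered_count R 3 f al m 2 e 45 (Q3 m%:R) (19 / 10) s n3 gf m0 isT Q1 hQ hL.
  move=> /(_ _ _ _ _ ss) H.
  apply: (cover_size_le e2 (H _ _ _ _)).
  - by rewrite /dltB /=; lra.
  - have c2 : 8%:R * ln (11 / 10 * m%:R * 3 ^+ 3) <= 5%:R * ln (Q3 (m%:R : R)).
      apply: ln_le_pow; [by rewrite mE; lra | by lra |].
      apply: le_trans (_ : 256 ^+ 5 <= _); first by rewrite mE; lra.
      by rewrite lerXn2r ?nnegrE //; move: q256; clear; lra.
    rewrite /dltB /dltA /= divr1; lra.
  - by [].
  - by rewrite /idxB /thueK /=; lra.
  rewrite mE.
  have : (37 <= p2)%N.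
    rewrite leqNgt; apply/negP => lt; move: hp'; rewrite mE powR1 mulr1.
    have : p2%:R <= 36%:R :> R by rewrite ler_nat.
    by lra.
  by rewrite -(ler_nat R); lra.
have := @covered_count R 3 f al m 2 e 55 (Q3 m%:R) 5 s n3 gf m0 isT Q1 hQ hL.
move=> /(_ _ _ _ _ ss) H.
apply: (cover_size_le e2 (H _ _ _ _)).
- by rewrite /dltB /=; lra.
- by rewrite /dltB /dltA /= divr1; lra.
- by [].
- by rewrite /idxB /thueK /=; lra.
have h43 : 5 / 4 * m%:R <= m%:R `^ (4 / 3) :> R.
  have -> : 4 / 3 = 1 + 1 / 3 :> R by lra.
  rewrite powRD; last by rewrite pnatr_eq0 -lt0n m0 implybT.
  rewrite powRr1 // mulrC; apply: ler_wpM2l => //.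
  rewrite -[5 / 4]cube_rootK; last by lra.
  apply: ge0_ler_powR; rewrite ?nnegrE //; first by lra.
    by rewrite exprn_ge0; lra.
  by apply: le_trans (_ : 2%:R <= _); [lra | rewrite ler_nat].
by move: h43 hp' M1; clear; lra.
Qed.

Lemma count4 (R : realType) (f : {poly int}) (al : 'I_4 -> R[i]) (m p2 : nat) s :
  good_form f al -> (0 < m)%N ->
  m%:R `^ (4 / 4%:R) * (7 / 2) ^+ 2 * 4%:R `^ (2 / (4%:R - 1)) <= p2%:R :> R ->
  solution_list 4 f m%:Z s ->
  (size s)%:R <= (p2%:R + 1) * (9 * 4%:R + 4 / (4%:R - 1)) :> R.
Proof.
have e41 : 4%:R - 1 = 3 :> R by lra.
rewrite e41 => gf m0 hp ss.
have M1 : 1 <= m%:R :> R by rewrite ler1n.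
have [e [e1 e2]] := exists_pow2 m0.
have w := W4_ge M1; pose Q := Num.sqrt (W4 (m%:R : R)).
have w0 : 0 < W4 (m%:R : R) by apply: lt_le_trans w; lra.
have Q2 : Q ^+ 2 = W4 m%:R by rewrite sqr_sqrtr // ltW.
have Q0 : 0 < Q by rewrite sqrtr_gt0.
have lQ : ln (W4 m%:R) = 2 * ln Q by rewrite -Q2 lnXn // mulr_natl.
have hL : thueL R 4 <= ln Q.
  rewrite /thueL /=; have : 12%:R <= ln (W4 (m%:R : R)).
    by apply: ln_ge_of_exp; apply: le_trans w; lra.
  by rewrite lQ; lra.
have Q1 : 1 <= Q.
  by rewrite -ler_ln ?posrE // ln1; apply: le_trans hL; rewrite /thueL /=; lra.
have hQ : 4 ^+ 4 * 3%:R ^+ 3 * m%:R ^+ 2 * (Q ^+ 2) ^+ 2 <= (2 ^ e.+1)%:R ^+ (4 * 3) :> R.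
  apply: le_trans (_ : (8 * (m%:R + 1)) ^+ (4 * 3) <= _); last first.
    by rewrite lerXn2r ?nnegrE ?pow2_ge //; move: M1; clear; lra.
  rewrite Q2.
  have -> : 4 ^+ 4 * 3%:R ^+ 3 * m%:R ^+ 2 * W4 m%:R ^+ 2 =
     4 ^+ 4 * 3 ^+ 3 * 3120 ^+ 2 * (m%:R + 1) ^+ 12 :> R.
    by rewrite /W4; field; rewrite gt_eqF // (lt_le_trans ltr01).
  have -> : (8 * (m%:R + 1)) ^+ (4 * 3) = 8 ^+ 12 * (m%:R + 1) ^+ 12 :> R by ring.
  by apply: ler_wpM2r; [apply: exprn_ge0; move: M1; clear; lra | lra].
have cost := W4_cost M1; rewrite lQ in cost.
have q0 : 0 < ln Q by apply: lt_le_trans hL; rewrite /thueL /=; lra.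
have n4 : (2 < 4)%N by [].
have := @covered_count R 4 f al m 2 e 48 Q (11 / 10) s n4 gf m0 isT Q1 hQ hL.
move=> /(_ _ _ _ _ ss) H.
apply: (cover_size_le e2 (H _ _ _ _)).
- by rewrite /dltB /=; lra.
- by rewrite /dltB /dltA /=; lra.
- by [].
- by rewrite /idxB /thueK /=; lra.
(* Three decimals matter: 24 * 48 = 1152 is compared with 12.25 * 2.519 * (36 + 4 / 3), about
   1152.02. *)
have h4 : 2519 / 1000 <= 4 `^ (2 / 3) :> R.
  rewrite -[2519 / 1000]cube_rootK; last by lra.
  have -> : 4 `^ (2 / 3) = (4 ^+ 2) `^ (1 / 3) :> R.
    rewrite -[4 ^+ 2 in RHS](powR_mulrn 2) // -powRrM; congr (_ `^ _); lra.
  apply: ge0_ler_powR; rewrite ?nnegrE ?exprn_ge0 //; by lra.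
have hm : m%:R `^ (4 / 4) = m%:R :> R by rewrite divff ?pnatr_eq0 // powRr1.
have : m%:R * (7 / 2) ^+ 2 * (2519 / 1000) <= p2%:R :> R.
  apply: le_trans hp; rewrite hm; apply: ler_wpM2l => //.
  by apply: mulr_ge0 => //; lra.
by move: M1; clear; lra.
Qed.

Lemma powR_exp (R : realType) (a x : R) (k j : nat) :
  0 <= a -> x * k%:R = j%:R -> (a `^ x) ^+ k = a ^+ j.
Proof. by move=> a0 h; rewrite -powR_mulrn ?powR_ge0 // -powRrM h powR_mulrn. Qed.

Lemma pow_split (A : comNzRingType) (c z M : A) i j :
  ((c * z ^+ i * M ^+ 2) ^+ j) ^+ 2 = (c ^+ j) ^+ 2 * z ^+ (i * j * 2) * M ^+ (2 * j * 2).
Proof. by rewrite -[LHS]exprM exprMn exprMn -!exprM !mulnA. Qed.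

Lemma exponent_split k (n := k.+4.+1) :
  (4 * n.-1 = 2 * n.-2 * 2 + (2 + 2))%N /\ (2 * (n * n.-1) = n.+1 * n.-2 * 2 + 4)%N.
Proof. by rewrite /n /=; split; lia. Qed.

(** The index is p2. Its lower bound raised to n (n - 1) is m^(4 (n - 1)) (7 / 2)^(2 n (n - 1)) n^(2
    n). Apart from the m^2 already present, Q uses up all of this but m^2 (7 / 2)^4 n^(2 n), and c
    is limited by what remains. With C = 9 / 5 both outcomes stay within 9 n. *)
Lemma count_ge5 (R : realType) k (n := k.+4.+1) (f : {poly int}) (al : 'I_n -> R[i])
    (m p2 : nat) (c : R) (Q := c * (7 / 2) ^+ n.+1 * m%:R ^+ 2) s :
  good_form f al -> (0 < m)%N -> prime p2 ->
  m%:R `^ (4 / n%:R) * (7 / 2) ^+ 2 * n%:R `^ (2 / (n%:R - 1)) <= p2%:R :> R ->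
  1 <= c -> 4 ^+ n * n.-1%:R ^+ n.-1 * (c ^+ n.-2) ^+ 2 <= (7 / 2) ^+ 4 * (n%:R ^+ n) ^+ 2 ->
  9 / 5 * ln (11 / 10 * m%:R * 3 ^+ n) + dltB R n * ln Q <=
    9 / 5 * (1 - dltA R n / n.-2%:R) * ln Q ->
  solution_list n f m%:Z s ->
  (size s)%:R <= (p2%:R + 1) * (9 * n%:R + 4 / (n%:R - 1)) :> R.
Proof.
move=> gf m0 pp hp c1 hc star ss.
have M1 : 1 <= m%:R :> R by rewrite ler1n.
have M0 : 0 <= m%:R :> R by [].
have n0 : n%:R != 0 :> R by rewrite pnatr_eq0.
have n1E : n%:R - 1 = n.-1%:R :> R by rewrite /n /= -[k.+4.+1%:R]natr1 addrK.
have n10 : n.-1%:R != 0 :> R by rewrite pnatr_eq0.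
have Q72 : (7 / 2) ^+ n.+1 <= Q.
  rewrite /Q -mulrA mulrCA ler_peMr ?exprn_ge0 //; first by lra.
  by apply: mulr_ege1 => //; exact: exprn_ege1.
have Q1 : 1 <= Q by apply: le_trans Q72; apply: exprn_ege1; lra.
have Q0 : 0 < Q by exact: lt_le_trans Q1.
have hL : thueL R n <= ln Q.
  rewrite /thueL /n /= -/n; have : (5 * n)%:R <= ln (Q ^+ 4).
    apply: ln_ge_of_exp; apply: le_trans (_ : ((7 / 2) ^+ n.+1) ^+ 4 <= _); last first.
      by rewrite lerXn2r ?nnegrE //; [apply: exprn_ge0; lra | exact: ltW].
    rewrite exprM [leRHS]exprAC; apply: le_trans (_ : ((7 / 2) ^+ 4) ^+ n <= _).
      by rewrite lerXn2r ?nnegrE ?exprn_ge0 //; lra.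
    by apply: ler_weXn2l => //; apply: exprn_ege1; lra.
  by rewrite lnXn // -mulr_natl natrM; lra.
have hQ : 4 ^+ n * n.-1%:R ^+ n.-1 * m%:R ^+ 2 * (Q ^+ n.-2) ^+ 2 <= (p2 ^ 1)%:R ^+ (n * n.-1) :> R.
  rewrite expn1; set b := _ * _ * _ in hp.
  have b0 : 0 <= b.
    by apply: mulr_ge0; [apply: mulr_ge0; [exact: powR_ge0 | apply: exprn_ge0; lra] | exact: powR_ge0].
  apply: le_trans (_ : b ^+ (n * n.-1) <= _); last by rewrite lerXn2r ?nnegrE.
  have -> : b ^+ (n * n.-1) = m%:R ^+ (4 * n.-1) * (7 / 2) ^+ (2 * (n * n.-1)) * n%:R ^+ (2 * n).
    rewrite /b exprMn exprMn -[((7 / 2) ^+ 2) ^+ _]exprM; congr (_ * _ * _).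
      by apply: powR_exp => //; rewrite !natrM; field.
    by apply: powR_exp => //; rewrite n1E !natrM; field.
  have -> : m%:R ^+ (4 * n.-1) * (7 / 2) ^+ (2 * (n * n.-1)) * n%:R ^+ (2 * n) =
    ((7 / 2) ^+ (n.+1 * n.-2 * 2) * m%:R ^+ (2 * n.-2 * 2) * m%:R ^+ 2) *
    (m%:R ^+ 2 * ((7 / 2) ^+ 4 * (n%:R ^+ n) ^+ 2)) :> R.
    have [-> ->] : (4 * n.-1 = 2 * n.-2 * 2 + (2 + 2))%N /\
        (2 * (n * n.-1) = n.+1 * n.-2 * 2 + 4)%N := exponent_split k.
    by rewrite [(2 * n)%N]mulnC -[(n%:R ^+ n) ^+ 2]exprM !exprD; ring.
  have -> : 4 ^+ n * n.-1%:R ^+ n.-1 * m%:R ^+ 2 * (Q ^+ n.-2) ^+ 2 =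
    ((7 / 2) ^+ (n.+1 * n.-2 * 2) * m%:R ^+ (2 * n.-2 * 2) * m%:R ^+ 2) *
    (4 ^+ n * n.-1%:R ^+ n.-1 * (c ^+ n.-2) ^+ 2).
    have -> : (Q ^+ n.-2) ^+ 2 =
       (c ^+ n.-2) ^+ 2 * (7 / 2) ^+ (n.+1 * n.-2 * 2) * m%:R ^+ (2 * n.-2 * 2).
      exact: pow_split.
    by move: (_ ^+ (n.+1 * n.-2 * 2)) (_ ^+ (2 * n.-2 * 2)) ((_ ^+ n.-2) ^+ 2) => z1 z2 z3; ring.
  have z0 : 0 <= 7 / 2 :> R by lra.
  apply: ler_wpM2l; first exact: (mulr_ge0 (mulr_ge0 (exprn_ge0 _ z0) (exprn_ge0 _ M0)) (exprn_ge0 _ M0)).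
  apply: le_trans hc _; rewrite ler_peMl ?exprn_ege1 //.
  exact: (mulr_ge0 (exprn_ge0 _ z0) (sqr_ge0 _)).
have n2 : (2 < n)%N by [].
have := @covered_count R n f al m p2 0 (9 * n) Q (9 / 5) s n2 gf m0 pp Q1 hQ hL.
move=> /(_ _ star _ _ ss) H.
have {H} : (size s <= (p2 ^ 1 + p2 ^ 0) * (9 * n))%N.
  apply: H.
  - by rewrite /dltB /n /=; case: ifP => _; lra.
  - by rewrite /idxA /thueK /n /= -/n mulnC leq_mul2r.
  have -> : (idxB n + thueK n)%:R = 6 :> R by [].
  rewrite -[(9 * n).+1%:R]natr1 natrM.
  by have : 0 < n%:R :> R by []; lra.
rewrite expn1 expn0 -(ler_nat R) natrM natrD natrM => /le_trans; apply.
apply: ler_wpM2l => //; first by rewrite addr_ge0.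
by rewrite lerDl divr_ge0 // n1E.
Qed.

Lemma count5 (R : realType) (f : {poly int}) (al : 'I_5 -> R[i]) (m p2 : nat) s :
  good_form f al -> (0 < m)%N -> prime p2 ->
  m%:R `^ (4 / 5%:R) * (7 / 2) ^+ 2 * 5%:R `^ (2 / (5%:R - 1)) <= p2%:R :> R ->
  solution_list 5 f m%:Z s ->
  (size s)%:R <= (p2%:R + 1) * (9 * 5%:R + 4 / (5%:R - 1)) :> R.
Proof.
move=> gf m0 pp hp ss.
have M1 : 1 <= m%:R :> R by rewrite ler1n.
(* In degree 5 the choice c = 4 is possible since 4^15 <= (7 / 2)^4 * 5^10. *)
apply: (@count_ge5 R 0 f al m p2 4 s) => //; first by lra.
  by rewrite /=; lra.
pose q : R := ln (4 * (7 / 2) ^+ 6 * m%:R ^+ 2); rewrite -/q; have q0 : 0 <= q.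
  apply: ln_ge0; rewrite mulr_ege1 ?exprn_ege1 //; lra.
have c : 3%:R * ln (11 / 10 * m%:R * 3 ^+ 5) <= 2%:R * q.
  apply: ln_le_pow; [by rewrite !mulr_gt0 ?exprn_gt0 //; lra | by rewrite !mulr_gt0 ?exprn_gt0 //; lra |].
  have M3 : m%:R ^+ 3 <= m%:R ^+ 4 :> R by rewrite ler_weXn2l.
  have M4 : 1 <= m%:R ^+ 4 :> R by exact: exprn_ege1.
  have -> : (11 / 10 * m%:R * 3 ^+ 5) ^+ 3 = (11 / 10 * 3 ^+ 5) ^+ 3 * m%:R ^+ 3 :> R by ring.
  have -> : (4 * (7 / 2) ^+ 6 * m%:R ^+ 2) ^+ 2 = (4 * (7 / 2) ^+ 6) ^+ 2 * m%:R ^+ 4 :> R by ring.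
  by apply: ler_pM => //; [lra | exact: exprn_ge0 | lra].
rewrite /dltB /dltA /=; lra.
Qed.

Lemma count6 (R : realType) k (n := k.+4.+2) (f : {poly int}) (al : 'I_n -> R[i]) (m p2 : nat) s :
  good_form f al -> (0 < m)%N -> prime p2 ->
  m%:R `^ (4 / n%:R) * (7 / 2) ^+ 2 * n%:R `^ (2 / (n%:R - 1)) <= p2%:R :> R ->
  solution_list n f m%:Z s ->
  (size s)%:R <= (p2%:R + 1) * (9 * n%:R + 4 / (n%:R - 1)) :> R.
Proof.
move=> gf m0 pp hp ss.
have M1 : 1 <= m%:R :> R by rewrite ler1n.
apply: (@count_ge5 R k.+1 f al m p2 1 s) => //.
  rewrite !expr1n mulr1 -/n.
  have h1 : 4 ^+ n <= n%:R ^+ n :> R by rewrite lerXn2r ?nnegrE // ler_nat.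
  have h2 : n.-1%:R ^+ n.-1 <= n%:R ^+ n :> R.
    apply: le_trans (_ : n%:R ^+ n.-1 <= _); first by rewrite lerXn2r ?nnegrE // ler_nat.
    by rewrite ler_weXn2l // ler1n.
  apply: le_trans (ler_pM _ _ h1 h2) _; rewrite ?exprn_ge0 // -expr2.
  by rewrite ler_peMl ?exprn_even_ge0 // exprn_ege1 //; lra.
rewrite !mul1r -/n; pose q : R := ln ((7 / 2) ^+ n.+1 * m%:R ^+ 2); rewrite -/q; have q0 : 0 <= q.
  apply: ln_ge0; rewrite mulr_ege1 ?exprn_ege1 //; lra.
have c : 10%:R * ln (11 / 10 * m%:R * 3 ^+ n) <= 9%:R * q.
  apply: ln_le_pow; [by rewrite mulr_gt0 ?exprn_gt0 //; lra | by rewrite mulr_gt0 ?exprn_gt0 //; lra |].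
  have M3 : m%:R ^+ 10 <= m%:R ^+ 18 :> R by rewrite ler_weXn2l.
  have -> : (11 / 10 * m%:R * 3 ^+ n) ^+ 10 = (11 / 10) ^+ 10 * (3 ^+ 10) ^+ n * m%:R ^+ 10 :> R.
    by rewrite [(3 ^+ 10) ^+ n]exprAC; move: (3 ^+ n) => t; ring.
  have -> : ((7 / 2) ^+ n.+1 * m%:R ^+ 2) ^+ 9 = (7 / 2) ^+ 9 * ((7 / 2) ^+ 9) ^+ n * m%:R ^+ 18 :> R.
    by rewrite [((7 / 2) ^+ 9) ^+ n]exprAC [(7 / 2) ^+ n.+1]exprS; move: ((7 / 2) ^+ n) => t; ring.
  have a0 : 0 <= (11 / 10) ^+ 10 :> R by apply: exprn_ge0; lra.
  have b0 : 0 <= (3 ^+ 10) ^+ n :> R by apply: exprn_ge0; exact: exprn_ge0.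
  have ab : (11 / 10) ^+ 10 <= (7 / 2) ^+ 9 :> R by lra.
  have bb : (3 ^+ 10) ^+ n <= ((7 / 2) ^+ 9) ^+ n :> R.
    by rewrite lerXn2r ?nnegrE //; [apply: exprn_ge0 | apply: exprn_ge0; lra | lra].
  apply: (ler_pM (mulr_ge0 a0 b0) _ (ler_pM a0 b0 ab bb) M3).
  exact: exprn_ge0.
have d : dltA R n / n.-2%:R <= 1 / 125.
  rewrite /dltA /n /= ler_pdivrMr //.
  have : 4%:R <= k.+4%:R :> R by rewrite ler_nat.
  lra.
have h : q * (1 - 1 / 125) <= q * (1 - dltA R n / n.-2%:R) by apply: ler_wpM2l => //; lra.
have dB : dltB R n = 4 / 25 by [].
rewrite dB; clearbody q; move: (dltA R n / n.-2%:R) (ln _) c h q0 => t l; clear; lra.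
Qed.

Lemma count_all (R : realType) n (f : {poly int}) (al : 'I_n -> R[i]) (m p2 : nat) s :
  (2 < n)%N -> good_form f al -> (0 < m)%N -> prime p2 ->
  m%:R `^ (4 / n%:R) * (7 / 2) ^+ 2 * n%:R `^ (2 / (n%:R - 1)) <= p2%:R :> R ->
  solution_list n f m%:Z s ->
  (size s)%:R <= (p2%:R + 1) * (9 * n%:R + 4 / (n%:R - 1)) :> R.
Proof.
move=> n2; case/degreeP: n2 al => [|||k] al gf m0 pp hp ss.
- exact: (count3 gf m0 hp ss).
- exact: (count4 gf m0 hp ss).
- exact: (count5 gf m0 pp hp ss).
exact: (count6 gf m0 pp hp ss).
Qed.

(** * Dehomogenization *)

From mathcomp Require Import finmap.
From mathcomp Require Import all_classical all_reals all_analysis.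
From mathcomp Require Import -(notations) mpoly.

Section Hom.
Variable A : comNzRingType.
Implicit Types (g h : {poly A}) (x y : A).

Lemma homD n g h x y : hom n (g + h) x y = hom n g x y + hom n h x y.
Proof. by rewrite -big_split /=; apply: eq_bigr => i _; rewrite coefD !mulrDl. Qed.

Lemma hom_mulX n g x y : (size g <= n.+1)%N -> hom n.+1 (g * 'X) x y = x * hom n g x y.
Proof.
move=> sg; have := @hom_mulXsubC A n g 0 x y sg.
by rewrite polyC0 subr0 mul0r subr0 mulrC.
Qed.

Lemma hom_pad e d h x y : (size h <= d.+1)%N -> hom (e + d) h x y = y ^+ e * hom d h x y.
Proof.
move=> sh; elim: e => [|e IH]; first by rewrite mul1r.
rewrite addSn exprS -mulrA -IH {1}/hom big_ord_recr /= nth_default ?mul0r ?addr0; last first.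
  by apply: leq_trans sh _; rewrite ltnS leq_addl.
rewrite mulr_sumr; apply: eq_bigr => i _; rewrite /= subSn ?exprS; last by rewrite -ltnS.
by rewrite mulrCA.
Qed.

Lemma homM d1 d2 g h x y : (size g <= d1.+1)%N -> (size h <= d2.+1)%N ->
  hom (d1 + d2) (g * h) x y = hom d1 g x y * hom d2 h x y.
Proof.
move=> + sh; elim/poly_ind: g d1 => [|g c IH] d1 sg.
  rewrite mul0r; have z n : hom n (0 : {poly A}) x y = 0.
    by apply: big1 => i _; rewrite coef0 !mul0r.
  by rewrite !z mul0r.
have cE d : hom d c%:P x y = c * y ^+ d.
  rewrite /hom big_ord_recl coefC /= expr0 mulr1 subn0 big1 ?addr0 // => i _.
  by rewrite coefC /= !mul0r.
case: d1 sg => [|d1] sg.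
  have g0 : g = 0.
    apply/eqP; rewrite -size_poly_eq0; move: sg; rewrite size_MXaddC.
    by case: eqP => [->|_] /=; rewrite ?size_poly0 // ltnS leqn0.
  by rewrite g0 mul0r add0r cE expr0 mulr1 mul_polyC homZ.
have sg' : (size g <= d1.+1)%N.
  move: sg; rewrite size_MXaddC; case: eqP => [->|_] /=; first by rewrite size_poly0.
  by rewrite ltnS.
have sgh : (size (g * h)%R <= (d1 + d2).+1)%N.
  by apply: leq_trans (size_polyMleq _ _) _; move: sg' sh; clear; lia.
rewrite mulrDl homD [g * 'X * h]mulrAC addSn hom_mulX // IH //.
rewrite homD hom_mulX // cE mulrDl mulrA; congr (_ + _).
by rewrite mul_polyC homZ -addSn hom_pad // mulrA.
Qed.

Lemma homXn n k x y : (k <= n)%N -> hom n 'X^k x y = x ^+ k * y ^+ (n - k).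
Proof.
move=> kn; have kn' : (k < n.+1)%N by [].
rewrite /hom (bigD1 (Ordinal kn')) //= coefXn eqxx mul1r big1 ?addr0 // => i ik.
by rewrite coefXn -val_eqE /= in ik *; rewrite (negPf ik) !mul0r.
Qed.

Lemma hom00 n (g : {poly A}) : (0 < n)%N -> hom n g 0 0 = 0.
Proof.
move=> n0; apply: big1 => i _; rewrite -mulrA -exprD subnKC ?expr0n ?gtn_eqF ?mulr0 //.
by rewrite -ltnS.
Qed.

End Hom.

Definition dehomog (F : {binary int}) : {poly int} :=
  \sum_(m <- msupp F) mcoeff m F *: 'X^(m ord0).

Lemma hom_dehomog (A : comNzRingType) (phi : {rmorphism int -> A}) n (F : {binary int}) x y :
  is_form n F ->
  hom n (map_poly phi (dehomog F)) x y =
  \sum_(m <- msupp F) phi (mcoeff m F) * (x ^+ m ord0 * y ^+ m ord_max).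
Proof.
move=> /dhomogP hF.
have mE m : m \in msupp F -> (m ord0 + m ord_max = n)%N.
  move=> mF; have := hF m mF; rewrite /= mdegE big_ord_recl big_ord1 => <-; congr (_ + m _)%N; exact: val_inj.
rewrite /dehomog rmorph_sum /= big_seq [RHS]big_seq.
have : forall s : seq (multinom 2), {subset s <= msupp F} ->
  hom n (\sum_(m <- s) map_poly phi (mcoeff m F *: 'X^(m ord0))) x y =
  \sum_(m <- s) phi (mcoeff m F) * (x ^+ m ord0 * y ^+ m ord_max).
  elim=> [|m s IH] hs; first by rewrite !big_nil; apply: big1 => i _; rewrite coef0 !mul0r.
  rewrite !big_cons homD IH; last by move=> z zs; apply: hs; rewrite inE zs orbT.
  congr (_ + _); rewrite map_polyZ homZ map_polyXn.
  have := mE m (hs m (mem_head _ _)) => e.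
  by rewrite homXn -?e ?leq_addr // addKn.
by move=> /(_ (msupp F)); rewrite big_seq [in RHS]big_seq; apply.
Qed.

Lemma prod2 (A : comNzRingType) (G : 'I_2 -> A) : \prod_(i < 2) G i = G ord0 * G ord_max.
Proof. by rewrite big_ord_recl big_ord1; congr (_ * G _); exact: val_inj. Qed.

Lemma binary_eval_dehomog n (F : {binary int}) x y :
  is_form n F -> binary_eval F x y = hom n (dehomog F) x y.
Proof.
move=> hF; have := @hom_dehomog int idfun n F x y hF; rewrite map_poly_id // => ->.
by rewrite /binary_eval mevalE; apply: eq_bigr => m _; rewrite prod2.
Qed.

Definition homog (d : nat) (g : {poly rat}) : {binary rat} :=
  hom d (map_poly (@mpolyC 2 rat) g) (mpolyX rat (mnm1 ord0)) (mpolyX rat (mnm1 ord_max)).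

Lemma homogM d1 d2 (g h : {poly rat}) : (size g <= d1.+1)%N -> (size h <= d2.+1)%N ->
  homog (d1 + d2) (g * h) = homog d1 g * homog d2 h.
Proof.
by move=> sg sh; rewrite /homog rmorphM /= homM // (leq_trans (size_poly _ _)).
Qed.

Lemma homog_nunit d g : (0 < d)%N -> homog d g \isn't a GRing.unit.
Proof.
move=> d0; apply/negP => u.
have := congr1 (meval (fun _ : 'I_2 => 0 : rat)) (mulrV u).
rewrite rmorphM rmorph1 /homog (hom_map (meval (fun _ : 'I_2 => 0 : rat))) /= !mevalXU.
by rewrite hom00 // mul0r => /esym/eqP; rewrite oner_eq0.
Qed.

Lemma homog_dehomog n (F : {binary int}) : is_form n F ->
  map_mpoly (intr : int -> rat) F = homog n (map_poly intr (dehomog F)).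
Proof.
move=> hF; rewrite /homog -map_poly_comp.
rewrite (@hom_dehomog _ (@mpolyC 2 rat \o intr : {rmorphism int -> mpoly 2 rat}) n F _ _ hF).
rewrite {1}[F]mpolyE rmorph_sum /=; apply: eq_bigr => m _.
rewrite map_mpolyZ map_mpolyX mul_mpolyC mpolyXE_id prod2.
by [].
Qed.

(** A degree below n would make F divisible by y, and a factor over the rationals homogenizes to a
    factor of F. Forms of positive degree vanish at the origin, so they are not units. *)
Lemma dehomog_irreducible n (F : {binary int}) : (1 < n)%N -> is_form n F -> irreducible_form F ->
  size (dehomog F) = n.+1 /\ irreducible_poly (map_poly (intr : int -> rat) (dehomog F)).
Proof.
move=> n1 hF [F0 _ irr]; rewrite (homog_dehomog hF) in F0 irr.
set f := map_poly _ _ in F0 irr *.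
have sf : size f = size (dehomog F) by apply: size_map_inj_poly => //; exact: intr_inj.
have sle : (size f <= n.+1)%N.
  rewrite sf; apply: (leq_trans (size_sum _ _ _)); apply/bigmax_leqP_seq => m mF _.
  apply: leq_trans (size_scale_leq _ _) _; rewrite size_polyXn ltnS.
  by move/dhomogP: hF => /(_ m mF) /= <-; rewrite mdegE (bigD1 ord0) //= leq_addr.
have f0 : f != 0.
  apply: contraNneq F0 => ->; rewrite /homog map_poly0; apply/eqP.
  by apply: big1 => i _; rewrite coef0 !mul0r.
have sn : size f = n.+1.
  apply/eqP; rewrite eqn_leq sle ltnNge; apply/negP => sn.
  (* [homog 1 1] is the variable y. *)
  have := irr (homog 1 1) (homog n.-1 f).
  rewrite -homogM ?size_poly1 ?prednK ?(ltnW n1) // mul1r add1n prednK ?(ltnW n1) //.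
  case=> // u; move: u; apply/negP; apply: homog_nunit => //.
  by rewrite -ltnS prednK // ltnW.
rewrite -sf; split => //; split; first by rewrite sn ltnS ltnW.
move=> q q1 /dvdpP[h hE].
have h0 : h != 0 by apply: contraNneq f0 => h0; rewrite hE h0 mul0r.
have q0 : q != 0 by apply: contraNneq f0 => q0; rewrite hE q0 mulr0.
have shq : (size h + size q).-1 = n.+1 by rewrite -sn hE size_mul.
have sh0 : (0 < size h)%N by rewrite lt0n size_poly_eq0.
have sq0 : (0 < size q)%N by rewrite lt0n size_poly_eq0.
have dE : ((size h).-1 + (size q).-1 = n)%N by move: shq sh0 sq0; clear; lia.
have := irr (homog (size h).-1 h) (homog (size q).-1 q).
rewrite -homogM ?prednK // dE hE => /(_ erefl)[] u.
  have sh1 : size h = 1%N.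
    move: u; case E: (size h).-1 => [|d]; first by move: sh0 E; clear; lia.
    by move=> u; have := homog_nunit h (isT : (0 < d.+1)%N); rewrite u.
  rewrite -dvdp_size_eqp ?dvdp_mull // -hE sn; move: dE sq0; rewrite sh1 => dE sq0.
  by rewrite -dE /= prednK.
move: u; case E: (size q).-1 => [|d].
  by move: q1; have -> : size q = 1%N by move: sq0 E; clear; lia.
by move=> u; have := homog_nunit q (isT : (0 < d.+1)%N); rewrite u.
Qed.

(** A polynomial not divisible by f over the rationals is coprime to f and shares no root with it.
    For the derivative of f this gives distinct roots, for an arbitrary g conjugacy. *)
Lemma irreducible_good_form (R : rcfType) n (f : {poly int}) :
  size f = n.+1 -> (0 < n)%N -> irreducible_poly (map_poly (intr : int -> rat) f) ->
  exists al : 'I_n -> R[i], good_form f al.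
Proof.
move=> sf n0 irr.
pose toC (g : {poly int}) : {poly R[i]} := map_poly intr g.
have toCE g : toC g = map_poly ratr (map_poly (intr : int -> rat) g).
  by rewrite -map_poly_comp; apply: eq_map_poly => z /=; rewrite ratr_int.
have [r rE] := closed_field_poly_normal (toC f).
have scf : size (toC f) = n.+1 by rewrite size_map_inj_poly //; exact: intr_inj.
have lc0 : lead_coef (toC f) != 0 by rewrite lead_coef_eq0 -size_poly_eq0 scf.
have sr : size r = n.
  by move: scf; rewrite rE size_scale // size_prod_XsubC => -[].
have cop (g : {poly int}) z : ~~ (map_poly (intr : int -> rat) f %| map_poly intr g) ->
    root (toC f) z -> (toC g).[z] != 0.
  move=> nd; apply: coprimep_root.
  by rewrite !toCE coprimep_map (irreducible_poly_coprime _ irr).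
have ur : uniq r.
  rewrite -[uniq r]negbK; apply/negP => nu.
  have [z [s1 [s2 [s3 rz]]]] : exists z s1 s2 s3, r = s1 ++ z :: s2 ++ z :: s3.
    elim: {sr rE} r nu => // z r IH; rewrite cons_uniq negb_and negbK => /orP[zr|/IH].
      by have [s1 s2] := splitPr zr; exists z, [::], s1, s2.
    by case=> [z' [s1 [s2 [s3 ->]]]]; exists z', (z :: s1), s2, s3.
  pose P := lead_coef (toC f) *: (\prod_(z <- s1 ++ s2 ++ s3) ('X - z%:P)).
  have fP : toC f = ('X - z%:P) ^+ 2 * P.
    rewrite rE {1}rz /P -scalerAr; congr (_ *: _).
    by rewrite !big_cat /= !big_cons !big_cat /= !big_cons; ring.
  have rz' : root (toC f) z by rewrite fP rootM expr2 rootM root_XsubC eqxx.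
  have : (toC f^`()).[z] = 0.
    have -> : toC f^`() = (toC f)^`() by rewrite /toC deriv_map.
    by rewrite fP expr2 -mulrA derivM hornerD !hornerM hornerXsubC subrr !mul0r mulr0 addr0.
  apply/eqP; apply: cop rz'; apply/negP => /dvdp_leq.
  have inj0 (g : {poly int}) : size (map_poly (intr : int -> rat) g) = size g.
    by apply: size_map_inj_poly => //; exact: intr_inj.
  have f0 : f != 0 by rewrite -size_poly_eq0 sf.
  have df0 : f^`() != 0.
    apply/eqP => e; have := congr1 (fun p : {poly int} => p`_n.-1) e.
    rewrite coef_deriv coef0 prednK // => /eqP; rewrite mulrn_eq0 gtn_eqF //=.
    by have := lead_coef_eq0 f; rewrite lead_coefE sf /= => ->; rewrite (negPf f0).
  rewrite !inj0 -size_poly_eq0 inj0 size_poly_eq0 df0 => /(_ isT).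
  by rewrite leqNgt lt_size_deriv.
pose al (i : 'I_n) := r`_i.
have prodE : \prod_(z <- r) ('X - z%:P) = \prod_(i < n) ('X - (al i)%:P).
  by rewrite (big_nth 0) sr big_mkord.
have spl : splits_as f al.
  split => //.
    by move=> i j /eqP; rewrite nth_uniq ?sr // => /eqP/val_inj.
  by rewrite -prodE [LHS]rE lead_coef_map_inj //; exact: intr_inj.
have rt i : root (toC f) (al i).
  by rewrite rE rootZ // root_prod_XsubC mem_nth ?sr.
exists al; split => // g i j gi.
have [/dvdpP[h hE]|nd] := boolP (map_poly (intr : int -> rat) f %| map_poly intr g).
  rewrite -[map_poly intr g]/(toC g) toCE hE rmorphM /= -toCE hornerM.
  by have /rootP-> := rt j; rewrite mulr0.
by have := cop g _ nd (rt i); rewrite /toC gi eqxx.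
Qed.

(** * The count of solutions *)

Local Open Scope classical_set_scope.
Local Open Scope ring_scope.

(** By coprimality the coordinates of p and q divide each other, so they agree up to signs;
    proportionality makes the signs equal unless a coordinate is 0. *)
Lemma coprimez_prop (p q : int * int) : coprimez p.1 p.2 -> coprimez q.1 q.2 ->
  ~~ nonprop p q -> q = p \/ q = - p.
Proof.
case: p q => x y [x' y'] /= cp cq; rewrite negbK subr_eq0 => /eqP /= e.
have dvd_eq (a b : int) : (a %| b)%Z -> (b %| a)%Z -> b = a \/ b = - a.
  rewrite !dvdzE => h1 h2; have /eqP : `|a|%N == `|b|%N by rewrite eqn_dvd h1.
  by clear; lia.
have [hx|hx] : x' = x \/ x' = - x.
- apply: dvd_eq; first by rewrite -(Gauss_dvdzl _ cp) -e dvdz_mulr.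
  by rewrite -(Gauss_dvdzl _ cq) e dvdz_mulr.
- have [hy|hy] : y' = y \/ y' = - y.
  + apply: dvd_eq.
      by rewrite -(Gauss_dvdzr (m := y) (n := x)) ?e ?dvdz_mull // coprimez_sym.
    by rewrite -(Gauss_dvdzr (m := y') (n := x')) -?e ?dvdz_mull // coprimez_sym.
  + by left; rewrite hx hy.
  have /eqP : x * y = 0 by move: e; rewrite hx hy; clear; lia.
  rewrite mulf_eq0 => /orP[]/eqP z; rewrite hx hy z.
    by right; rewrite -[RHS]/(- 0, - y) oppr0.
  by left; rewrite oppr0.
have [hy|hy] : y' = y \/ y' = - y.
- apply: dvd_eq.
    by rewrite -(Gauss_dvdzr (m := y) (n := x)) ?e ?dvdz_mull // coprimez_sym.
  by rewrite -(Gauss_dvdzr (m := y') (n := x')) -?e ?dvdz_mull // coprimez_sym.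
- have /eqP : x * y = 0 by move: e; rewrite hx hy; clear; lia.
  rewrite mulf_eq0 => /orP[]/eqP z; rewrite hx hy z.
    by left; rewrite oppr0.
  by right; rewrite -[RHS]/(- x, - 0) oppr0.
by right; rewrite hx hy.
Qed.

(** The bound yields finiteness too: an infinite set has finite subsets of every size. *)
Lemma card_at_most_fsets (R : realType) (T : choiceType) (A : set T) (b : R) :
  0 <= b -> (forall B : {fset T}, [set` B] `<=` A -> (#|` B|)%fset%:R <= b) ->
  card_at_most A b.
Proof.
move=> b0 h; have fA : finite_set A.
  apply: contrapT => /(@infinite_set_fset _ _ (Num.truncn b).+1)[B BA].
  rewrite -(ler_nat R) => /le_trans /(_ (h B BA)); rewrite leNgt => /negP; apply.
  by have /andP[] := truncn_itv b0.
by split => //; apply: h; rewrite fset_setK.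
Qed.

Theorem theorem1p5 (R : realType) (n : nat) (F : {binary int}) (m p2 : nat)
    (hn : (3 <= n)%N) (hF : is_form n F) (hirr : irreducible_form F)
    (hm : (0 < m)%N)
    (hp2 : smallest_prime_ge
      (m%:R `^ (4 / n%:R) * (7 / 2) ^+ 2 * n%:R `^ (2 / (n%:R - 1)) : R) p2) :
  card_at_most (primitive_solutions_mod_sign F m)
    ((p2%:R + 1) * (9 * n%:R + 4 / (n%:R - 1)) : R).
Proof.
have [pp hp _] := hp2.
have [sf irr] := dehomog_irreducible (ltnW hn) hF hirr.
have [al gf] := irreducible_good_form R sf (ltnW (ltnW hn)) irr.
have n1 : 0 <= n%:R - 1 :> R by rewrite subr_ge0 ler1n (ltnW (ltnW hn)).
apply: card_at_most_fsets => [|B BA].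
  by apply: mulr_ge0; [exact: addr_ge0 | apply: addr_ge0; [exact: mulr_ge0 | exact: divr_ge0]].
(* One solution is picked in each class; by [coprimez_prop] those of distinct classes are not
   proportional. *)
have /choice[rep hrep] (c : set (int * int)) : exists xy : int * int,
    c \in B -> primitive_solutions F m xy /\ c = [set xy; - xy].
  case cB: (c \in B); last by exists (0, 0).
  by have [xy sxy <-] := BA c cB; exists xy.
rewrite -(size_map rep); apply: (count_all hn gf hm pp hp).
have sols c : c \in B -> primsol n (dehomog F) m%:Z (rep c).
  move=> /hrep[[h1 h2] _]; split; first by apply/eqP.
  by rewrite -(binary_eval_dehomog _ _ hF).
split.
- rewrite map_inj_in_uniq ?fset_uniq // => c d cB dB e.
  have [_ ->] := hrep c cB; have [_ ->] := hrep d dB; by rewrite e.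
- by move=> _ /mapP[c cB ->]; exact: sols.
move=> _ _ /mapP[c cB ->] /mapP[d dB ->] cd; apply: contraT => np.
have [c1 _] := sols c cB; have [d1 _] := sols d dB.
have cE := (hrep c cB).2; have dE := (hrep d dB).2.
have cd' : c = d.
  rewrite cE dE; have [->|->] := coprimez_prop c1 d1 np => //.
  by rewrite opprK setUC.
by move: cd; rewrite cd' eqxx.
Qed.
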